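(* If $\mathcal{Q}_H^p(\mu,\nu)\neq\emptyset$, then $\mu-\nu\in(HW^{1,q})'_\diamond(\Omega)$. More precisely, for every $Q\in\mathcal{Q}_H^p(\mu,\nu)$, the vector horizontal traffic intensity $\mathbf{w}_Q$ belongs to $L^p(\Omega,H\Omega)$ and satisfies $\mathrm{div}_H\mathbf{w}_Q=\mu-\nu$, and $|\mathbf{w}_Q|_H\le i_Q$. Therefore, $$\inf_{\mathbf{w}\in L^p(\Omega,H\Omega)}\left\{\int_\Omega G(x,|\mathbf{w}(x)|_H)\,dx:\ \mathrm{div}_H\mathbf{w}=\mu-\nu\right\}\ \le\ \inf_{Q\in\mathcal{Q}_H^p(\mu,\nu)}\int_\Omega G(x,i_Q(x))\,dx.$$
   Context: Let $n\ge1$. $\mathbb{H}^n$ is $\mathbb{R}^{2n+1}$ with the horizontal vector fields $X_j=\partial_{x_j}-\frac{x_{n+j}}{2}\partial_{x_{2n+1}}$, $X_{n+j}=\partial_{x_{n+j}}+\frac{x_j}{2}\partial_{x_{2n+1}}$ ($j=1,\dots,n$). The norm $|\cdot|_H$ and inner product $\langle\cdot,\cdot\rangle_H$ on $H_x\mathbb{H}^n=\mathrm{span}\{X_1(x),\dots,X_{2n}(x)\}$ make $X_1,\dots,X_{2n}$ orthonormal. $\nabla_H\varphi=\sum_{i=1}^{2n}X_i\varphi\,X_i$ (distributional). A curve $\sigma\in AC([0,1],\mathbb{R}^{2n+1})$ is horizontal if $\dot\sigma(t)\in H_{\sigma(t)}\mathbb{H}^n$ for a.e. $t$; $d_{SR}(x,y)$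 is the infimum of $\int_0^1|\dot\sigma|_Hdt$ over horizontal curves from $x$ to $y$; $\ell(\sigma)$ is the metric length of a continuous curve with respect to $d_{SR}$ (equal to $\int_0^1|\dot\sigma|_Hdt$ for horizontal $\sigma$). $\Omega\subset\mathbb{H}^n$ is a bounded domain with $C^{1,1}$ boundary (Euclidean sense); $\mu,\nu\in\mathcal{P}(\overline\Omega)$; $1<p<\infty$, $q=p/(p-1)$. $HW^{1,q}(\Omega)=\{\varphi\in L^q(\Omega):\nabla_H\varphi\in L^q(\Omega,H\Omega)\}$ with norm $\|\varphi\|_{L^q}+\|\nabla_H\varphi\|_{L^q}$; $(HW^{1,q})'_\diamond(\Omega)=\{f\in(HW^{1,q}(\Omega))':\langle f,1\rangle=0\}$. $L^p(\Omega,H\Omega)$ is the space of $p$-summable horizontal vector fields. For $\mathbf{w}\in L^p(\Omega,H\Omega)$, $\langle\mathrm{div}_H\mathbf{w},\varphi\rangle=-\int_\Omega\langle\nabla_H\varphi,\mathbf{w}\rangle_Hdx$, for $\varphi\in C^\infty(\mathbb{H}^n)$ and, by extension, $\varphi\in HW^{1,q}(\Omega)$. The measure $\mu-\nu$ is identified with the functional $\varphi\mapsto\int_{\overline\Omega}\varphi\,d(\mu-\nu)$ on $C^\infty(\mathbb{H}^n)$; it is said to be in $(HW^{1,q}(\Omega))'$ if it extends continuously. $C([0,1],\overline\Omega)$ has the uniform topology; $e_t(\sigma)=\sigma(t)$; $H$ is the set of horizontal curves in $AC([0,1],\overline\Omega)$. $\mathcal{Q}_H(\mu,\nu)$ is the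 set of Borel probability measures $Q$ on $C([0,1],\overline\Omega)$ (horizontal traffic plans) with $\int\ell\,dQ<+\infty$, $Q$ concentrated on $H$, $(e_0)_\#Q=\mu$, $(e_1)_\#Q=\nu$. The horizontal traffic intensity $i_Q\in\mathcal{M}_+(\overline\Omega)$ is defined by $\int\varphi\,di_Q=\int\left(\int_0^1\varphi(\sigma(t))|\dot\sigma(t)|_Hdt\right)dQ(\sigma)$, $\varphi\in C(\overline\Omega)$, and the vector horizontal traffic intensity $\mathbf{w}_Q$ (an $\mathbb{R}^{2n}$-valued, i.e. $H\overline\Omega$-valued, finite Radon measure) by $\int\phi\cdot d\mathbf{w}_Q=\int\left(\int_0^1\langle\phi(\sigma(t)),\dot\sigma(t)\rangle_Hdt\right)dQ(\sigma)$ for continuous horizontal vector fields $\phi$ on $\overline\Omega$. $\mathcal{Q}_H^p(\mu,\nu)=\{Q\in\mathcal{Q}_H(\mu,\nu):i_Q\in L^p(\Omega)\}$ (i.e. $i_Q$ is absolutely continuous with $L^p$ density, also denoted $i_Q$). $G:\overline\Omega\times[0,\infty)\to\mathbb{R}$ satisfies: $x\mapsto G(x,i)$ is Lebesgue measurable for all $i$; $G(x,0)=0$ for all $x$; $i\mapsto G(x,i)$ is convex and non-decreasing for all $x$; and $\frac{a}{p}i^p-h_0(x)\le G(x,i)\le\frac{b}{p}i^p+h_1(x)$ for all $(x,i)$, for some $a,b>0$ and $h_0,h_1\in L^p(\Omega,\mathbb{R}_+)$. *)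

(* Defs.v *)
From HB Require Import structures.
From mathcomp Require Import all_boot all_order all_algebra.
From mathcomp Require Import all_classical all_reals all_analysis.
From mathcomp Require Import measurable_realfun.

Set Implicit Arguments.
Unset Strict Implicit.
Unset Printing Implicit Defensive.

Import Order.TTheory GRing.Theory Num.Theory.
Import numFieldNormedType.Exports.

Local Open Scope classical_set_scope.
Local Open Scope ring_scope.

Notation borel T := (g_sigma_algebraType (@open T)).

Section lebesgue_rV.
Context {R : realType}.

Lemma coord_measurable m (j : 'I_m) :
  measurable_fun [set: borel 'rV[R]_m] (fun v : borel 'rV[R]_m => v ord0 j).
Proof.
apply: (measurability _ (RGenOpens.measurableE R)) => _ [_ [a [b ->]] <-].
rewrite setTI; apply: sub_sigma_algebra.
have := @coord_continuous R 1 m ord0 j.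
by move=> /continuousP; apply; exact: interval_open.
Qed.

Lemma measurable_fun_rV d (T : measurableType d) m (f : T -> borel 'rV[R]_m) :
  (forall j, measurable_fun setT (fun x => f x ord0 j)) ->
  measurable_fun setT f.
Proof.
move=> mf; apply: (@measurability _ _ T (borel 'rV[R]_m) setT f (@open 'rV[R]_m)).
  by [].
move=> _ [U oU <-]; rewrite setTI.
pose c (a : 'rV[rat]_m) : 'rV[R]_m := map_mx ratr a.
pose B (a : 'rV[rat]_m * nat) : set 'rV[R]_m := ball (c a.1) a.2.+1%:R^-1.
pose F (k : nat) : set T := if unpickle k is Some a then
  if `[< B a `<=` U >] then f @^-1` B a else set0 else set0.
have -> : f @^-1` U = \bigcup_k F k.
  apply/seteqP; split => [x Ux|x [k _]]; last first.
    rewrite /F; case: (unpickle k) => // a; case: asboolP => // BU Bx.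
    exact: BU.
  have : nbhs (f x : 'rV[R]_m) U by exact: open_nbhs_nbhs.
  move=> /nbhs_ballP[e /= e0 eU].
  have [k ke] : exists k, k.+1%:R^-1 < e / 2.
    have [k] := @ltr_add_invr R 0 (e / 2) (divr_gt0 e0 (ltr0n R 2)).
    by rewrite add0r; exists k.
  have k0 : 0 < k.+1%:R^-1 :> R by rewrite invr_gt0.
  have H (j : 'I_m) : {q : rat |
      ball (ratr q : R) k.+1%:R^-1 (f x ord0 j)}.
    have /rat_in_itvoo /cid[q] :
      f x ord0 j - k.+1%:R^-1 < f x ord0 j + k.+1%:R^-1.
      by rewrite ltrD2l gtrN.
    rewrite in_itv/= => qx; exists q.
    by rewrite /ball/= distrC ltr_distlC.
  pose a : 'rV[rat]_m := \row_j sval (H j).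
  have Bax : B (a, k) (f x).
    split => // i j; rewrite /c !mxE (ord1 i).
    exact: (svalP (H j)).
  exists (pickle (a, k)) => //; rewrite /F pickleK; case: asboolP => // -[] y yB.
  apply: eU; apply: (@le_ball _ _ _ (k.+1%:R^-1 + k.+1%:R^-1)).
    by rewrite (splitr e) lerD// ltW.
  apply: ball_triangle yB; exact: ball_sym.
apply: bigcupT_measurable => k; rewrite /F.
case: (unpickle k) => // a; case: asboolP => // _.
have -> : f @^-1` B a =
    \bigcap_(j : 'I_m) ((fun x => f x ord0 j) @^-1`
      ball (c a.1 ord0 j) a.2.+1%:R^-1).
  apply/seteqP; split => [x [_ Bx] j _|x Bx]; first exact: Bx.
  by split=> [|i j]; [rewrite invr_gt0|rewrite (ord1 i); exact: Bx].
apply: fin_bigcap_measurable => // j _.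
rewrite -[X in measurable X]setTI; apply: mf => //.
exact: measurable_ball.
Qed.

Definition cons_rV m (tv : measurableTypeR R * borel 'rV[R]_m) : borel 'rV[R]_m.+1 :=
  row_mx (tv.1%:M : 'rV[R]_1) tv.2.

Let measurable_cons m : measurable_fun setT (@cons_rV m).
Proof.
apply: measurable_fun_rV => j; rewrite /cons_rV.
under eq_fun do rewrite mxE.
case: (@fintype.split 1 m j) => i.
- by under eq_fun do rewrite (ord1 i) mxE; exact: measurable_fst.
- exact: (measurableT_comp (coord_measurable i) measurable_snd).
Qed.

Section step.
Context {m : nat} (l : {sigma_finite_measure set (borel 'rV[R]_m) -> \bar R}).

Definition lebesgue_step : set (borel 'rV[R]_m.+1) -> \bar R :=
  pushforward (lebesgue_measure \x l)%E (@cons_rV m).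

Let step0 : lebesgue_step set0 = 0%E.
Proof. by rewrite /lebesgue_step /pushforward preimage_set0 measure0. Qed.

Let step_ge0 A : (0 <= lebesgue_step A)%E.
Proof. exact: measure_ge0. Qed.

Let step_sigma_additive : semi_sigma_additive lebesgue_step.
Proof.
move=> F mF tF mUF; rewrite /lebesgue_step /pushforward preimage_bigcup.
have mcF k : measurable (@cons_rV m @^-1` F k).
  by rewrite -[X in measurable X]setTI; exact: measurable_cons.
apply: measure_semi_sigma_additive => //.
- apply/trivIsetP => /= i j _ _ ij; rewrite -preimage_setI.
  by move/trivIsetP : tF => /(_ _ _ _ _ ij) ->//; rewrite preimage_set0.
- exact: bigcupT_measurable.
Qed.

HB.instance Definition _ := isMeasure.Build _ _ _ lebesgue_step
  step0 step_ge0 step_sigma_additive.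

Let step_sigma_finite : sigma_finite setT lebesgue_step.
Proof.
have /sigma_finiteP[E [TE ndE Eoo]] := sigma_finiteT (@lebesgue_measure R).
have /sigma_finiteP[G [TG ndG Goo]] := sigma_finiteT l.
pose F k := E k `*` G k.
have FT : setT = \bigcup_k F k.
  rewrite -setXTT TE TG predeqE => -[x y]; split.
    move=> [/= [i _ Ex] [j _ Gy]]; exists (maxn i j) => //; split.
    - by move: x Ex; exact/subsetPset/ndE/leq_maxl.
    - by move: y Gy; exact/subsetPset/ndG/leq_maxr.
  by move=> [i _ []/= ? ?]; split; exists i.
have mF k : measurable (F k) /\ ((lebesgue_measure \x l) (F k) < +oo)%E.
  have [? ?] := Eoo k; have [? ?] := Goo k; split; first exact: measurableX.
  by rewrite product_measure1E// lte_mul_pinfty// ge0_fin_numE.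
pose u (x : borel 'rV[R]_m.+1) : measurableTypeR R * borel 'rV[R]_m :=
  (x ord0 ord0, \row_j x ord0 (lift ord0 j)).
have uK : cancel (@cons_rV m) u.
  move=> [t v]; rewrite /u /cons_rV/=; congr pair.
    by rewrite mxE; case: splitP => // i _; rewrite (ord1 i) mxE.
  apply/rowP => j; rewrite !mxE; case: splitP => [i|i /=]; first by rewrite (ord1 i).
  by move=> [ij]; congr (v _ _); apply: val_inj.
have mu_ : measurable_fun setT u.
  apply/prod_measurable_funP; split; first exact: coord_measurable.
  apply: measurable_fun_rV => j; under eq_fun do rewrite mxE.
  exact: coord_measurable.
exists (fun k => u @^-1` F k).
  by rewrite -preimage_bigcup -FT preimage_setT.
move=> k; split; first by rewrite -[X in measurable X]setTI; exact: mu_ (mF k).1.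
rewrite /lebesgue_step /pushforward -comp_preimage.
have -> : u \o @cons_rV m = id by apply/funext => x; exact: uK.
exact: (mF k).2.
Qed.

HB.instance Definition _ := @Measure_isSigmaFinite.Build _ _ _ lebesgue_step
  step_sigma_finite.

End step.

(* Lebesgue measure on R^m, as an iterated product, on the Borel sets. *)
Fixpoint lebesgue_rV m : {sigma_finite_measure set (borel 'rV[R]_m) -> \bar R} :=
  match m with
  | 0 => \d_(0 : borel 'rV[R]_0)
  | k.+1 => lebesgue_step (lebesgue_rV k)
  end.

End lebesgue_rV.
Arguments lebesgue_rV : clear implicits.

Notation heis R n := ('rV[R]_(n + n + 1)).
Notation horiz R n := ('rV[R]_(n + n)).

Section euclidean.
Context {R : realType}.

Fixpoint Ck m k (f : 'rV[R]_m -> R) : Prop :=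
  continuous f /\
  if k is k'.+1 then
    forall i, (forall x, derivable f x (delta_mx ord0 i)) /\
              Ck k' ('D_(delta_mx ord0 i) f)
  else True.

Definition smooth m (f : 'rV[R]_m -> R) := forall k, Ck k f.

Definition C11 m (f : 'rV[R]_m -> R) :=
  (forall x, differentiable f x) /\
  forall i, [lipschitz 'D_(delta_mx ord0 i) f x | x in [set: 'rV[R]_m]].

(* After a rotation O, the set is near each boundary point the strict epigraph
   of a C^{1,1} function of the first m coordinates. *)
Definition C11_boundary m (A : set 'rV[R]_(m + 1)) :=
  forall x0, (closure A `\` A^°) x0 ->
  exists (O : 'M[R]_(m + 1)) (r : R) (g : 'rV[R]_m -> R),
    [/\ O *m O^T = 1%:M, 0 < r, C11 g &
      forall x, ball x0 r x ->
        (A x <-> g (lsubmx (x *m O)) < rsubmx (x *m O) ord0 ord0)].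

Definition abs_continuous01 m (g : R -> 'rV[R]_m) :=
  forall e : R, 0 < e -> exists2 d : R, 0 < d &
    forall (k : nat) (a b : 'I_k -> R),
      (forall i, 0 <= a i /\ a i <= b i /\ b i <= 1) ->
      (forall i j, i != j -> b i <= a j \/ b j <= a i) ->
      \sum_(i < k) (b i - a i) < d ->
      \sum_(i < k) `|g (b i) - g (a i)| < e.

(* Measurability for the completion of Lebesgue measure.  The library integral is
   built from Borel simple functions below the positive and negative parts, so
   integrating such an f against lebesgue_rV still gives its Lebesgue
   integral. *)
Definition lebesgue_measurable_fun m (D : set 'rV[R]_m) (f : 'rV[R]_m -> R) :=
  measurable_fun
    (D : set (g_sigma_algebraType (completed_algebra_gen (lebesgue_rV R m)))) f.

(* f is a representative on D of an element of the library's L^p; functions are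
   only relevant on D. *)
Definition Lp m (D : set 'rV[R]_m) (p : R) (f : 'rV[R]_m -> R) :=
  exists2 g : borel 'rV[R]_m -> R, g \in Lfun (lebesgue_rV R m) p%:E &
    {ae lebesgue_rV R m, forall x, D x -> f x = g x}.

Definition Lp_norm m (D : set 'rV[R]_m) (p : R) (f : 'rV[R]_m -> R) : \bar R :=
  'N[lebesgue_rV R m]_(p%:E)[EFin \o (f \_ D)].

End euclidean.

Section heisenberg.
Context {R : realType} {n : nat}.
Implicit Types (x y v : heis R n) (c : horiz R n) (g : R -> heis R n).

(* Coordinates are (x_1..x_n, x_{n+1}..x_{2n}, x_{2n+1}). *)
Definition hfield (i : 'I_(n + n)) x : heis R n :=
  row_mx (delta_mx ord0 i)
    (match fintype.split i with
     | inl j => - (x ord0 (lshift 1 (rshift n j)) / 2)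
     | inr j => x ord0 (lshift 1 (lshift n j)) / 2
     end)%:M.

Definition hspace x : set (heis R n) :=
  [set v | exists c, v = \sum_i c ord0 i *: hfield i x].

(* Coordinates of a horizontal vector in the frame (X_1,...,X_2n), and the
   inner product and norm making this frame orthonormal. *)
Definition hcoord v : horiz R n := lsubmx v.

Lemma hcoordE x c : hcoord (\sum_i c ord0 i *: hfield i x) = c.
Proof.
rewrite /hcoord linear_sum/=; apply/rowP => k; rewrite summxE (bigD1 k)//= big1.
  by rewrite addr0 linearZ/= row_mxKl !mxE !eqxx mulr1.
by move=> i ik; rewrite linearZ/= row_mxKl !mxE eqxx/= eq_sym (negbTE ik) mulr0.
Qed.

Definition hdot c c' : R := \sum_i c ord0 i * c' ord0 i.
Definition hnorm c : R := Num.sqrt (hdot c c).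

Definition hderiv (i : 'I_(n + n)) (f : heis R n -> R) x : R :=
  'D_(hfield i x) f x.

Definition hgrad (f : heis R n -> R) x : horiz R n := \row_i hderiv i f x.

(* Horizontal velocity of a curve, in the frame. *)
Definition hspeed g (t : R) : horiz R n := hcoord (derive1 g t).

Definition horizontal g :=
  abs_continuous01 g /\
  {ae lebesgue_measure, forall t : R, t \in `[0, 1] ->
     derivable g t 1 /\ hspace (g t) (derive1 g t)}.

Definition d_SR x y : \bar R :=
  ereal_inf [set (\int[lebesgue_measure]_(t in `[0%R, 1%R]) (hnorm (hspeed g t))%:E)%E
            | g in [set g | horizontal g /\ g 0 = x /\ g 1 = y]].

(* Metric length for d_SR of the restriction of g to [0, 1]. *)
Definition mlength g : \bar R :=
  ereal_sup [set (\sum_(0 <= k < size s)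
                   d_SR (g (nth 1%R (0%R :: s) k)) (g (nth 1%R s k)))%E
            | s in itv_partition 0 1].

(* Horizontal vector fields are given by their coordinates in the frame. *)
Definition LpH (D : set (heis R n)) (p : R) (w : heis R n -> horiz R n) :=
  forall i, Lp D p (fun x => w x ord0 i).

Definition test_function (D : set (heis R n)) (psi : heis R n -> R) :=
  [/\ smooth psi, compact (closure [set x | psi x != 0]) &
      closure [set x | psi x != 0] `<=` D].

(* The fields X_i are divergence free, so that X_i^* = - X_i. *)
Definition weak_hgrad (D : set (heis R n)) (f : heis R n -> R)
    (w : heis R n -> horiz R n) :=
  forall i psi, test_function D psi ->
    \int[lebesgue_rV R (n + n + 1)]_(x in D) (f x * hderiv i psi x) =
    - \int[lebesgue_rV R (n + n + 1)]_(x in D) (w x ord0 i * psi x).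

(* f is in HW^{1,q}(D) with horizontal gradient w. *)
Definition HW_grad (D : set (heis R n)) (q : R) (f : heis R n -> R)
    (w : heis R n -> horiz R n) :=
  [/\ Lp D q f, LpH D q w & weak_hgrad D f w].

Definition HW (D : set (heis R n)) (q : R) : set (heis R n -> R) :=
  [set f | exists w, HW_grad D q f w].

(* Continuity for the norm of HW^{1,q}(D) forces invariance under modification
   on null sets and outside D. *)
Definition HW_dual (D : set (heis R n)) (q : R) : set ((heis R n -> R) -> R) :=
  [set L |
    (forall (a : R) f f', HW D q f -> HW D q f' ->
       L (fun x => a * f x + f' x) = a * L f + L f') /\
    exists C : R, forall f w, HW_grad D q f w ->
      (`|L f|%:E <= C%:E * (Lp_norm D q f + Lp_norm D q (hnorm \o w)))%E].

Definition HW_dual_diamond (D : set (heis R n)) (q : R) :=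
  [set L | HW_dual D q L /\ L (cst 1) = 0].

End heisenberg.

Record bounded_domain (R : realType) (m : nat) := BoundedDomain {
  dom_set :> set 'rV[R]_m ;
  dom_open : open dom_set ;
  dom_connected : connected dom_set ;
  dom_neq0 : dom_set !=set0 ;
  dom_bounded : bounded_set dom_set }.

Definition cldom (R : realType) m (Om : bounded_domain R m) : Type :=
  set_type (closure Om).

HB.instance Definition _ (R : realType) m (Om : bounded_domain R m) :=
  PseudoMetric.copy (cldom Om) (set_type (closure Om)).

Lemma dom_point_subproof (R : realType) m (Om : bounded_domain R m) :
  projT1 (cid (dom_neq0 Om)) \in closure Om.
Proof. by apply/mem_set/subset_closure; case: cid. Qed.

HB.instance Definition _ (R : realType) m (Om : bounded_domain R m) :=
  isPointed.Build (cldom Om)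
    (exist (fun x => x \in closure Om) _ (dom_point_subproof Om)).

Definition I01 (R : realType) : Type := set_type `[0 : R, 1]%classic.

HB.instance Definition _ (R : realType) :=
  PseudoMetric.copy (I01 R) (set_type `[0 : R, 1]%classic).

Section curves.
Context {R : realType} {m : nat} (Om : bounded_domain R m).

Definition curve : Type := continuousType (I01 R) (cldom Om).

Definition curve_fun (c : curve) : {uniform (I01 R) -> (cldom Om)} :=
  (c : continuousType (I01 R) (cldom Om)) : I01 R -> cldom Om.

HB.instance Definition _ :=
  Choice.copy curve (continuousType (I01 R) (cldom Om)).
HB.instance Definition _ :=
  Uniform.copy curve (initial_topology curve_fun).
HB.instance Definition _ := isPointed.Build curve (cst point).

Definition eval_at (t : I01 R) (c : curve) : cldom Om := curve_fun c t.

Definition clamp01 (t : R) : R := Num.min 1 (Num.max 0 t).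

Lemma clamp01_subproof (t : R) : clamp01 t \in `[0 : R, 1]%classic.
Proof.
apply/mem_set; rewrite /= in_itv/= /clamp01 le_min ler01 ge_min lexx/= le_max.
by rewrite lexx.
Qed.

Definition to01 (t : R) : I01 R :=
  exist (fun x => x \in `[0 : R, 1]%classic) _ (clamp01_subproof t).

(* The curve as a function on R, constant on each side of [0, 1]. *)
Definition curveR (c : curve) (t : R) : 'rV[R]_m := val (eval_at (to01 t) c).

End curves.

(* The integral against a signed measure, by its Jordan decomposition. *)
Definition charge_integral d (T : measurableType d) (R : realType)
    (nu : {charge set T -> \bar R}) (f : T -> \bar R) : \bar R :=
  let P := cid (Hahn_decomposition nu) in
  let N := cid (projT2 P) in
  (\int[jordan_pos (projT2 N)]_x f x - \int[jordan_neg (projT2 N)]_x f x)%E.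

Section traffic.
Context {R : realType} {n : nat} (Om : bounded_domain R (n + n + 1)).
Implicit Types (mu nu : probability (borel (cldom Om)) R).
Implicit Types (Q : probability (borel (curve Om)) R).
Implicit Types (f : heis R n -> R) (w : heis R n -> horiz R n).

Definition marginal (t : R) : borel (curve Om) -> borel (cldom Om) :=
  eval_at (to01 t).

Definition horizontal_traffic_plan mu nu Q :=
  [/\ (\int[Q]_c mlength (curveR c) < +oo)%E,
      {ae Q, forall c, horizontal (curveR c)},
      forall A, measurable A -> pushforward Q (marginal 0) A = mu A &
      forall A, measurable A -> pushforward Q (marginal 1) A = nu A].

Definition traffic_intensity Q
    (m : {finite_measure set (borel (cldom Om)) -> \bar R}) :=
  forall phi : cldom Om -> R, continuous phi ->
    (\int[m]_x (phi x)%:E =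
     \int[Q]_c \int[lebesgue_measure]_(t in `[0%R, 1%R])
        (phi (eval_at (to01 t) c) * hnorm (hspeed (curveR c) t))%:E)%E.

Definition vector_traffic_intensity Q
    (W : 'I_(n + n) -> {charge set (borel (cldom Om)) -> \bar R}) :=
  forall phi : cldom Om -> horiz R n, continuous phi ->
    (\sum_i charge_integral (W i) (fun x => (phi x ord0 i)%:E) =
     \int[Q]_c \int[lebesgue_measure]_(t in `[0%R, 1%R])
        (hdot (phi (eval_at (to01 t) c)) (hspeed (curveR c) t))%:E)%E.

(* The set function on the closure with density f on Om (and no mass on the
   boundary). *)
Definition density_integral f (A : set (cldom Om)) : \bar R :=
  (\int[lebesgue_rV R (n + n + 1)]_(x in (Om : set _) `&` (val @` A))
     (f x)%:E)%E.

(* The traffic intensity i_Q is in L^p(Om), with density f; since i_Q >= 0, this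
   forces f >= 0 almost everywhere on Om. *)
Definition intensity_density (p : R) Q f :=
  Lp Om p f /\
  exists2 m, traffic_intensity Q m &
    forall A, measurable (A : set (borel (cldom Om))) ->
      m A = density_integral f A.

(* The vector traffic intensity w_Q is in L^p(Om, H Om), with density w. *)
Definition vector_intensity_density (p : R) Q w :=
  LpH Om p w /\
  exists2 W, vector_traffic_intensity Q W &
    forall k A, measurable (A : set (borel (cldom Om))) ->
      W k A = density_integral (fun x => w x ord0 k) A.

Definition traffic_plan_p (p : R) mu nu : set (probability (borel (curve Om)) R) :=
  [set Q | horizontal_traffic_plan mu nu Q /\ exists f, intensity_density p Q f].

Definition measure_diff mu nu f : R :=
  \int[mu]_x f (val x) - \int[nu]_x f (val x).

(* mu - nu, a functional on smooth functions, extends to a functional in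
   (HW^{1,q})'_diamond(Om). *)
Definition in_HW_dual_diamond (q : R) mu nu :=
  exists2 L, HW_dual_diamond (Om : set _) q L &
    forall phi, smooth phi -> L phi = measure_diff mu nu phi.

(* div_H w = mu - nu. *)
Definition divH_eq w mu nu :=
  forall phi, smooth phi ->
    - (\int[lebesgue_rV R (n + n + 1)]_(x in Om) hdot (hgrad phi x) (w x)) =
    measure_diff mu nu phi.

End traffic.

(* Main.v *)
Require Import Defs.
From HB Require Import structures.
From mathcomp Require Import all_boot all_order all_algebra.
From mathcomp Require Import all_classical all_reals all_analysis.
From mathcomp Require Import ring lra measurable_realfun.

Import Order.TTheory GRing.Theory Num.Theory.
Import numFieldNormedType.Exports.

Set Implicit Arguments.
Unset Strict Implicit.
Unset Printing Implicit Defensive.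

Local Open Scope classical_set_scope.
Local Open Scope ring_scope.

(* The velocity of a curve has a version V that is jointly measurable in the curve and
   in time, so i_Q and w_Q are the images, under the evaluation (c, t) |-> c t, of the
   measures with densities |V| and V with respect to Q x dt.  Hence w_Q is absolutely
   continuous as soon as i_Q is, and integrating <c, V> <= |c| |V| for rational vectors
   c gives |w_Q| <= i_Q almost everywhere.  The divergence equation is the fundamental
   theorem of calculus for phi along the absolutely continuous horizontal curves,
   integrated against Q.  The functional f |-> - int <grad_H f, w_Q> then extends
   mu - nu to HW^{1,q}, by Hoelder's inequality and the uniqueness of weak gradients,
   and the inequality between the infima follows from the monotonicity of G. *)

(** * Integrals of arbitrary functions and image measures *)

(** Two measurability gaps shape the proof. [hspeed] is a derivative that exists only at almost
    every time on almost every curve, so Fubini does not apply directly to the iterated integrals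
    that define i_Q and w_Q; and the composite [G x (hnorm (w x))] need not be Borel. Both are met
    by comparing integrals almost everywhere, which works for arbitrary functions: [hspeed] is
    exchanged for V inside the iterated integrals before any use of Fubini, and the last inequality
    is a pointwise comparison under the integral.

    Moreover i_Q is prescribed only through continuous functions, while domination of measures
    concerns Borel sets. Smooth bumps that tend to indicators of open boxes bridge this, and the
    same bumps are the test functions behind the uniqueness of weak gradients. The L^p functions are
    replaced by Borel representatives that vanish exactly off Om: as Om has finite measure they are
    integrable, and integrals over Om become integrals over the whole space. *)

Section lower_integral.
Local Open Scope ereal_scope.
Context d (T : measurableType d) (R : realType).
Variable mu : {measure set T -> \bar R}.
Import HBNNSimple.

(** A simple function below [f] can be set to 0 on the exceptional null set: its integral is
    unchanged and it now lies below [g] everywhere, so it enters the supremum that defines the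
    integral of [g]. *)
Let ge0_le_integral_ae (f g : T -> \bar R) :
  (forall x, 0 <= f x) -> (forall x, 0 <= g x) ->
  {ae mu, forall x, f x <= g x} -> \int[mu]_x f x <= \int[mu]_x g x.
Proof.
move=> f0 g0 [N [mN muN fgN]].
rewrite !ge0_integralTE//; apply/ge_ereal_sup => _ [h hf <-].
pose h' := proj_nnsfun h (measurableC mN).
have hh' : sintegral mu h = sintegral mu h'.
  have := @integral_nnsfun _ _ _ mu setT measurableT h.
  have := @integral_nnsfun _ _ _ mu setT measurableT h'.
  rewrite !patch_setT => <- <-; apply: ae_eq_integral => //.
  - exact/measurable_EFinP.
  - exact/measurable_EFinP.
  - exists N; split => // x; apply: contra_notP => Nx _.
    by rewrite /h' /= mindicE mem_set// mulr1.
rewrite hh'; apply: ereal_sup_ubound; exists h' => // x /=.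
rewrite mindicE; case: (pselect (N x)) => Nx.
  by rewrite memNset ?mulr0//; exact.
rewrite mem_set// mulr1 (le_trans (hf x))//; apply: contrapT => fg.
by apply: Nx; apply: fgN.
Qed.

(* No measurability is assumed: the integral of the library is a lower
   integral on positive and on negative parts. *)
Lemma le_integral_ae (D : set T) (f g : T -> \bar R) :
  {ae mu, forall x, D x -> f x <= g x} ->
  \int[mu]_(x in D) f x <= \int[mu]_(x in D) g x.
Proof.
move=> fg; rewrite [leLHS]integral_mkcond [leRHS]integral_mkcond.
rewrite [leLHS]integralE [leRHS]integralE.
have fg' : {ae mu, forall x, (f \_ D) x <= (g \_ D) x}.
  apply: filterS fg => x fg; rewrite /patch; case: ifPn => //.
  by rewrite inE => /fg.
apply: leeB; apply: ge0_le_integral_ae => //;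
  apply: filterS fg' => x fgx.
- by rewrite !funeposE ge_max !le_max lexx orbT andbT fgx.
- by rewrite !funenegE ge_max !le_max lexx orbT andbT leeN2 fgx.
Qed.

Lemma eq_integral_ae (D : set T) (f g : T -> \bar R) :
  {ae mu, forall x, D x -> f x = g x} ->
  \int[mu]_(x in D) f x = \int[mu]_(x in D) g x.
Proof.
move=> fg; apply/eqP; rewrite eq_le.
by apply/andP; split; apply: le_integral_ae; apply: filterS fg => x fg Dx;
  rewrite fg.
Qed.

End lower_integral.

Section image_measure_of_density.
Local Open Scope ereal_scope.
Context d d' (P : measurableType d) (E : measurableType d') (R : realType).
Variable mu : {measure set P -> \bar R}.
Variables (e : P -> E) (me : measurable_fun [set: P] e).

Let mpre A : measurable A -> measurable (e @^-1` A).
Proof. by move=> mA; rewrite -[X in measurable X]setTI; exact: me. Qed.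

Section nonnegative.
Variables (g : P -> R) (mg : measurable_fun [set: P] g).
Hypothesis g0 : forall x, (0 <= g x)%R.

(** The proofs are arguments so that the measure structure attached below can be recovered from the
    term by unification. *)
Definition density_image of measurable_fun [set: P] e &
  measurable_fun [set: P] g & (forall x, 0 <= g x)%R : set E -> \bar R :=
  fun A => \int[mu]_(x in e @^-1` A) (g x)%:E.

Local Notation nu := (density_image me mg g0).

Let nu0 : nu set0 = 0.
Proof. by rewrite /density_image preimage_set0 integral_set0. Qed.

Let nu_ge0 A : 0 <= nu A.
Proof. by apply: integral_ge0 => x _; rewrite lee_fin. Qed.

Let nu_sigma_additive : semi_sigma_additive nu.
Proof.
move=> F mF tF mUF; rewrite /density_image preimage_bigcup.
apply: semi_sigma_additive_nng_induced => //.
- exact/measurable_EFinP.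
- by move=> i; exact: mpre.
- apply/trivIsetP => /= i j _ _ ij; rewrite -preimage_setI.
  by move/trivIsetP : tF => /(_ _ _ _ _ ij) ->//; rewrite preimage_set0.
- by rewrite -preimage_bigcup; exact: mpre.
Qed.

HB.instance Definition _ := isMeasure.Build _ _ _ nu nu0 nu_ge0
  nu_sigma_additive.

Import HBNNSimple.

(** Monotone convergence along simple functions reduces the formula to indicators, for which it is
    the definition of the image measure. *)
Lemma ge0_integral_density_image (f : E -> \bar R) :
  measurable_fun [set: E] f -> (forall y, 0 <= f y) ->
  \int[nu]_y f y = \int[mu]_x (f (e x) * (g x)%:E).
Proof.
move=> mf f0; pose f_ := nnsfun_approx measurableT mf.
have cvf y : (f_ n y)%:E @[n --> \oo] --> f y.
  exact: cvg_nnsfun_approx.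
have nd y (m n : nat) : (m <= n)%N -> (f_ m y <= f_ n y)%R.
  by move=> mn; exact/lefP/nd_nnsfun_approx.
transitivity (limn (fun n => \int[nu]_y (f_ n y)%:E)).
  rewrite -monotone_convergence//.
  - by apply: eq_integral => y _; apply/esym/cvg_lim.
  - by move=> n; exact/measurable_EFinP.
  - by move=> n y _; rewrite lee_fin.
  - by move=> y _ m n mn; rewrite lee_fin; exact: nd.
rewrite [X in limn X](_ : _ = (fun n =>
    \int[mu]_x ((f_ n (e x))%:E * (g x)%:E))); last first.
  apply/funext => n.
  have mI r : measurable (f_ n @^-1` [set r]) by [].
  have mIg r : measurable_fun [set: P]
      (fun x => (r * \1_(f_ n @^-1` [set r]) (e x))%:E * (g x)%:E).
    apply: emeasurable_funM; apply/measurable_EFinP => //.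
    apply: measurable_funM => //; apply: (measurableT_comp _ me).
    exact: measurable_indic.
  have Ig0 : forall s x, 0 <= (s * \1_(f_ n @^-1` [set s]) (e x))%:E * (g x)%:E.
    by move=> s x; rewrite mule_ge0 ?lee_fin//; exact: nnfun_muleindic_ge0.
  transitivity (\int[nu]_y (\sum_(r \in range (f_ n))
      (r * \1_(f_ n @^-1` [set r]) y)%:E)).
    by apply: eq_integral => y _; rewrite {1}fimfunE -fsumEFin.
  rewrite ge0_integral_fsum//; last 2 first.
  - by move=> r; apply/measurable_EFinP; exact: measurable_funM.
  - by move=> r y _; rewrite nnfun_muleindic_ge0.
  transitivity (\sum_(r \in range (f_ n)) \int[mu]_x
      ((r * \1_(f_ n @^-1` [set r]) (e x))%:E * (g x)%:E)).
    apply: eq_fsbigr => r; rewrite inE => -[y _ ry].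
    rewrite integralZl_indic_nnsfun// integral_indic// setIT.
    have r0 : (0 <= r)%R by rewrite -ry.
    under [RHS]eq_integral do rewrite EFinM -muleA.
    rewrite ge0_integralZl//; last 2 first.
    - apply: emeasurable_funM; apply/measurable_EFinP => //.
      by apply: (measurableT_comp _ me); exact: measurable_indic.
    - by move=> x _; rewrite mule_ge0// lee_fin.
    congr (_ * _); rewrite /= /density_image [LHS]integral_mkcond.
    apply: eq_integral => x _; rewrite patchE indicE.
    by rewrite -[_ \in e @^-1` _]/(e x \in f_ n @^-1` [set r]); case: ifP;
      rewrite ?mul1e ?mul0e.
  rewrite -ge0_integral_fsum//.
  apply: eq_integral => x _; rewrite -ge0_mule_fsuml; last first.
    by move=> r; exact: nnfun_muleindic_ge0.
  by rewrite fsumEFin// -fimfunE.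
rewrite -monotone_convergence//.
- by apply: eq_integral => x _; apply/cvg_lim => //; exact: cvgeZr.
- move=> n; apply: emeasurable_funM; apply/measurable_EFinP => //.
  by apply: (measurableT_comp _ me).
- by move=> n x _; rewrite mule_ge0// lee_fin.
- by move=> x _ m n mn; rewrite lee_wpmul2r ?lee_fin ?g0 ?nd.
Qed.

End nonnegative.
End image_measure_of_density.

Section bounded_integral.
Local Open Scope ereal_scope.
Context d (T : measurableType d) (R : realType).

Lemma bounded_integrable (m : {finite_measure set T -> \bar R}) (f : T -> R)
    (M : R) :
  measurable_fun [set: T] f -> (forall x, (`|f x| <= M)%R) ->
  m.-integrable [set: T] (EFin \o f).
Proof.
move=> mf fM; apply: measurable_bounded_integrable => //.
  by rewrite -ge0_fin_numE// fin_num_measure.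
by exists M; split; [exact: num_real|] => A MA x _ /=; rewrite (le_trans (fM x))// ltW.
Qed.

(** The integral against a difference of finite measures does not depend on the decomposition: the
    last hypothesis says that a + k and c + b are the same measure, and all integrals are finite. *)
Lemma integral_sub_measure (a b c k : {finite_measure set T -> \bar R})
    (f : T -> R) (M : R) :
  measurable_fun [set: T] f -> (forall x, (`|f x| <= M)%R) ->
  (forall A, measurable A -> a A - b A = c A - k A) ->
  \int[a]_x (f x)%:E - \int[b]_x (f x)%:E =
  \int[c]_x (f x)%:E - \int[k]_x (f x)%:E.
Proof.
move=> mf fM abck.
have intf (m : {finite_measure set T -> \bar R}) :
  m.-integrable [set: T] (EFin \o f) by exact: bounded_integrable fM.
have ifin (m : {finite_measure set T -> \bar R}) :
  \int[m]_x (f x)%:E \is a fin_num by exact: integrable_fin_num (intf m).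
have : \int[measure_add a k]_x (f x)%:E = \int[measure_add c b]_x (f x)%:E.
  apply: eq_measure_integral => A mA _; rewrite -[LHS]/(measure_add a k A) -[RHS]/(measure_add c b A) !measure_addE.
  rewrite -[LHS]/(a A + k A) -[RHS]/(c A + b A).
  have := abck A mA.
  rewrite -(fineK (fin_num_measure a _ mA)) -(fineK (fin_num_measure b _ mA)).
  rewrite -(fineK (fin_num_measure c _ mA)) -(fineK (fin_num_measure k _ mA)).
  by rewrite -!EFinB -!EFinD => -[h]; congr EFin; lra.
rewrite !integral_measure_add//; try exact: intf; try exact/measurable_EFinP.
rewrite -(fineK (ifin a)) -(fineK (ifin b)) -(fineK (ifin c)) -(fineK (ifin k)).
by rewrite -!EFinB -!EFinD => -[h]; congr EFin; lra.
Qed.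

End bounded_integral.

Section image_charge_of_density.
Local Open Scope ereal_scope.
Context d d' (P : measurableType d) (E : measurableType d') (R : realType).
Variable mu : {measure set P -> \bar R}.
Variables (e : P -> E) (me : measurable_fun [set: P] e).
Variables (g : P -> R) (ig : mu.-integrable [set: P] (EFin \o g)).

Definition charge_image of measurable_fun [set: P] e &
    mu.-integrable [set: P] (EFin \o g) : set E -> \bar R :=
  fun A => \int[mu]_(x in e @^-1` A) (g x)%:E.

Local Notation nu := (charge_image me ig).

Let mpre A : measurable A -> measurable (e @^-1` A).
Proof. by move=> mA; rewrite -[X in measurable X]setTI; exact: me. Qed.

Let nu0 : nu set0 = 0.
Proof. by rewrite /charge_image preimage_set0 integral_set0. Qed.

Let finnu A : measurable A -> nu A \is a fin_num.
Proof.
move=> mA; apply: integrable_fin_num => //; first exact: mpre.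
by apply: integrableS ig => //; exact: mpre.
Qed.

Let snu : semi_sigma_additive nu.
Proof.
move=> F mF tF mUF; rewrite /charge_image preimage_bigcup.
apply: (@charge_semi_sigma_additive _ _ _ (induced_charge ig)) => //.
- by move=> i; exact: mpre.
- apply/trivIsetP => /= i j _ _ ij; rewrite -preimage_setI.
  by move/trivIsetP : tF => /(_ _ _ _ _ ij) ->//; rewrite preimage_set0.
- by rewrite -preimage_bigcup; exact: mpre.
Qed.

HB.instance Definition _ := isCharge.Build _ _ _ nu nu0 finnu snu.

Let mg : measurable_fun [set: P] g.
Proof. by apply/measurable_EFinP; exact: measurable_int ig. Qed.

Let mgp : measurable_fun [set: P] (g ^\+)%R. Proof. exact: measurable_funrpos. Qed.
Let mgn : measurable_fun [set: P] (g ^\-)%R. Proof. exact: measurable_funrneg. Qed.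

(** The two parts of [g] are pushed forward separately. The images need not be mutually singular,
    since [e] may send points where [g] has opposite signs to the same point. *)
Let ap := density_image mu me mgp (@funrpos_ge0 _ _ g).
Let an := density_image mu me mgn (@funrneg_ge0 _ _ g).

Let igp : mu.-integrable [set: P] (EFin \o (g ^\+)%R).
Proof. by rewrite -funerpos; exact: integrable_funepos. Qed.
Let ign : mu.-integrable [set: P] (EFin \o (g ^\-)%R).
Proof. by rewrite -funerneg; exact: integrable_funeneg. Qed.

Let ap_fin : fin_num_fun ap.
Proof.
move=> A mA; apply: integrable_fin_num => //; first exact: mpre.
by apply: integrableS igp => //; exact: mpre.
Qed.
Let an_fin : fin_num_fun an.
Proof.
move=> A mA; apply: integrable_fin_num => //; first exact: mpre.
by apply: integrableS ign => //; exact: mpre.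
Qed.

HB.instance Definition _ := Measure.on ap.
HB.instance Definition _ := Measure.on an.
HB.instance Definition _ := Measure_isFinite.Build _ _ _ ap ap_fin.
HB.instance Definition _ := Measure_isFinite.Build _ _ _ an an_fin.

Let charge_imageE A : measurable A -> nu A = ap A - an A.
Proof.
move=> mA; rewrite /charge_image [LHS]integralE; congr (_ - _);
  apply: eq_integral => x _.
- by rewrite -[in LHS]/(EFin \o g) funerpos.
- by rewrite -[in LHS]/(EFin \o g) funerneg.
Qed.

Let integral_ap_an (f : E -> R) (M : R) :
  measurable_fun [set: E] f -> (forall y, (`|f y| <= M)%R) ->
  \int[ap]_y (f y)%:E - \int[an]_y (f y)%:E =
  \int[mu]_x (f (e x) * g x)%:E.
Proof.
move=> mf fM.
have intE (h : P -> R) (mh : measurable_fun [set: P] h) (h0 : forall x, (0 <= h x)%R)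
    (ih : mu.-integrable [set: P] (EFin \o h)) :
    \int[density_image mu me mh h0]_y (f y)%:E =
      \int[mu]_x (f (e x) * h x)%:E.
  rewrite [LHS]integralE [RHS]integralE.
  have fh s : (EFin \o (fun x => s (f (e x)) * h x))%R =
     (fun x => (s (f (e x)))%:E * (h x)%:E) by [].
  rewrite !ge0_integral_density_image//; last 2 first.
  - by apply: measurable_funeneg; exact/measurable_EFinP.
  - by apply: measurable_funepos; exact/measurable_EFinP.
  by congr (_ - _); apply: eq_integral => x _;
    rewrite ?funeposE ?funenegE -?EFin_max -?EFinN -?EFinM;
    rewrite -?EFin_max maxr_pMl// ?mul0r ?mulNr.
rewrite !intE//.
have im (h : P -> R) (ih : mu.-integrable [set: P] (EFin \o h)) :
    mu.-integrable [set: P] (fun x => (f (e x) * h x)%:E).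
  apply: (@le_integrable _ _ _ _ _ measurableT _ (fun x => M%:E * (h x)%:E)).
  - apply/measurable_EFinP; apply: measurable_funM.
      exact: measurableT_comp.
    by apply/measurable_EFinP; exact: measurable_int ih.
  - move=> x _; rewrite -EFinM lee_fin !normrM ler_wpM2r//.
    by rewrite (le_trans (fM (e x)))// ler_norm.
  - exact: integrableZl.
rewrite -integralB//; [|exact: im..].
apply: eq_integral => x _; rewrite -EFinB -mulrBr.
by congr (_ * _)%:E; rewrite -[in RHS](funrposBneg g).
Qed.

(** [charge_integral] is taken along the Jordan decomposition, which may differ from [ap] and [an];
    [integral_sub_measure] reconciles the two. Stating it for any charge equal to the image on
    measurable sets lets one charge be written as an image in two ways. *)
Lemma integral_charge_image (nu' : {charge set E -> \bar R}) (f : E -> R)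
    (M : R) :
  (forall A, measurable A -> nu' A = nu A) ->
  measurable_fun [set: E] f -> (forall y, (`|f y| <= M)%R) ->
  charge_integral nu' (EFin \o f) = \int[mu]_x (f (e x) * g x)%:E.
Proof.
move=> nu'E mf fM; rewrite -(integral_ap_an mf fM) /charge_integral.
apply: (integral_sub_measure mf fM) => A mA.
by rewrite -charge_imageE// -nu'E// [RHS](jordan_decomp (projT2 (cid (projT2
  (cid (Hahn_decomposition nu'))))) mA)//= /cadd/= cscaleN1.
Qed.

End image_charge_of_density.

(** * Radon-Nikodym densities of vector measures *)

Section horizontal_vectors.
Context {R : realType} {n : nat}.
Implicit Types (a b c : horiz R n) (t : R).

Lemma hdotC a b : hdot a b = hdot b a.
Proof. by apply: eq_bigr => i _; rewrite mulrC. Qed.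

Lemma hdotDl a b c : hdot (a + b) c = hdot a c + hdot b c.
Proof. by rewrite -big_split/=; apply: eq_bigr => i _; rewrite !mxE mulrDl. Qed.

Lemma hdotZl t a b : hdot (t *: a) b = t * hdot a b.
Proof. by rewrite mulr_sumr; apply: eq_bigr => i _; rewrite !mxE mulrA. Qed.

Lemma hdotDr a b c : hdot c (a + b) = hdot c a + hdot c b.
Proof. by rewrite hdotC hdotDl !(hdotC c). Qed.

Lemma hdotZr t a b : hdot a (t *: b) = t * hdot a b.
Proof. by rewrite hdotC hdotZl hdotC. Qed.

Lemma hdotNl a b : hdot (- a) b = - hdot a b.
Proof. by rewrite -scaleN1r hdotZl mulN1r. Qed.

Lemma hdotBl a b c : hdot (a - b) c = hdot a c - hdot b c.
Proof. by rewrite hdotDl hdotNl. Qed.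

Lemma hdot_ge0 a : 0 <= hdot a a.
Proof. by apply: sumr_ge0 => i _; rewrite -expr2 sqr_ge0. Qed.

Lemma hnorm_ge0 a : 0 <= hnorm a. Proof. exact: sqrtr_ge0. Qed.

Lemma sqr_hnorm a : hnorm a ^+ 2 = hdot a a.
Proof. by rewrite sqr_sqrtr// hdot_ge0. Qed.

Lemma hnormZ t a : hnorm (t *: a) = `|t| * hnorm a.
Proof.
by rewrite /hnorm hdotZl hdotZr mulrA -expr2 sqrtrM ?sqr_ge0// sqrtr_sqr.
Qed.

(** Cauchy-Schwarz, by expanding the square of the vector |b|^2 a - (a . b) b; the case |b| = 0 is
    apart because a factor |b|^2 is cancelled. *)
Lemma hdot_le a b : hdot a b <= hnorm a * hnorm b.
Proof.
have [b0|b0] := eqVneq (hnorm b) 0.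
  have bi i : b ord0 i = 0.
    apply/eqP; rewrite -sqrf_eq0 eq_le sqr_ge0 andbT.
    have := sqr_hnorm b; rewrite b0 expr0n/= => /esym/eqP.
    rewrite psumr_eq0; last by move=> j _; rewrite -expr2 sqr_ge0.
    by move=> /allP/(_ i); rewrite mem_index_enum => /(_ isT)/= /eqP <-.
  by rewrite b0 mulr0 /hdot big1// => i _; rewrite bi mulr0.
have bgt0 : 0 < hnorm b by rewrite lt_def b0 hnorm_ge0.
have := hdot_ge0 (hnorm b ^+ 2 *: a - hdot a b *: b).
rewrite -scaleNr !(hdotDl, hdotDr, hdotZl, hdotZr) -!sqr_hnorm (hdotC b a).
set s := hdot a b; set B := hnorm b; set A := hnorm a => H.
have : 0 <= B ^+ 2 * (B ^+ 2 * A ^+ 2 - s ^+ 2).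
  by apply: le_trans H _; rewrite le_eqVlt; apply/orP; left; apply/eqP; ring.
rewrite pmulr_rge0 ?exprn_gt0// subr_ge0 -exprMn mulrC => sAB.
apply: le_trans (ler_norm _) _.
rewrite -(ler_pXn2r (ltn0Sn 1)) ?nnegrE ?mulr_ge0 ?hnorm_ge0//.
by rewrite real_normK ?num_real.
Qed.

Lemma hdot_norm_le a b : `|hdot a b| <= hnorm a * hnorm b.
Proof.
rewrite ler_norml hdot_le andbT lerNl -hdotNl (le_trans (hdot_le _ _))//.
by rewrite -scaleN1r hnormZ normrN1 mul1r.
Qed.

Lemma hnorm_coord a i : `|a ord0 i| <= hnorm a.
Proof.
rewrite -sqrtr_sqr ler_wsqrtr// /hdot (bigD1 i)//= -expr2 lerDl.
by apply: sumr_ge0 => j _; rewrite -expr2 sqr_ge0.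
Qed.

Lemma hnorm_le_sum a : hnorm a <= \sum_i `|a ord0 i|.
Proof.
have s0 : 0 <= \sum_i `|a ord0 i| by apply: sumr_ge0.
rewrite -(ler_pXn2r (ltn0Sn 1)) ?nnegrE ?hnorm_ge0// sqr_hnorm.
rewrite expr2 mulr_suml; apply: ler_sum => i _.
rewrite (le_trans (ler_norm _))// normrM ler_wpM2l//.
by rewrite (bigD1 i)//= lerDl sumr_ge0.
Qed.

(** By duality one would take c = a. A rational c within [e] of a in each coordinate costs an error
    of at most (n + n) e in the norm, and [e] then tends to 0. *)
Lemma hnorm_le_rat a (r : R) : 0 <= r ->
  (forall c : 'rV[rat]_(n + n), hdot (map_mx ratr c) a <= hnorm (map_mx ratr c : horiz R n) * r) ->
  hnorm a <= r.
Proof.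
move=> r0 H.
suff S (e : R) : 0 < e ->
    hnorm a ^+ 2 <= hnorm a * r + e * ((n + n)%:R * (r + hnorm a)).
  have [->//|a0] := eqVneq (hnorm a) 0.
  have agt0 : 0 < hnorm a by rewrite lt_def a0 hnorm_ge0.
  rewrite -(ler_pM2l agt0) -expr2; apply/ler_addgt0Pr => d d0.
  set K := (n + n)%:R * (r + hnorm a) in S.
  have K0 : 0 <= K by rewrite mulr_ge0// addr_ge0// hnorm_ge0.
  (* The denominator K + 1 rather than K, since K may be 0. *)
  apply: le_trans (S (d / (K + 1)) _) _.
    by rewrite divr_gt0// ltr_wpDl.
  rewrite lerD2l -mulrA -[leRHS]mulr1 ler_wpM2l ?(ltW d0)//.
  by rewrite ler_pdivrMl ?mulr1 ?ltr_wpDl// lerDl.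
move=> e0.
have Hc (j : 'I_(n + n)) : {q : rat | `|ratr q - a ord0 j| < e}.
  have /rat_in_itvoo /cid[q] : a ord0 j - e < a ord0 j + e.
    by rewrite ltrD2l gtrN.
  by rewrite in_itv/= => qx; exists q; rewrite ltr_distl.
pose c : 'rV[rat]_(n + n) := \row_j sval (Hc j).
pose cr : horiz R n := map_mx ratr c.
have ca : hnorm (cr - a) <= (n + n)%:R * e.
  apply: le_trans (hnorm_le_sum _) _.
  apply: (@le_trans _ _ (\sum_(i < n + n) e)).
    by apply: ler_sum => i _; rewrite !mxE ltW//; exact: svalP (Hc i).
  by rewrite sumr_const card_ord mulr_natl.
have crn : hnorm cr <= hnorm a + (n + n)%:R * e.
  have K0 : 0 <= hnorm a + (n + n)%:R * e.
    by rewrite addr_ge0 ?hnorm_ge0// mulr_ge0// ltW.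
  rewrite -(ler_pXn2r (ltn0Sn 1)) ?nnegrE ?hnorm_ge0//.
  have -> : hnorm cr ^+ 2 =
      hnorm a ^+ 2 + 2 * hdot a (cr - a) + hnorm (cr - a) ^+ 2.
    rewrite !sqr_hnorm !(hdotDl, hdotDr, hdotNl) !(hdotC _ (- a)) !hdotNl.
    by rewrite (hdotC a cr); ring.
  rewrite sqrrD lerD//.
    rewrite lerD2l -[leRHS]mulr_natl ler_wpM2l// (le_trans (hdot_le _ _))//.
    by rewrite ler_wpM2l ?hnorm_ge0.
  by rewrite ler_sqr ?nnegrE ?hnorm_ge0// (le_trans (hnorm_ge0 _) ca).
have -> : hnorm a ^+ 2 = hdot cr a - hdot (cr - a) a.
  by rewrite -hdotBl opprB addrC subrK sqr_hnorm.
have h1 : hdot cr a <= (hnorm a + (n + n)%:R * e) * r.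
  by rewrite (le_trans (H c))// ler_wpM2r.
have h2 : - hdot (cr - a) a <= (n + n)%:R * e * hnorm a.
  rewrite -hdotNl (le_trans (hdot_le _ _))// -scaleN1r hnormZ normrN1 mul1r.
  by rewrite ler_wpM2r ?hnorm_ge0.
by apply: le_trans (lerD h1 h2) _; rewrite le_eqVlt; apply/orP; left; apply/eqP; ring.
Qed.

End horizontal_vectors.

Section ae_comparison.
Local Open Scope ereal_scope.
Context d (T : measurableType d) (R : realType).
Variable mu : {measure set T -> \bar R}.

(** On the set where g < f, the positive function f - g has integral at most 0, so it vanishes
    almost everywhere there, which forces the set to be null. *)
Lemma ae_le_of_le_integral (f g : T -> R) :
  mu.-integrable [set: T] (EFin \o f) -> mu.-integrable [set: T] (EFin \o g) ->
  (forall A, measurable A ->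
    \int[mu]_(x in A) (f x)%:E <= \int[mu]_(x in A) (g x)%:E) ->
  {ae mu, forall x, (f x <= g x)%R}.
Proof.
move=> intf intg fg.
have mf : measurable_fun [set: T] f by apply/measurable_EFinP; exact: measurable_int intf.
have mg : measurable_fun [set: T] g by apply/measurable_EFinP; exact: measurable_int intg.
pose A := [set x | (g x < f x)%R].
have mA : measurable A.
  by rewrite -[A]setTI; apply: measurable_fun_ltr.
have intfA : mu.-integrable A (EFin \o f) by exact: integrableS intf.
have intgA : mu.-integrable A (EFin \o g) by exact: integrableS intg.
have : ae_eq mu A (fun x => (f x - g x)%:E) (cst 0).
  apply/ae_eq_integral_abs => //.
    by apply: measurable_funTS; apply/measurable_EFinP; exact: measurable_funB.
  have -> : \int[mu]_(x in A) `|(f x - g x)%:E| = \int[mu]_(x in A) (f x - g x)%:E.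
    apply: eq_integral => x; rewrite inE => Ax.
    by rewrite abse_EFin ger0_norm// subr_ge0 ltW.
  apply/eqP; rewrite eq_le; apply/andP; split.
    rewrite integralB_EFin// sube_le0; exact: fg.
  by apply: integral_ge0 => x Ax; rewrite lee_fin subr_ge0 ltW.
apply: filterS => x h; rewrite leNgt; apply/negP => gf.
by have /eqP := h gf; rewrite eqe subr_eq0 => /eqP fgx; rewrite fgx ltxx in gf.
Qed.

Lemma ae_forall_countable (I : countType) (P : I -> T -> Prop) :
  (forall i, {ae mu, forall x, P i x}) -> {ae mu, forall x, forall i, P i x}.
Proof.
move=> PH.
have : {ae mu, forall x, forall k : nat,
    if unpickle k is Some i then P i x else True}.
  apply/ae_foralln => k; case: (unpickle k) => [i|]; first exact: PH.
  exact: aeW.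
by apply: filterS => x h i; have := h (pickle i); rewrite pickleK.
Qed.

End ae_comparison.

Section hdot_integral.
Local Open Scope ereal_scope.
Context d (T : measurableType d) (R : realType) (n : nat).
Variable mu : {measure set T -> \bar R}.
Implicit Types (w : T -> horiz R n) (A : set T).

Lemma integrable_hdot w A (c : horiz R n) : measurable A ->
  (forall k, mu.-integrable A (fun x => (w x ord0 k)%:E)) ->
  mu.-integrable A (fun x => (hdot c (w x))%:E).
Proof.
move=> mA iw; under eq_fun do rewrite /hdot -sumEFin.
by apply: integrable_sum => // k _; under eq_fun do rewrite EFinM; exact: integrableZl.
Qed.

Lemma integral_hdot w A (c : horiz R n) : measurable A ->
  (forall k, mu.-integrable A (fun x => (w x ord0 k)%:E)) ->
  \int[mu]_(x in A) (hdot c (w x))%:E =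
  \sum_k (c ord0 k)%:E * \int[mu]_(x in A) (w x ord0 k)%:E.
Proof.
move=> mA iw; under eq_integral do rewrite /hdot -sumEFin.
rewrite integral_sum//; last first.
  by move=> k; under eq_fun do rewrite EFinM; exact: integrableZl.
by apply: eq_bigr => k _; rewrite -integralZl//; apply: eq_integral.
Qed.

Lemma measurable_hnorm w A :
  (forall k, measurable_fun A (fun x => w x ord0 k)) ->
  measurable_fun A (fun x => hnorm (w x)).
Proof.
move=> mw; apply: (measurableT_comp (continuous_measurable_fun (@sqrt_continuous R))).
by apply: measurable_sum => k; apply: measurable_funM; exact: mw.
Qed.

End hdot_integral.

Section radon_nikodym_vector.
Local Open Scope ereal_scope.
Context d d' (P : measurableType d) (E : measurableType d') (R : realType).
Context (n : nat) (M : {measure set P -> \bar R}).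
Variable la : {sigma_finite_measure set E -> \bar R}.
Variables (e : P -> E) (me : measurable_fun [set: P] e).
Variables (V : P -> horiz R n) (i : E -> R).

(* The Euclidean bound on the density follows from the scalar inequalities
   <c, w> <= |c| i for rational c, each obtained by integrating over sets. *)
Lemma vector_density :
  (forall k, measurable_fun [set: P] (fun x => V x ord0 k)) ->
  M.-integrable [set: P] (fun x => (hnorm (V x))%:E) ->
  la.-integrable [set: E] (EFin \o i) ->
  (forall A, measurable A -> \int[M]_(x in e @^-1` A) (hnorm (V x))%:E =
                             \int[la]_(y in A) (i y)%:E) ->
  exists w : E -> horiz R n,
  [/\ forall k, la.-integrable [set: E] (fun y => (w y ord0 k)%:E),
      {ae la, forall y, (hnorm (w y) <= i y)%R} &
      forall k A, measurable A -> \int[la]_(y in A) (w y ord0 k)%:E =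
        \int[M]_(x in e @^-1` A) (V x ord0 k)%:E].
Proof.
move=> mV iV ii iE.
have mpre A : measurable A -> measurable (e @^-1` A).
  by move=> mA; rewrite -[X in measurable X]setTI; exact: me.
have iVk k : M.-integrable [set: P] (EFin \o (fun x => V x ord0 k)).
  apply: (@le_integrable _ _ _ _ _ measurableT _ (fun x => (hnorm (V x))%:E)) => //.
    exact/measurable_EFinP.
  move=> x _; rewrite lee_fin (le_trans (hnorm_coord _ _))//.
  by rewrite ger0_norm ?hnorm_ge0.
have iVkA k A : measurable A -> M.-integrable (e @^-1` A) (EFin \o (fun x => V x ord0 k)).
  by move=> mA; apply: integrableS (iVk k) => //; exact: mpre.
pose W k := charge_image me (iVk k).
(* A set that is null for [la] has a preimage on which |V| integrates to 0 by [iE], and |V_k| <=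
   |V|. *)
have Wla k : W k `<< la.
  apply/null_content_dominatesP => A mA laA0.
  have iA0 : \int[M]_(x in e @^-1` A) (hnorm (V x))%:E = 0.
    rewrite iE//; apply: null_set_integral => //.
    by apply: measurable_funTS; exact: measurable_int ii.
  apply/eqP; rewrite -abse_eq0 eq_le abse_ge0 andbT -iA0.
  apply: le_trans (le_abse_integral _ _ _) _ => //; first exact: mpre.
    by have /integrableP[] := iVkA k A mA.
  apply: le_integral_ae; apply: aeW => x _.
  by rewrite abse_EFin lee_fin hnorm_coord.
pose w y : horiz R n := \row_k fine (Radon_Nikodym (W k) la y).
have wE k : (fun y => (w y ord0 k)%:E) = Radon_Nikodym (W k) la.
  by apply/funext => y; rewrite mxE fineK//; exact: (Radon_Nikodym_fin_num y (Wla k)).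
have iw k : la.-integrable [set: E] (fun y => (w y ord0 k)%:E).
  by rewrite wE; exact: (Radon_Nikodym_integrable (Wla k)).
have iwA k A : measurable A -> la.-integrable A (fun y => (w y ord0 k)%:E).
  by move=> mA; apply: integrableS (iw k).
have wI k A : measurable A -> \int[la]_(y in A) (w y ord0 k)%:E =
        \int[M]_(x in e @^-1` A) (V x ord0 k)%:E.
  by move=> mA; rewrite wE -(Radon_Nikodym_integral (Wla k) mA).
exists w; split => //.
(* The sign of [i] is read off its integrals, which are those of |V|; [hnorm_le_rat] requires a
   nonnegative bound. *)
have i0 : {ae la, forall y, (0 <= i y)%R}.
  have i00 : la.-integrable [set: E] (EFin \o cst 0%R) by exact: integrable0.
  apply: (ae_le_of_le_integral i00 ii).
  move=> A mA; rewrite [leLHS]integral0 -iE//; apply: integral_ge0 => x _.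
  by rewrite lee_fin hnorm_ge0.
have cw : {ae la, forall y, forall c : 'rV[rat]_(n + n),
    (hdot (map_mx ratr c) (w y) <= hnorm (map_mx ratr c : horiz R n) * i y)%R}.
  apply: ae_forall_countable => c; set cr := map_mx ratr c.
  apply: ae_le_of_le_integral.
  - exact: integrable_hdot.
  - by rewrite (_ : _ \o _ = (fun y => (hnorm cr)%:E * (i y)%:E))//; exact: integrableZl.
  - move=> A mA; rewrite integral_hdot//; last by move=> k; exact: iwA.
    under eq_bigr do rewrite wI//.
    rewrite -integral_hdot//; [|exact: mpre|by move=> k; exact: iVkA].
    under [leRHS]eq_integral do rewrite EFinM.
    rewrite integralZl//; last by apply: integrableS ii.
    rewrite -iE// -integralZl//; [|exact: mpre|]; last first.
      by apply: integrableS iV => //; exact: mpre.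
    by apply: le_integral_ae; apply: aeW => x _; rewrite -EFinM lee_fin hdot_le.
by apply: filterS2 i0 cw => y i0 cw; exact: hnorm_le_rat.
Qed.

End radon_nikodym_vector.

(** * Smooth functions and bumps *)

Section flat_functions.
Context {R : realType}.
Implicit Types (p : {poly R}) (t : R).

Lemma is_derive1_compose (f g : R -> R) (x df dg : R) :
  is_derive x 1 f df -> is_derive (f x) 1 g dg ->
  is_derive x 1 (g \o f) (dg * df).
Proof.
move=> [fd <-] [gd <-]; apply: DeriveDef.
  by apply/derivable1_diffP; apply: differentiable_comp; exact/derivable1_diffP.
by rewrite -!derive1E derive1_comp.
Qed.

(** Term by term, y^k <= k! exp y for y >= 0. *)
Lemma poly_expRN_bounded p :
  exists2 C : R, 0 <= C & forall y, 0 <= y -> `|p.[y]| * expR (- y) <= C.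
Proof.
exists (\sum_(i < size p) `|p`_i| * (i`!)%:R).
  by apply: sumr_ge0 => i _; rewrite mulr_ge0.
move=> y y0; rewrite horner_coef.
apply: (@le_trans _ _ ((\sum_(i < size p) `|p`_i * y ^+ i|) * expR (- y))).
  by rewrite ler_wpM2r ?expR_ge0// ler_norm_sum.
rewrite mulr_suml; apply: ler_sum => i _; rewrite normrM -mulrA ler_wpM2l//.
rewrite ger0_norm ?exprn_ge0// expRN ler_pdivrMr ?expR_gt0//.
case: (nat_of_ord i) => [|k].
  by rewrite expr0 fact0 mul1r -expR0 ler_expR.
have := expR_ge1Dxn k y0; rewrite -lerBrDl => /(le_trans _) H.
have f0 : (0 : R) < k.+1`!%:R by rewrite ltr0n fact_gt0.
rewrite mulrC -ler_pdivrMr//; apply: le_trans (H _ (lexx _)) _.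
by rewrite gerBl.
Qed.

(** The family p(1/t) exp(-1/t), continued by 0 to t <= 0, is stable under differentiation, so that
    smoothness of the standard flat function [flat 1] follows by induction. *)
Definition flat p t : R := if 0 < t then p.[t^-1] * expR (- t^-1) else 0.

(** The bound on q(y) exp(-y) for q = 'X^2 * p, taken at y = 1/t. Quadratic decay makes the
    difference quotient at 0 tend to 0. *)
Lemma flat_le_sqr p :
  exists2 C : R, 0 <= C & forall t, `|flat p t| <= C * t ^+ 2.
Proof.
have [C C0 HC] := poly_expRN_bounded ('X^2 * p).
exists C => // t; rewrite /flat; case: ifPn => [t0|_]; last first.
  by rewrite normr0 mulr_ge0// sqr_ge0.
rewrite normrM (ger0_norm (expR_ge0 _)).
have := HC t^-1; rewrite invr_ge0 ltW// => /(_ isT).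
rewrite hornerM hornerXn normrM exprVn normrV ?unitfE ?sqrf_eq0 ?gt_eqF//.
rewrite ger0_norm ?sqr_ge0// -mulrA ler_pdivrMl ?exprn_gt0//.
by rewrite [leRHS]mulrC.
Qed.

(** For t > 0, differentiating p(1/t) and exp(-1/t) each produces a factor 1/t^2, with p' entering
    negatively. At 0 the bound [flat_le_sqr] gives derivative 0. *)
Lemma is_derive_flat p t : is_derive t 1 (flat p) (flat ('X^2 * (p - p^`())) t).
Proof.
have [t0|t0|->] := ltgtP t 0.
- apply: (@near_eq_is_derive _ _ _ (cst 0)); last first.
    rewrite /flat ltNge (ltW t0)/=; exact: is_derive_cst.
  near=> s; rewrite /flat ltNge; suff -> : s <= 0 by [].
  by apply: ltW; near: s; exact: lt_nbhsl.
- apply: (@near_eq_is_derive _ _ _ ((fun y => p.[y] * expR (- y)) \o (fun s => s^-1))).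
    near=> s; rewrite /flat /=; suff -> : 0 < s by [].
    by near: s; exact: lt_nbhsr.
  have dinv : is_derive t 1 (fun s : R => s^-1) (- t ^- 2).
    apply: DeriveDef; first by apply: derivableV; rewrite ?gt_eqF.
    by rewrite deriveV ?gt_eqF// derive_id scaler1.
  have dp : is_derive t^-1 1 (fun y => p.[y] * expR (- y))
      (p.[t^-1] * (expR (- t^-1) * (-1)) + expR (- t^-1) * p^`().[t^-1]).
    have d1 : is_derive (t^-1 : R) 1 (expR \o -%R) (expR (- t^-1) * (-1)).
      exact: (is_derive1_compose (is_deriveNid _ _) (is_derive_expR _)).
    exact: (is_deriveM (is_derive_poly p t^-1) d1).
  apply: is_derive_eq (is_derive1_compose dinv dp) _.
  rewrite /flat t0 hornerM hornerXn hornerD hornerN exprVn; ring.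
- rewrite /flat ltxx.
  have [C C0 HC] := flat_le_sqr p.
  have f0 : flat p 0 = 0 by rewrite /flat ltxx.
  suff cv : (fun h => h^-1 *: (flat p (h *: 1 + 0) - flat p 0)) @ 0^' --> (0 : R).
    apply: DeriveDef; first by apply/cvg_ex; exists 0.
    exact: cvg_lim cv.
  apply/cvgrPdist_le => /= e e0; near=> h.
  rewrite f0 subr0 sub0r normrN addr0 [h *: 1]mulr1 normrM.
  have h0 : h != 0 by near: h; exact: nbhs_dnbhs_neq.
  rewrite normrV ?unitfE// ler_pdivrMl ?normr_gt0//.
  apply: le_trans (HC h) _; rewrite -real_normK ?num_real// expr2 mulrCA.
  rewrite ler_wpM2l//.
  apply: (@le_trans _ _ ((C + 1) * `|h|)).
    by rewrite ler_wpM2r// lerDl.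
  rewrite mulrC -ler_pdivlMr ?ltr_wpDl// ltW//.
  near: h; apply: dnbhs0_lt; by rewrite divr_gt0// ltr_wpDl.
Unshelve. all: by end_near. Qed.

End flat_functions.

Section smooth_functions.
Context {R : realType} {m : nat}.
Implicit Types (f g : 'rV[R]_m -> R) (x v : 'rV[R]_m).

Lemma is_derive_line_at f x v (r df : R) :
  is_derive (r *: v + x) v f df <-> is_derive r 1 (fun s => f (s *: v + x)) df.
Proof.
have E : (fun h : R => h^-1 *: (f (h *: v + (r *: v + x)) - f (r *: v + x))) =
    (fun h => h^-1 *: (f ((h *: (1 : R) + r) *: v + x) - f (r *: v + x))).
  by apply/funext => h; rewrite [h *: 1]mulr1 scalerDl addrA.
split => -[d <-]; apply: DeriveDef.
- by rewrite /derivable -E.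
- by rewrite /derive -E.
- by move: d; rewrite /derivable -E.
- by rewrite /derive -E.
Qed.

Lemma is_derive_line f x v (df : R) :
  is_derive x v f df <-> is_derive (0 : R) 1 (fun s => f (s *: v + x)) df.
Proof. by rewrite -is_derive_line_at scale0r add0r. Qed.

Lemma Ck_continuous k f : Ck k f -> continuous f.
Proof. by case: k => [|k] []. Qed.

Lemma CkS k f : Ck k.+1 f -> Ck k f.
Proof.
elim: k f => [|k IH] f; first by move=> [cf _]; split.
move=> [cf H]; split => // i; have [df dC] := H i; split => //; exact: IH.
Qed.

Lemma Ck_cst k (c : R) : Ck k (cst c : 'rV[R]_m -> R).
Proof.
elim: k c => [|k IH] c; split => //; try exact: cst_continuous.
move=> i; split => [x|]; first exact: derivable_cst.
rewrite (_ : 'D_(delta_mx ord0 i) (cst c) = cst 0); first exact: IH.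
by apply/funext => x; rewrite derive_cst.
Qed.

Lemma CkD k f g : Ck k f -> Ck k g -> Ck k (f \+ g).
Proof.
elim: k f g => [|k IH] f g [cf Hf] [cg Hg].
  by split => // x; apply: continuousD; [exact: cf|exact: cg].
split=> [x|i]; first by apply: continuousD; [exact: cf|exact: cg].
have [df dCf] := Hf i; have [dg dCg] := Hg i.
split => [x|]; first exact: derivableD.
rewrite (_ : 'D_(delta_mx ord0 i) (f \+ g) =
  'D_(delta_mx ord0 i) f \+ 'D_(delta_mx ord0 i) g); first exact: IH.
by apply/funext => x; rewrite deriveD.
Qed.

Lemma CkM k f g : Ck k f -> Ck k g -> Ck k (f \* g).
Proof.
elim: k f g => [|k IH] f g Cf Cg.
  case: Cf Cg => cf _ [cg _].
  by split => // x; apply: continuousM; [exact: cf|exact: cg].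
have [cf Hf] := Cf; have [cg Hg] := Cg.
split=> [x|i]; first by apply: continuousM; [exact: cf|exact: cg].
have [df dCf] := Hf i; have [dg dCg] := Hg i.
split => [x|]; first exact: derivableM.
rewrite (_ : 'D_(delta_mx ord0 i) (f \* g) =
  (f \* 'D_(delta_mx ord0 i) g) \+ (g \* 'D_(delta_mx ord0 i) f)).
  by apply: CkD; apply: IH => //; exact: CkS.
by apply/funext => x; rewrite deriveM.
Qed.

Lemma Ck_prod k (I : Type) (s : seq I) (F : I -> 'rV[R]_m -> R) :
  (forall i, Ck k (F i)) -> Ck k (fun x => \prod_(i <- s) F i x).
Proof.
move=> CF; elim: s => [|i s IH].
  rewrite (_ : (fun _ => _) = cst 1); first exact: Ck_cst.
  by apply/funext => x; rewrite big_nil.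
rewrite (_ : (fun _ => _) = F i \* (fun x => \prod_(i <- s) F i x)).
  exact: CkM.
by apply/funext => x; rewrite big_cons.
Qed.

Lemma is_derive_coord (h : R -> R) (dh : R) i j x :
  is_derive (x ord0 j) 1 h dh ->
  is_derive x (delta_mx ord0 i) (fun y : 'rV[R]_m => h (y ord0 j))
    (if i == j then dh else 0).
Proof.
move=> hd; case: eqVneq => [->|ij].
  have E : (fun s : R => s^-1 *: (h ((s *: delta_mx ord0 j + x) ord0 j) - h (x ord0 j))) =
      (fun s => s^-1 *: (h (s *: 1 + x ord0 j) - h (x ord0 j))).
    by apply/funext => s; rewrite !mxE !eqxx.
  case: hd => hd <-; apply: DeriveDef; first by rewrite /derivable/= E.
  by rewrite /derive/= E.
apply/is_derive_line.
rewrite (_ : (fun s : R => _) = cst (h (x ord0 j))); first exact: is_derive_cst.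
by apply/funext => s; rewrite !mxE (eq_sym j) (negbTE ij) mulr0 add0r.
Qed.

(** The whole sequence of successive derivatives is carried along, so that the induction on k can
    pass from [H l] to [H l.+1]. *)
Lemma Ck_coord (H : nat -> R -> R) :
  (forall (l : nat) (t : R), is_derive t 1 (H l) (H l.+1 t)) ->
  forall k l j, Ck k (fun x : 'rV[R]_m => H l (x ord0 j)).
Proof.
move=> dH; elim=> [|k IH] l j.
  split => // x; apply: (continuous_comp (@coord_continuous _ _ _ _ _ x)).
  by apply/differentiable_continuous/derivable1_diffP; have [] := dH l (x ord0 j).
split=> [x|i].
  apply: (continuous_comp (@coord_continuous _ _ _ _ _ x)).
  by apply/differentiable_continuous/derivable1_diffP; have [] := dH l (x ord0 j).
split=> [x|]; first by have [] := is_derive_coord i (dH l (x ord0 j)).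
rewrite (_ : 'D_(delta_mx ord0 i) _ =
  (cst (i == j)%:R : 'rV[R]_m -> R) \* (fun x => H l.+1 (x ord0 j))).
  by apply: CkM; [exact: Ck_cst|exact: IH].
apply/funext => x; have [_ ->] := is_derive_coord i (dH l (x ord0 j)).
by case: eqP => _ /=; rewrite ?mul1r ?mul0r.
Qed.

Fixpoint flat_poly k : {poly R} :=
  if k is k'.+1 then 'X^2 * (flat_poly k' - (flat_poly k')^`()) else 1.

Lemma Ck_flat k (a b : R) j :
  Ck k (fun x : 'rV[R]_m => flat 1 (a * x ord0 j + b)).
Proof.
(* The l-th derivative of t |-> [flat 1 (a * t + b)], with the factor a^l from the chain rule. *)
pose H l t := a ^+ l * flat (flat_poly l) (a * t + b).
rewrite (_ : (fun _ => _) = (fun x => H 0%N (x ord0 j))); last first.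
  by apply/funext => x; rewrite /H expr0 mul1r.
apply: Ck_coord => l t.
have d1 : is_derive t 1 (fun s : R => a * s + b) a.
  have -> : (fun s : R => a * s + b) = (a \*: id) + cst b by [].
  have := is_deriveD (is_deriveZ a (is_derive_id t 1)) (is_derive_cst b t 1).
  by move=> D; apply: (is_derive_eq D); rewrite addr0 [a *: 1]mulr1.
have := is_deriveZ (a ^+ l) (is_derive1_compose d1 (is_derive_flat (flat_poly l) (a * t + b))).
by move=> D; apply: (is_derive_eq D); rewrite /H [a ^+ l.+1]exprSr -mulrA [a * flat _ _]mulrC.
Qed.

Definition box (a b : 'rV[R]_m) : set 'rV[R]_m :=
  [set x | forall j, a ord0 j < x ord0 j < b ord0 j].

(** K is a sharpness parameter: inside the box each factor is exp(-1/(K s)) with s > 0, which tends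
    to 1 as K grows, so the bumps tend to the indicator of the open box. *)
Definition bump (a b : 'rV[R]_m) (K : R) x : R :=
  \prod_j (flat 1 (K * (x ord0 j - a ord0 j)) * flat 1 (K * (b ord0 j - x ord0 j))).

Lemma smooth_bump a b K : smooth (bump a b K).
Proof.
move=> k; apply: Ck_prod => j; apply: CkM.
  rewrite (_ : (fun _ => _) = (fun x : 'rV[R]_m => flat 1 (K * x ord0 j + (- (K * a ord0 j))))).
    exact: Ck_flat.
  by apply/funext => x; rewrite mulrBr.
rewrite (_ : (fun _ => _) = (fun x : 'rV[R]_m => flat 1 ((- K) * x ord0 j + K * b ord0 j))).
  exact: Ck_flat.
by apply/funext => x; rewrite mulrBr mulNr addrC.
Qed.

Lemma flat1_ge0 (t : R) : 0 <= flat 1 t.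
Proof. by rewrite /flat; case: ifP => // _; rewrite hornerC mul1r expR_ge0. Qed.

Lemma flat1_le1 (t : R) : flat 1 t <= 1.
Proof.
rewrite /flat; case: ifP => // t0; rewrite hornerC mul1r -expR0 ler_expR.
by rewrite oppr_le0 invr_ge0 ltW.
Qed.

Lemma bump_ge0 a b K x : 0 <= bump a b K x.
Proof. by apply: prodr_ge0 => j _; rewrite mulr_ge0// flat1_ge0. Qed.

Lemma bump_le1 a b K x : bump a b K x <= 1.
Proof.
apply: prodr_ile1 => j _; rewrite mulr_ge0 ?flat1_ge0//=.
by rewrite mulr_ile1 ?flat1_ge0 ?flat1_le1.
Qed.

Lemma bump_eq0 a b K x : 0 <= K -> ~ box a b x -> bump a b K x = 0.
Proof.
move=> K0 /existsNP[j /negP]; rewrite negb_and -!leNgt => /orP[] h;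
  rewrite /bump (bigD1 j)//= /flat.
- by rewrite [0 < _ * (_ - _)]ltNge mulr_ge0_le0 ?subr_le0// !mul0r.
- by rewrite [X in _ * (if X then _ else _)]ltNge mulr_ge0_le0 ?subr_le0// mulr0 mul0r.
Qed.

Lemma flat1_cvg (t : R) : 0 < t -> flat 1 (k.+1%:R * t) @[k --> \oo] --> (1 : R).
Proof.
move=> t0.
have -> : (fun k => flat 1 (k.+1%:R * t)) = expR \o (fun k => - (k.+1%:R^-1 * t^-1)).
  by apply/funext => k; rewrite /flat mulr_gt0//= hornerC mul1r invfM.
have h0 : (fun k => k.+1%:R^-1 * t^-1) @ \oo --> (0 : R).
  by rewrite -(mul0r t^-1); apply: cvgM; [exact: cvg_harmonic|exact: cvg_cst].
rewrite -[X in _ --> X]expR0; apply: continuous_cvg; first exact: continuous_expR.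
by rewrite -[X in _ --> X]oppr0; exact: cvgN.
Qed.

Lemma bump_cvg a b x : bump a b k.+1%:R x @[k --> \oo] --> (\1_(box a b) x : R).
Proof.
rewrite indicE; have [bx|bx] := pselect (box a b x); last first.
  rewrite memNset//; rewrite (_ : (fun _ => _) = cst 0); first exact: cvg_cst.
  by apply/funext => k; rewrite bump_eq0.
rewrite mem_set//= /bump.
rewrite [X in _ --> X](_ : 1 = \prod_(j < m) (1 * 1)); last first.
  by rewrite big1// => j _; rewrite mulr1.
apply: cvg_big => [|j _]; first exact: mul_continuous.
have /andP[aj bj] := bx j.
by apply: cvgM; apply: flat1_cvg; rewrite subr_gt0.
Qed.

End smooth_functions.

(** * Borel sets of R^m *)

Section borel_continuous.
Context {R : realType}.

Lemma continuous_borel_measurable (X Y : ptopologicalType) (f : X -> Y) :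
  continuous f -> measurable_fun [set: borel X] (f : borel X -> borel Y).
Proof.
move=> cf; apply: (@measurability _ _ (borel X) (borel Y) setT f (@open Y)) => //.
move=> _ [U oU <-]; rewrite setTI; apply: sub_sigma_algebra.
by move/continuousP : cf; exact.
Qed.

Lemma continuous_real_measurable (X : ptopologicalType) (f : X -> R) :
  continuous f -> measurable_fun [set: borel X] (f : borel X -> R).
Proof.
move=> /continuousP cf.
apply: (measurability _ (RGenOpens.measurableE R)) => _ [_ [a [b ->]] <-].
by rewrite setTI; apply: sub_sigma_algebra; apply: cf; exact: interval_open.
Qed.

End borel_continuous.

Section boxes.
Context {R : realType} {m : nat}.
Implicit Types (a b : 'rV[R]_m) (U : set 'rV[R]_m).

Definition cbox a b : set 'rV[R]_m :=
  [set x | forall j, a ord0 j <= x ord0 j <= b ord0 j].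

Lemma box_setI a b a' b' :
  box a b `&` box a' b' = box (\row_j Num.max (a ord0 j) (a' ord0 j))
                              (\row_j Num.min (b ord0 j) (b' ord0 j)).
Proof.
apply/seteqP; split => [x [h h'] j|x h].
  have /andP[? ?] := h j; have /andP[? ?] := h' j.
  by rewrite !mxE gt_max lt_min; apply/andP; split; apply/andP.
split => j; have := h j; rewrite !mxE gt_max lt_min;
  by move=> /andP[/andP[? ?] /andP[? ?]]; apply/andP.
Qed.

Lemma measurable_box a b : measurable (box a b : set (borel 'rV[R]_m)).
Proof.
have -> : box a b = \bigcap_(j : 'I_m) ((fun x => x ord0 j) @^-1` `]a ord0 j, b ord0 j[).
  apply/seteqP; split => [x bx j _ /=|x bx j]; rewrite ?in_itv/=; first exact: bx.
  by have /= := bx j I; rewrite in_itv.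
apply: fin_bigcap_measurable => // j _; rewrite -[X in measurable X]setTI.
exact: coord_measurable.
Qed.

(** Boxes with rational centre and radius 1/(k+1) are countably many. That even the closed box lies
    in U is what makes the bumps of the box test functions on U. *)
Lemma open_bigcup_box U : open U -> exists F : nat -> set 'rV[R]_m,
  U = \bigcup_k F k /\
  forall k, F k = set0 \/ exists a b, F k = box a b /\ cbox a b `<=` U.
Proof.
move=> oU.
pose lo (a : 'rV[rat]_m * nat) : 'rV[R]_m := \row_j (ratr (a.1 ord0 j) - a.2.+1%:R^-1).
pose hi (a : 'rV[rat]_m * nat) : 'rV[R]_m := \row_j (ratr (a.1 ord0 j) + a.2.+1%:R^-1).
pose F (k : nat) : set 'rV[R]_m := if unpickle k is Some a then
  if `[< cbox (lo a) (hi a) `<=` U >] then box (lo a) (hi a) else set0 else set0.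
exists F; split; last first.
  move=> k; rewrite /F; case: (unpickle k) => [a|]; last by left.
  by case: asboolP => H; [right; exists (lo a), (hi a)|left].
apply/seteqP; split => [x Ux|x [k _]]; last first.
  rewrite /F; case: (unpickle k) => // a; case: asboolP => // BU Bx.
  by apply: BU => j; have /andP[/ltW -> /ltW ->] := Bx j.
have : nbhs (x : 'rV[R]_m) U by exact: open_nbhs_nbhs.
move=> /nbhs_ballP[e /= e0 eU].
have [k ke] : exists k, k.+1%:R^-1 < e / 2.
  have [k] := @ltr_add_invr R 0 (e / 2) (divr_gt0 e0 (ltr0n R 2)).
  by rewrite add0r; exists k.
have k0 : 0 < k.+1%:R^-1 :> R by rewrite invr_gt0.
have H (j : 'I_m) : {q : rat | x ord0 j - k.+1%:R^-1 < (ratr q : R) < x ord0 j + k.+1%:R^-1}.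
  have /rat_in_itvoo /cid[q] : x ord0 j - k.+1%:R^-1 < x ord0 j + k.+1%:R^-1.
    by rewrite ltrD2l gtrN.
  by rewrite in_itv/= => qx; exists q.
pose a : 'rV[rat]_m := \row_j sval (H j).
exists (pickle (a, k)) => //; rewrite /F pickleK.
case: asboolP => [_ j|[]].
  rewrite !mxE/=; have /andP[h1 h2] := svalP (H j).
  by rewrite ltrBlDr h2/= -ltrBlDr.
move=> y yB; apply: eU; split => // i j; have {i}-> : i = ord0 by exact: ord1.
have /andP[h1 h2] := svalP (H j).
have := yB j; rewrite !mxE/= => /andP[y1 y2].
rewrite /ball/= ltr_distlC.
move: h1 h2 y1 y2 ke; rewrite /=; set r := k.+1%:R^-1; set s := ratr _.
by move=> *; apply/andP; split; lra.
Qed.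

Lemma borel_sub_box :
  (measurable : set (set (borel 'rV[R]_m))) `<=`
  <<s [set B : set (borel 'rV[R]_m) | exists a b, B = box a b] >>.
Proof.
apply: smallest_sub; first exact: smallest_sigma_algebra.
move=> U oU; have [F [-> HF]] := open_bigcup_box oU.
apply: sigma_algebra_bigcup => k.
have [->|[a [b [-> _]]]] := HF k; first exact: sigma_algebra0.
by apply: sub_sigma_algebra; exists a, b.
Qed.

Lemma bigcup_boxT : \bigcup_k box (const_mx (- k%:R)) (const_mx k%:R) = [set: 'rV[R]_m].
Proof.
apply/seteqP; split => // x _.
have [k _ xk] : exists2 k : nat, True & forall j, `|x ord0 j| < k%:R.
  exists (Num.truncn (\sum_j `|x ord0 j|)).+1 => // j.
  rewrite (le_lt_trans _ (truncnS_gt _))// (bigD1 j)//= lerDl.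
  by apply: sumr_ge0.
by exists k => // j; rewrite !mxE -ltr_norml.
Qed.

(** Open boxes are stable under intersection, generate the Borel sets and exhaust the space, so the
    uniqueness theorem for measures on a pi-system applies. *)
Lemma eq_measure_box (m1 m2 : {measure set (borel 'rV[R]_m) -> \bar R}) :
  (m1 setT < +oo)%E -> (forall a b, m1 (box a b) = m2 (box a b)) ->
  forall A, measurable A -> m1 A = m2 A.
Proof.
move=> m1oo m12 A mA.
apply: (@g_sigma_algebra_measure_unique _ R (borel 'rV[R]_m)
  [set B | exists a b, B = box a b] _
  (fun k => box (const_mx (- k%:R)) (const_mx k%:R)) _ _ m1 m2).
- by move=> _ [a [b ->]]; exact: measurable_box.
- by move=> k; exists (const_mx (- k%:R)), (const_mx k%:R).
- exact: bigcup_boxT.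
- by move=> _ _ [a [b ->]] [a' [b' ->]]; rewrite box_setI; do 2 eexists.
- by move=> _ [a [b ->]]; exact: m12.
- move=> k; rewrite (le_lt_trans _ m1oo)// le_measure ?inE//; exact: measurable_box.
- exact: borel_sub_box.
Qed.

Lemma bump_integral_cvg a b (m1 : {measure set (borel 'rV[R]_m) -> \bar R}) (D : set (borel 'rV[R]_m)) :
  measurable D -> (m1 D < +oo)%E ->
  (\int[m1]_(x in D) (bump a b k.+1%:R x)%:E @[k --> \oo] --> m1 (box a b `&` D))%E.
Proof.
move=> mD m1oo.
rewrite -(integral_indic _ mD (measurable_box a b)).
apply: (dominated_cvg mD (g := cst 1%E)) => //.
- move=> k; apply/measurable_EFinP; apply: measurable_funTS.
  apply: continuous_real_measurable.
  exact: (Ck_continuous (smooth_bump a b k.+1%:R 0)).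
- by move=> x _; apply: cvg_EFin; [exact: nearW|exact: bump_cvg].
- apply/integrableP; split; first exact: measurable_cst.
  rewrite (eq_integral (cst 1%E)); last by move=> x _; rewrite gee0_abs.
  by rewrite integral_cst// mul1e.
- by move=> k x _; rewrite lee_fin ger0_norm ?bump_ge0// bump_le1.
Qed.

(** Identifies finite measures that are known only through integrals of smooth functions. *)
Lemma eq_measure_bump (m1 m2 : {measure set (borel 'rV[R]_m) -> \bar R}) :
  (m1 setT < +oo)%E -> (m2 setT < +oo)%E ->
  (forall a b (k : nat), \int[m1]_x (bump a b k.+1%:R x)%:E = \int[m2]_x (bump a b k.+1%:R x)%:E)%E ->
  forall A, measurable A -> m1 A = m2 A.
Proof.
move=> m1oo m2oo m12; apply: eq_measure_box => // a b.
have h1 := @bump_integral_cvg a b m1 _ measurableT m1oo.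
have h2 := @bump_integral_cvg a b m2 _ measurableT m2oo.
rewrite !setIT in h1 h2; rewrite -(cvg_lim _ h1)// -(cvg_lim _ h2)//.
by congr (lim (_ @ \oo)); apply/funext => k; exact: m12.
Qed.

Lemma closure_box_sub a b : closure (box a b) `<=` cbox a b.
Proof.
have cB : closed (cbox a b).
  have -> : cbox a b = \bigcap_(j : 'I_m) ((fun x => x ord0 j) @^-1` `[a ord0 j, b ord0 j]).
    apply/seteqP; split => [x bx j _ /=|x bx j]; rewrite ?in_itv/=; first exact: bx.
    by have /= := bx j I; rewrite in_itv.
  apply: closed_bigI => j _; apply: preimage_closed; last exact: interval_closed.
  by move=> x _; exact: coord_continuous.
move/closure_id : cB => ->; apply: closure_subset => x bx j.
by have /andP[/ltW -> /ltW ->] := bx j.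
Qed.

Lemma compact_closure_box a b (A : set 'rV[R]_m) : A `<=` box a b -> compact (closure A).
Proof.
move=> AB; apply: bounded_closed_compact; last exact: closed_closure.
exists (\sum_j (`|a ord0 j| + `|b ord0 j|)); split; first exact: num_real.
move=> M HM x /(closure_subset AB)/closure_box_sub bx.
have M0 : 0 <= M by rewrite (le_trans _ (ltW HM))// sumr_ge0// => j _; rewrite addr_ge0.
rewrite /= [leLHS]/Num.Def.normr/= mx_normrE (bigmax_le _ M0)// => -[i j] _ /=; rewrite (ord1 i).
rewrite (le_trans _ (ltW HM))// (bigD1 j)//=.
apply: (@le_trans _ _ (`|a ord0 j| + `|b ord0 j|)); last first.
  by rewrite lerDl sumr_ge0// => k _; rewrite addr_ge0.
have /andP[ax xb] := bx j.
rewrite ler_norml; apply/andP; split.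
  rewrite (le_trans _ ax)// lerNl (le_trans (ler_norm _))// normrN lerDl//.
by rewrite (le_trans xb)// (le_trans (ler_norm _))// lerDr.
Qed.

End boxes.

(** * Measurability of curves and velocities *)

Section caratheodory.
Context d (T : measurableType d) (R : realType).

(** Time is rounded down to multiples of 1/(k+1). The rounded function is constant in time on each
    grid interval, so preimages are countable unions of rectangles, and continuity in time gives
    pointwise convergence. *)
Lemma measurable_fun_caratheodory (f : T -> R -> R) :
  (forall s, measurable_fun [set: T] (f^~ s)) -> (forall x, continuous (f x)) ->
  measurable_fun [set: T * measurableTypeR R] (fun z => f z.1 z.2).
Proof.
move=> mf cf.
pose q (k : nat) (t : R) : R := (Num.floor (k.+1%:R * t))%:~R / k.+1%:R.
apply: (@measurable_fun_cvg _ _ _ _ (fun k z => f z.1 (q k z.2))).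
- move=> k _ B mB; rewrite setTI.
  pose F (j : nat) : set (T * measurableTypeR R) :=
    if unpickle j is Some i then
      ((fun x => f x ((i : int)%:~R / k.+1%:R)) @^-1` B) `*`
      `[i%:~R / k.+1%:R, (i + 1)%:~R / k.+1%:R[%classic else set0.
  rewrite (_ : _ @^-1` _ = \bigcup_j F j).
    apply: bigcupT_measurable => j; rewrite /F; case: (unpickle j) => // i.
    apply: measurableX => //; rewrite -[X in measurable X]setTI; exact: mf.
  have flE (i : int) (t : R) : (i%:~R / k.+1%:R <= t < (i + 1)%:~R / k.+1%:R) =
      (Num.floor (k.+1%:R * t) == i).
    by rewrite ler_pdivrMr// ltr_pdivlMr// mulrC floor_eq.
  apply/seteqP; split => [[x t] /= Bx|[x t] [j _]].
    exists (pickle (Num.floor (k.+1%:R * t))); [exact: I|rewrite /F pickleK].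
    by split => //=; rewrite in_itv/= flE.
  rewrite /F; case: (unpickle j) => // i [/= Bx].
  by rewrite /= in_itv/= flE => /eqP E; rewrite /= /q E.
- move=> [x t] _ /=; apply: continuous_cvg; first exact: cf.
  apply/cvgrPdist_le => /= e e0; near=> k.
  rewrite /q ger0_norm; last first.
    by rewrite subr_ge0 ler_pdivrMr// mulrC floor_le.
  apply: (@le_trans _ _ k.+1%:R^-1).
    rewrite lerBlDl -[X in _ + X]mul1r -mulrDl ler_pdivlMr// mulrC ltW//.
    by have := floorD1_gt (k.+1%:R * t); rewrite intrD.
  rewrite -[leRHS]invrK lef_pV2 ?posrE ?invr_gt0//.
  apply: (@le_trans _ _ k%:R); last by rewrite ler_nat.
  near: k; exact: nbhs_infty_ger.
Unshelve. all: by end_near. Qed.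

End caratheodory.

Section curve_topology.
Context {R : realType} {m : nat} (Om : bounded_domain R m).

Lemma val_cldom_continuous : continuous (val : cldom Om -> 'rV[R]_m).
Proof. exact: (@initial_continuous (cldom Om) 'rV[R]_m set_val). Qed.

Lemma continuous_to01 : continuous (@to01 R).
Proof.
apply: (@continuous_comp_initial (I01 R) R R set_val (@to01 R)).
rewrite (_ : _ \o _ = @clamp01 R)//.
move=> t; apply: (@continuous_min _ _ (cst 1) (fun t : R => Num.max 0 t) t).
  exact: cst_continuous.
by apply: (@continuous_max _ _ (cst 0) id t); [exact: cst_continuous|exact: cvg_id].
Qed.

Lemma curveR_continuous (c : curve Om) : continuous (curveR c).
Proof.
move=> t; apply: (@continuous_comp R (cldom Om) _ (fun t => curve_fun c (to01 t)) val t).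
  apply: (@continuous_comp R (I01 R) (cldom Om) (@to01 R) (curve_fun c)).
    exact: continuous_to01.
  exact: (@cts_fun (I01 R) (cldom Om) c).
exact: val_cldom_continuous.
Qed.

(** [curve] receives the uniform topology through [curve_fun]; an entourage around [c t] yields a
    uniform neighbourhood of [c] on which evaluation at [t] stays close. *)
Lemma eval_at_continuous (t : I01 R) : continuous (@eval_at R m Om t).
Proof.
move=> c; rewrite /eval_at.
have : continuous (@curve_fun R m Om).
  exact: (@initial_continuous (curve Om) _ (@curve_fun R m Om)).
move=> /(_ c) cc A /= nA; apply: (cc [set h : I01 R -> cldom Om | A (h t)]).
change (nbhs (curve_fun c : {uniform (I01 R) -> (cldom Om)})
  [set h : I01 R -> cldom Om | A (h t)]).
apply/uniform_nbhs; move: nA; rewrite -nbhs_entourageE => -[E entE EA].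
by exists E; split => // h hE; apply: (EA (h t)); apply/xsectionP; exact: (hE t I).
Qed.

End curve_topology.

Section borel_cldom.
Context {R : realType}.

Lemma measurable_cldom d (T : measurableType d) m (Om : bounded_domain R m)
    (f : T -> borel (cldom Om)) :
  measurable_fun [set: T] (fun x => val (f x) : borel 'rV[R]_m) ->
  measurable_fun [set: T] f.
Proof.
move=> mf; apply: (@measurability _ _ T (borel (cldom Om)) setT f (@open (cldom Om))) => //.
move=> _ [_ [U oU <-] <-]; rewrite setTI.
rewrite -[X in measurable X]setTI; apply: (mf measurableT U).
exact: sub_sigma_algebra.
Qed.

End borel_cldom.

Section velocity.
Context {R : realType} {n : nat} (Om : bounded_domain R (n + n + 1)).
Local Notation P := (borel (curve Om) * measurableTypeR R)%type.

(** The shift h serves difference quotients, and h = 0 the curve itself; as [curveR] is constant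
    beyond [0, 1], every shift makes sense. *)
Lemma measurable_curveR_shift j (h : R) :
  measurable_fun [set: P] (fun z : P => curveR z.1 (h + z.2) ord0 j).
Proof.
apply: (measurable_fun_caratheodory (T := borel (curve Om))
  (f := fun c t => curveR c (h + t) ord0 j)) => [s|c t].
- apply: (measurableT_comp (coord_measurable j)).
  apply: continuous_borel_measurable => c.
  apply: (@continuous_comp (curve Om) (cldom Om) _ (eval_at (to01 (h + s))) val).
    exact: eval_at_continuous.
  exact: val_cldom_continuous.
- apply: (@continuous_comp _ _ _ (fun t => curveR c (h + t)) (fun v : 'rV[R]_(n + n + 1) => v ord0 j)).
    apply: (@continuous_comp _ _ _ (fun t => h + t) (curveR c)); last exact: curveR_continuous.
    by apply: cvgD; [exact: cvg_cst|exact: cvg_id].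
  exact: coord_continuous.
Qed.

Definition path_eval (z : P) : borel (cldom Om) := eval_at (to01 z.2) z.1.

Lemma measurable_path_eval : measurable_fun [set: P] path_eval.
Proof.
apply: measurable_cldom; apply: measurable_fun_rV => j.
have := measurable_curveR_shift j 0.
by under eq_fun do rewrite add0r.
Qed.

Let diff_quotient j (z : P) (k : nat) : R :=
  k.+1%:R * (curveR z.1 (k.+1%:R^-1 + z.2) ord0 j - curveR z.1 z.2 ord0 j).

(* The upper limit along h = 1/(l+1) makes sense everywhere and is jointly measurable; it
   is the derivative wherever the latter exists, and fine turns infinite values into 0. *)
Definition velocity (z : P) : horiz R n :=
  \1_(`[0, 1]%classic) z.2 *:
  \row_k fine (limn_esup (fun l => (diff_quotient (lshift 1 k) z l)%:E)).

Lemma measurable_velocity k : measurable_fun [set: P] (fun z => velocity z ord0 k).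
Proof.
under eq_fun do rewrite !mxE.
apply: measurable_funM.
  apply: (@measurableT_comp _ _ _ _ _ _ (\1_`[0, 1]%classic : measurableTypeR R -> R)).
    exact: measurable_indic.
  exact: measurable_snd.
apply: measurableT_comp; first exact: fine_measurable.
apply: measurable_fun_limn_esup => l; apply/measurable_EFinP.
apply: measurable_funM => //; apply: measurable_funB.
  exact: measurable_curveR_shift.
have := measurable_curveR_shift (lshift 1 k) 0.
by under eq_fun do rewrite add0r.
Qed.

Lemma velocity_out (c : borel (curve Om)) (t : measurableTypeR R) :
  t \notin `[0, 1] -> velocity (c, t) = 0.
Proof.
move=> t01; rewrite /velocity indicE memNset ?scale0r//=.
by apply/negP.
Qed.

Lemma velocityE (c : borel (curve Om)) (t : measurableTypeR R) :
  t \in `[0, 1] -> derivable (curveR c) t 1 ->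
  velocity (c, t) = hspeed (curveR c) t.
Proof.
move=> t01 dc; rewrite /velocity indicE mem_set//= scale1r.
apply/rowP => k; rewrite !mxE derive1E derive_mx// mxE.
set j := lshift 1 k.
have /cvg_ex[l cl] : derivable (fun s => curveR c s ord0 j) t 1.
  exact: (derivable_mxP _ _ _).1.
have cq : diff_quotient j (c, t) l @[l --> \oo] --> (l : R).
  (* The steps 1/(k+1) are nonzero, so they converge to 0 along the punctured neighbourhoods that
     define the derivative. *)
  have h0 : (fun k : nat => k.+1%:R^-1 : R) @ \oo --> 0^'.
    move=> A /= nA.
    have nA' : \forall i \near \oo, (i.+1%:R^-1 : R) != 0 -> A (i.+1%:R^-1 : R).
      exact: (@cvg_harmonic R _ nA).
    suff : \forall i \near \oo, A (i.+1%:R^-1 : R) by [].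
    by apply: filterS nA' => i; apply; rewrite invr_eq0 pnatr_eq0.
  pose F (i : nat) : R := (i.+1%:R^-1)^-1 *:
    (curveR c (i.+1%:R^-1 *: (1 : R) + t) ord0 j - curveR c t ord0 j).
  have -> : diff_quotient j (c, t) = F.
    by apply/funext => i; rewrite /diff_quotient /F invrK [_%:A]mulr1.
  exact: (@cvg_comp _ _ _ _ _ _ _ _ h0 cl).
have -> : 'D_1 (fun s => curveR c s ord0 j) t = l by exact: cvg_lim cl.
have := cvg_limn_einf_sup (u := fun k => (diff_quotient j (c, t) k)%:E) (l := l%:E).
by case=> [|_ ->//]; apply: cvg_EFin => //; exact: nearW.
Qed.

End velocity.

(** * The fundamental theorem of calculus along horizontal curves *)

Section ftc_absolutely_continuous.
Context {R : realType}.
Local Notation leb := (@lebesgue_measure R).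

(** Let s be the supremum of the points where P holds. The local step with y = s gives P s, and the
    step with x = s would pass beyond s unless s = 1. *)
Lemma real_induction (P : R -> Prop) : P 0 ->
  (forall s, 0 <= s <= 1 -> exists2 r : R, 0 < r & forall x y,
     0 <= x -> x <= y -> y <= 1 -> (x = s \/ y = s) -> y - x < r -> P x -> P y) ->
  P 1.
Proof.
move=> P0 H.
pose S := [set x : R | 0 <= x <= 1 /\ P x].
have S0 : S 0 by split => //; rewrite lexx ler01.
have Sub : ubound S 1 by move=> x [/andP[]].
have hS : has_sup S by split; [exists 0|exists 1].
pose s := sup S.
have s0 : 0 <= s by apply: ub_le_sup => //; exists 1.
have s1 : s <= 1 by apply: ge_sup => //; exists 0.
have [|r r0 Hr] := H s; first by rewrite s0.
have [x [/andP[x0 x1] Px] sx] := sup_adherent r0 hS.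
have xs : x <= s by apply: ub_le_sup; [exists 1|split => //; rewrite x0].
have Ps : P s.
  by apply: (Hr x s) => //; [right|rewrite ltrBlDl -ltrBlDr].
have [<-//|sn1] := eqVneq s 1.
have {sn1}slt1 : s < 1 by rewrite lt_neqAle sn1.
pose y := Num.min 1 (s + r / 2).
have sy : s < y by rewrite lt_min slt1 ltrDl divr_gt0.
have y1 : y <= 1 by rewrite ge_min lexx.
have Py : P y.
  apply: (Hr s y) => //; [exact: ltW|by left|].
  rewrite (@le_lt_trans _ _ (r / 2))//; last by rewrite ltr_pdivrMr// ltr_pMr// ltr1n.
  by rewrite lerBlDl ge_min lexx orbT.
have : y <= s.
  by apply: ub_le_sup; [exists 1|split => //; rewrite y1 (le_trans s0)// ltW].
by rewrite leNgt sy.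
Qed.

Lemma is_derive0_lipschitz (h : R -> R) (s e : R) : 0 < e -> is_derive s 1 h 0 ->
  exists2 r : R, 0 < r & forall t, `|t - s| < r -> `|h t - h s| <= e * `|t - s|.
Proof.
move=> e0 [/cvg_ex[l cl] hd].
have l0 : l = 0 by rewrite -hd; apply/esym/cvg_lim.
move: cl; rewrite {}l0 => /cvgrPdist_le /(_ e e0)[r /= r0 Hr].
exists r => // t ts; have [->|tns] := eqVneq t s; first by rewrite !subrr normr0 mulr0.
have := Hr (t - s); rewrite /= sub0r normrN => /(_ ts).
rewrite subr_eq0 tns => /(_ isT).
rewrite sub0r normrN [(t - s) *: 1]mulr1 subrK normrM normrV ?unitfE ?subr_eq0//.
by rewrite ler_pdivrMl ?normr_gt0 ?subr_eq0// mulrC.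
Qed.

Section open_set_mass.
Variables (U : set (measurableTypeR R)) (k : R -> R).
Hypotheses (mU : measurable U) (k0 : forall x, 0 <= k x).
Hypothesis ik : leb.-integrable `[0, 1] (EFin \o k).

(** Used with k = 1, for the length of U up to x, and with k = |g|. *)
Let w (x : R) : R := \int[leb]_(t in U `&` `[0, x]) k t.

Let ikS (A : set (measurableTypeR R)) : measurable A -> A `<=` `[0, 1] -> leb.-integrable A (EFin \o k).
Proof. by move=> mA A01; apply: integrableS ik. Qed.

Let mUI (x : R) : measurable (U `&` `[0, x] : set (measurableTypeR R)). Proof. exact: measurableI. Qed.

Let Ux1 (x : R) : x <= 1 -> U `&` `[0, x] `<=` `[0, 1].
Proof.
by move=> x1 t [_] /=; rewrite !in_itv/= => /andP[-> tx]; rewrite (le_trans tx).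
Qed.

Lemma mass_le (x y : R) : x <= y -> y <= 1 -> w x <= w y.
Proof.
move=> xy y1.
have ix : leb.-integrable (U `&` `[0, x]) (EFin \o k).
  by apply: ikS => //; apply: Ux1; exact: le_trans y1.
have iy : leb.-integrable (U `&` `[0, y]) (EFin \o k).
  by apply: ikS => //; exact: Ux1.
rewrite /w /Rintegral fine_le//.
- exact: (integrable_fin_num (mUI x) ix).
- exact: (integrable_fin_num (mUI y) iy).
- apply: ge0_subset_integral => //.
  + exact: (measurable_int _ iy).
  + by move=> t _; rewrite lee_fin.
  + by move=> t [Ut] /=; rewrite !in_itv/= => /andP[-> tx]; split => //; exact: le_trans xy.
Qed.

Lemma mass_ge_itv (x y : R) : 0 <= x -> x <= y -> y <= 1 -> `]x, y] `<=` U ->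
  w x + \int[leb]_(t in `]x, y]) k t <= w y.
Proof.
move=> x0 xy y1 xyU.
have xy01 : `]x, y] `<=` `[0, 1].
  move=> t /=; rewrite !in_itv/= => /andP[xt ty].
  by rewrite (le_trans x0 (ltW xt)) (le_trans ty).
have x1 := le_trans xy y1.
have mxy : measurable (`]x, y]%classic : set (measurableTypeR R)) by [].
have ix : leb.-integrable (U `&` `[0, x]) (EFin \o k) by apply: ikS => //; exact: Ux1.
have iy : leb.-integrable (U `&` `[0, y]) (EFin \o k) by apply: ikS => //; exact: Ux1.
have ixy : leb.-integrable `]x, y] (EFin \o k) by exact: ikS.
rewrite /w /Rintegral -fineD; [|exact: (integrable_fin_num (mUI x) ix)|exact: (integrable_fin_num mxy ixy)].
have sub : (U `&` `[0, x]) `|` `]x, y] `<=` U `&` `[0, y].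
  move=> t [[Ut]|] /=; rewrite !in_itv/=.
    by move=> /andP[-> tx]; split => //; exact: le_trans xy.
  move=> /andP[xt ty]; rewrite (le_trans x0 (ltW xt)) ty; split => //.
  by apply: xyU; rewrite /= in_itv/= xt.
rewrite -ge0_integral_setU//; last 3 first.
- apply: measurable_funS (measurable_int _ iy) => //.
- by move=> t _; rewrite lee_fin.
- rewrite disj_set2E; apply/eqP/seteqP; split => // t [[_]] /=.
  by rewrite !in_itv/= => /andP[_ tx] /andP[]; rewrite ltNge tx.
have mXY : measurable ((U `&` `[0, x]) `|` `]x, y] : set (measurableTypeR R)).
  exact: measurableU.
rewrite fine_le//.
- apply: (integrable_fin_num mXY (ikS mXY _)) => //.
  by apply: subset_trans sub _; exact: Ux1.
- exact: (integrable_fin_num (mUI y) iy).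
- apply: ge0_subset_integral => //; first exact: (measurable_int _ iy).
  by move=> t _; rewrite lee_fin.
Qed.

End open_set_mass.

Definition scalar_ac (f : R -> R) :=
  forall e : R, 0 < e -> exists2 d : R, 0 < d &
    forall (k : nat) (a b : 'I_k -> R),
      (forall i, 0 <= a i /\ a i <= b i /\ b i <= 1) ->
      (forall i j, i != j -> b i <= a j \/ b j <= a i) ->
      \sum_(i < k) (b i - a i) < d ->
      \sum_(i < k) `|f (b i) - f (a i)| < e.

(** Real induction adds intervals at the right end by [cons], so the lists are sorted with the
    rightmost interval first; this order supplies the disjointness that [scalar_ac] asks for. *)
Lemma scalar_ac_seq (f : R -> R) (e : R) : scalar_ac f -> 0 < e ->
  exists2 d : R, 0 < d & forall l : seq (R * R),
    all (fun p => [&& 0 <= p.1, p.1 <= p.2 & p.2 <= 1]) l ->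
    pairwise (fun p q : R * R => q.2 <= p.1) l ->
    \sum_(p <- l) (p.2 - p.1) < d -> \sum_(p <- l) `|f p.2 - f p.1| < e.
Proof.
move=> fac e0; have [d d0 H] := fac e e0; exists d => // l /(all_nthP (0, 0)) l01.
move=> /(pairwiseP (0, 0)) lp.
rewrite !(big_nth (0, 0)) !big_mkord => ld.
apply: (H _ (fun i => (nth (0, 0) l i).1) (fun i => (nth (0, 0) l i).2)) => //.
- by move=> i; have /and3P[] := l01 i (ltn_ord i).
- move=> i j ij; have := neq_ltn i j; rewrite (_ : (i != j :> nat) = true)// => /esym/orP[] lt.
  + by right; apply: lp; rewrite ?inE ?ltn_ord.
  + by left; apply: lp; rewrite ?inE ?ltn_ord.
Qed.

(* The set where f - \int g fails to have derivative 0 is covered by an open set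
   U of small measure.  Real induction bounds the variation of f - \int g up to x
   by eps * x plus the variation of f on finitely many intervals inside U plus
   the integral of |g| over U. *)
Lemma ftc_scalar_ac (f g : R -> R) : scalar_ac f ->
  leb.-integrable [set: R] (EFin \o g) ->
  {ae leb, forall t : R, t \in `[0, 1] -> is_derive t 1 f (g t)} ->
  \int[leb]_(t in `[0, 1]) g t = f 1 - f 0.
Proof.
move=> fac ig fg.
have igS (A : set (measurableTypeR R)) : measurable A -> leb.-integrable A (EFin \o g).
  by move=> mA; apply: integrableS ig.
pose F x := \int[leb]_(t in `[0, x]) g t.
pose h x := f x - F x.
have F0 : F 0 = 0 by rewrite /F set_itv1 Rintegral_set1.
suff : h 1 = h 0.
  rewrite /h F0 subr0 => /eqP; rewrite subr_eq => /eqP ->.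
  by rewrite addrC addKr.
have locg : locally_integrable [set: R] g.
  have := @integrable_locally R g setT measurableT ig.
  by rewrite patch_setT.
have hd : {ae leb, forall t : R, t \in `[0, 1] -> is_derive t 1 h 0}.
  (* [FTC1] differentiates F only at t > 0, so the null set {0} is discarded. *)
  have tn0 : {ae leb, forall t : R, t != 0}.
    exists [set 0]; split; [exact: measurable_set1|exact: lebesgue_measure_set1|].
    by move=> t /= /negP/negPn/eqP.
  move: fg (@FTC1 R g (BLeft 0) (fun y => igS _ (measurable_itv _)) locg) tn0.
  apply: filterS3; first exact: (ae_filter_ringOfSetsType leb).
  move=> t fg FT tn0 t01.
  have [dF F'] : derivable F t 1 /\ (F^`())%classic t = g t.
    apply: FT; move: t01; rewrite in_itv/= => /andP[t0 _].
    by rewrite lte_fin lt_neqAle eq_sym tn0.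
  have dF' : is_derive t 1 F (g t) by apply: DeriveDef; rewrite -?derive1E.
  have := is_deriveB (fg t01) dF'; rewrite subrr; exact.
have [N [mN N0 hN]] := hd.
apply/eqP; rewrite -subr_eq0 -normr_le0; apply/ler_addgt0Pl => e e0; rewrite addr0.
(* One third for the points where h has derivative 0, one for the variation of f inside U, one for
   the integral of |g| over U. *)
pose e3 := e / 3.
have e30 : 0 < e3 by rewrite divr_gt0.
have [d1 d10 H1] := scalar_ac_seq fac e30.
have [d2 [d20 H2]] := integral_normr_continuous ig e30.
(* [d1] comes from the absolute continuity of f, [d2] from that of the integral of |g|. *)
pose d := Num.min d1 d2.
have d0 : 0 < d by rewrite lt_min d10.
have Noo : (leb N < +oo)%E by rewrite N0.
(* Outer regularity controls U minus N; since N is null, U itself has measure below d. *)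
have [U [oU NU Ud]] : exists U : set R, [/\ open U, N `<=` U & (leb U < d%:E)%E].
  have [U [oU NU Ud]] := @lebesgue_regularity_outer R N d mN Noo d0.
  exists U; split => //; rewrite (le_lt_trans _ Ud)//.
  have mU := open_measurable oU.
  rewrite -[in leLHS](setDUK NU); apply: le_trans.
    by apply: measureU2 => //; exact: measurableD.
  by rewrite [X in (X + _)%E](_ : _ = 0%E) ?add0e.
have mU : measurable (U : set (measurableTypeR R)) by exact: open_measurable.
pose u (x : R) : R := \int[leb]_(t in U `&` `[0, x]) (cst 1 t).
pose v (x : R) : R := \int[leb]_(t in U `&` `[0, x]) `|g t|.
have i1 : leb.-integrable `[0, 1] (EFin \o cst (1 : R)).
  apply/integrableP; split; first exact/measurable_EFinP.
  under eq_integral do rewrite /= normr1.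
  by rewrite integral_cst//= mul1e lebesgue_measure_itv/= lte_fin ltr01 -EFinB ltry.
have iv : leb.-integrable `[0, 1] (EFin \o (fun t => `|g t|)).
  exact: (integrable_abse (igS _ (measurable_itv `[0, 1]))).
have g0 t : 0 <= `|g t| by [].
have c0 (t : R) : 0 <= cst (1 : R) t by rewrite ler01.
(* The list [l] records the intervals crossed inside U, where the derivative of h is not controlled;
   their total length is bounded by the length of U up to x. *)
pose P x := exists l : seq (R * R),
  [/\ all (fun p => [&& 0 <= p.1, p.1 <= p.2 & p.2 <= x]) l,
      pairwise (fun p q : R * R => q.2 <= p.1) l,
      \sum_(p <- l) (p.2 - p.1) <= u x &
      `|h x - h 0| <= e3 * x + \sum_(p <- l) `|f p.2 - f p.1| + v x].
have : P 1.
  apply: real_induction.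
    exists [::]; split => //.
      by rewrite big_nil /u Rintegral_ge0//.
    by rewrite subrr normr0 big_nil mulr0 !add0r Rintegral_ge0.
  move=> s s01.
  (* Either s lies in U, and short intervals ending or starting at s stay in U, or s avoids N, and h
     has derivative 0 at s. *)
  have [r r0 Hr] : exists2 r : R, 0 < r & forall x y, 0 <= x -> x <= y -> y <= 1 ->
      (x = s \/ y = s) -> y - x < r ->
      (`|h y - h x| <= e3 * (y - x)) \/ `]x, y] `<=` U.
    have [Us|Us] := pselect (U s).
      have /nbhs_ballP[r /= r0 rU] := open_nbhs_nbhs (conj oU Us).
      exists r => // x y x0 xy y1 xys yxr; right => t /=; rewrite in_itv/= => /andP[xt ty].
      apply: rU; rewrite /ball/= ltr_norml; case: xys => ?; subst s.
      - by apply/andP; split; lra.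
      - by apply/andP; split; lra.
    have [|r r0 Hr] := @is_derive0_lipschitz h s e3 e30.
      apply: contrapT => nd; apply: Us; apply: NU; apply: hN => /=.
      by move=> H; apply: nd; apply: H; rewrite in_itv.
    exists r => // x y x0 xy y1 xys yxr; left; case: xys => ?; subst s.
    - have := Hr y; rewrite (ger0_norm (_ : 0 <= y - x)) ?subr_ge0//; exact.
    - have := Hr x; rewrite distrC (distrC (h x)) (ger0_norm (_ : 0 <= y - x)) ?subr_ge0//; exact.
  exists r => // x y x0 xy y1 xys yxr [l [l1 l2 l3 l4]].
  have [hh|xyU] := Hr x y x0 xy y1 xys yxr.
    exists l; split => //.
    - apply: sub_all l1 => p /and3P[-> -> /= px]; exact: le_trans xy.
    - by apply: le_trans l3 _; exact: mass_le.
    - have -> : h y - h 0 = (h y - h x) + (h x - h 0) by rewrite addrA subrK.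
      apply: le_trans (ler_normD _ _) _; apply: le_trans (lerD hh l4) _.
      have := mass_le mU g0 iv xy y1; rewrite -/(v x) -/(v y) => vv; lra.
  exists ((x, y) :: l); split.
  - rewrite /= x0 xy lexx/=; apply: sub_all l1 => p /and3P[-> -> /= px].
    exact: le_trans xy.
  - rewrite pairwise_cons l2 andbT; apply: sub_all l1 => p /and3P[_ _ px] //.
  - rewrite big_cons/= addrC; apply: le_trans (mass_ge_itv mU c0 i1 x0 xy y1 xyU).
    rewrite lerD// Rintegral_cst// mul1r. rewrite /= lebesgue_measure_itv/= lte_fin.
    by case: ltgtP xy => //= -> _; rewrite subrr.
  - have hyx : `|h y - h x| <= `|f y - f x| + \int[leb]_(t in `]x, y]) `|g t|.
      have -> : h y - h x = (f y - f x) - (F y - F x) by rewrite /h; ring.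
      apply: le_trans (ler_normB _ _) _; rewrite lerD2l /F.
      rewrite Rintegral_itvB//; [|exact: igS].
      apply: le_normr_Rintegral => //; exact: igS.
    have -> : h y - h 0 = (h y - h x) + (h x - h 0) by rewrite addrA subrK.
    apply: le_trans (ler_normD _ _) _; apply: le_trans (lerD hyx l4) _.
    have := mass_ge_itv mU g0 iv x0 xy y1 xyU; rewrite -/(v x) -/(v y) => vv.
    rewrite big_cons/=.
    have : e3 * x <= e3 * y by rewrite ler_wpM2l// ltW.
    move=> exy; lra.
move=> [l [l1 l2 l3 l4]]; apply: le_trans l4 _.
pose U1 : set (measurableTypeR R) := U `&` `[0, 1].
have mU1 : measurable U1 by exact: measurableI.
have U1d : (leb U1 < d%:E)%E.
  by rewrite (le_lt_trans _ Ud)// le_measure ?inE//; exact: subIsetl.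
have U1fin : leb U1 \is a fin_num.
  by rewrite ge0_fin_numE// (lt_trans U1d)// ltry.
have u1 : u 1 < d1.
  rewrite /u -/U1 Rintegral_cst// mul1r -lte_fin fineK// (lt_le_trans U1d)//.
  by rewrite lee_fin ge_min lexx.
have v1 : v 1 < e3.
  by apply: H2 => //; rewrite (lt_le_trans U1d)// lee_fin ge_min lexx orbT.
have := H1 l l1 l2 (le_lt_trans l3 u1).
move=> s1; rewrite mulr1.
have : e = e3 + e3 + e3 by rewrite /e3; field.
lra.
Qed.

End ftc_absolutely_continuous.

Section continuously_differentiable.
Context {R : realType} {m : nat}.
Implicit Types (f : 'rV[R]_m -> R) (x y v : 'rV[R]_m).

Local Notation "'d_ j f" := ('D_(delta_mx ord0 j) f) (at level 10, j at level 2, f at level 9).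

(** The coordinates of x are replaced by those of y one at a time, with the one-variable mean value
    theorem on each segment. Only partial derivatives enter, as in the definition of [Ck]. *)
Lemma coordinate_mean_value f x y : Ck 1 f ->
  exists xi : 'I_m -> 'rV[R]_m,
    (forall j k, Num.min (x ord0 k) (y ord0 k) <= xi j ord0 k <=
                 Num.max (x ord0 k) (y ord0 k)) /\
    f y - f x = \sum_j 'd_j f (xi j) * (y ord0 j - x ord0 j).
Proof.
move=> [cf Hf].
pose z (i : nat) : 'rV[R]_m := \row_k (if (k < i)%N then y ord0 k else x ord0 k).
have zE (j : 'I_m) : z j.+1 = (y ord0 j - x ord0 j) *: delta_mx ord0 j + z j.
  apply/rowP => k; rewrite !mxE eqxx/= ltnS leq_eqVlt val_eqE.
  have [->|kj] := eqVneq k j; last by rewrite mulr0 add0r.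
  by rewrite ltnn mulr1 subrK.
have step (j : 'I_m) : exists xi : 'rV[R]_m,
    (forall k, Num.min (x ord0 k) (y ord0 k) <= xi ord0 k <=
                 Num.max (x ord0 k) (y ord0 k)) /\
    f (z j.+1) - f (z j) = 'd_j f xi * (y ord0 j - x ord0 j).
  set d := y ord0 j - x ord0 j.
  (* Running s over [0, 1] with the factor d treats both signs of d, and d = 0, at once. *)
  pose ph (s : R) := f ((d * s) *: delta_mx ord0 j + z j).
  have dph (s : R) : is_derive s 1 ph ('d_j f ((d * s) *: delta_mx ord0 j + z j) * d).
    apply: (@is_derive1_compose _ (fun s => d * s) (fun r => f (r *: delta_mx ord0 j + z j))).
      have := is_deriveZ d (is_derive_id s 1).
      by move=> D; apply: (is_derive_eq D); exact: mulr1.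
    by apply/is_derive_line_at; apply: DeriveDef => //; exact: (Hf j).1.
  have cph : {within `[0, 1], continuous ph}.
    apply: continuous_subspaceT => s; apply/differentiable_continuous/derivable1_diffP.
    by have [] := dph s.
  have [s s01] := @MVT_segment _ ph _ 0 1 ler01 (fun s _ => dph s) cph.
  rewrite subr0 mulr1 /ph mulr1 mulr0 scale0r add0r -zE => ->.
  exists ((d * s) *: delta_mx ord0 j + z j); split => // k.
  rewrite !mxE eqxx/=; move: s01; rewrite in_itv/= => /andP[s0 s1].
  have [->|kj] := eqVneq k j.
    rewrite ltnn mulr1 /d; have [xy|xy] := leP (x ord0 j) (y ord0 j); apply/andP; split; nra.
  rewrite mulr0 add0r; case: ifP => _; rewrite ge_min le_max lexx ?orbT//.
have [xi Hxi] := choice step.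
exists xi; split; first by move=> j k; exact: (Hxi j).1.
transitivity (\sum_(0 <= i < m) (f (z i.+1) - f (z i))).
  rewrite telescope_sumr//; congr (f _ - f _); apply/rowP => k; rewrite mxE//.
  by rewrite ltn_ord.
by rewrite big_mkord; apply: eq_bigr => j _; exact: (Hxi j).2.
Qed.

Lemma Ck1_partial_continuous f j : Ck 1 f -> continuous ('d_j f).
Proof. by move=> [_ /(_ j)[_ []]]. Qed.

Lemma Ck1_partial f j x : Ck 1 f -> is_derive x (delta_mx ord0 j) f ('d_j f x).
Proof. by move=> [_ /(_ j)[df _]]; apply: DeriveDef. Qed.

Lemma rV_norm_le x (M : R) : 0 <= M -> (forall k, `|x ord0 k| <= M) -> `|x| <= M.
Proof.
move=> M0 xM; rewrite [leLHS]/Num.Def.normr/= mx_normrE (bigmax_le _ M0)// => -[i j] _ /=.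
by have -> : i = ord0 by exact: ord1.
Qed.

Lemma rV_coord_le x k : `|x ord0 k| <= `|x|.
Proof.
rewrite [leRHS]/Num.Def.normr/= mx_normrE.
by apply: le_trans; last exact: (le_bigmax _ _ (ord0, k)).
Qed.

Lemma between_dist (a b c : R) :
  Num.min a b <= c <= Num.max a b -> `|c - a| <= `|b - a|.
Proof.
by have [ab|ab] := leP a b => /andP[h1 h2]; rewrite ler_norml; apply/andP; split;
  [rewrite ger0_norm; lra|rewrite ger0_norm; lra|rewrite ler0_norm; lra|rewrite ler0_norm; lra].
Qed.

Lemma between_norm (a b c M : R) :
  Num.min a b <= c <= Num.max a b -> `|a| <= M -> `|b| <= M -> `|c| <= M.
Proof.
by rewrite !ler_norml => + /andP[? ?] /andP[? ?]; have [ab|ab] := leP a b => /andP[h1 h2];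
  apply/andP; split; lra.
Qed.

Lemma continuous_bounded_ball (f : 'rV[R]_m -> R) (M : R) : continuous f ->
  exists2 C : R, 0 <= C & forall x, `|x| <= M -> `|f x| <= C.
Proof.
move=> cf; pose A : set 'rV[R]_m := [set x | `|x| <= M].
have cA : compact A.
  apply: bounded_closed_compact.
    by exists M; split; [exact: num_real|move=> N MN x /= xM; rewrite (le_trans xM)// ltW].
  apply: (@preimage_closed _ _ (fun x : 'rV[R]_m => `|x|) [set y : R | y <= M]).
    by move=> x _; exact: norm_continuous.
  exact: closed_le.
have [C [_ HC]] := compact_bounded (continuous_compact (continuous_subspaceT cf) cA).
exists (`|C| + 1) => [|x xM]; first by rewrite addr_ge0.
apply: HC; first by rewrite (le_lt_trans (ler_norm _))// ltrDl.
by exists x.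
Qed.

(** The norm is the maximum of the coordinates, so the mean value points, which lie coordinatewise
    between x and y, stay in the same ball, where the partial derivatives are bounded. *)
Lemma Ck1_lipschitz f (M : R) : Ck 1 f -> exists2 C : R, 0 <= C &
  forall x y, `|x| <= M -> `|y| <= M -> `|f y - f x| <= C * `|y - x|.
Proof.
move=> fC; have /choice[C HC] : forall j, exists C : R, 0 <= C /\ forall x, `|x| <= M -> `|'d_j f x| <= C.
  move=> j; have [C C0 HC] := continuous_bounded_ball M (@Ck1_partial_continuous f j fC).
  by exists C.
exists (\sum_j C j); first by apply: sumr_ge0 => j _; exact: (HC j).1.
move=> x y xM yM; have M0 : 0 <= M by exact: le_trans xM.
have [xi [xi1 ->]] := coordinate_mean_value x y fC.
rewrite mulr_suml (le_trans (ler_norm_sum _ _ _))//; apply: ler_sum => j _.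
rewrite normrM ler_pM//.
  apply: (HC j).2; apply: rV_norm_le => // k.
  by apply: between_norm (xi1 j k) _ _; rewrite (le_trans (rV_coord_le _ _)).
by have := rV_coord_le (y - x) j; rewrite !mxE.
Qed.

(** In [coordinate_mean_value] between g t and g (t + h), the mean value points tend to g t, so
    continuity of the partial derivatives lets each summand pass to the limit. *)
Lemma Ck1_chain_rule f (g : R -> 'rV[R]_m) (t : R) : Ck 1 f ->
  derivable g t 1 ->
  is_derive t 1 (f \o g) (\sum_j 'd_j f (g t) * (derive1 g t) ord0 j).
Proof.
move=> fC gd.
have cg : {for t, continuous g}.
  by apply/differentiable_continuous/derivable1_diffP.
suff cv : (fun h => h^-1 *: (f (g (h *: (1 : R) + t)) - f (g t))) @ 0^' -->
    \sum_j 'd_j f (g t) * (derive1 g t) ord0 j.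
  apply: DeriveDef; first by apply/cvg_ex; eexists; exact: cv.
  exact: cvg_lim cv.
have /choice[xi Hxi] : forall h : R, exists xi : 'I_m -> 'rV[R]_m,
    (forall j k, Num.min (g t ord0 k) (g (h *: (1 : R) + t) ord0 k) <= xi j ord0 k <=
                 Num.max (g t ord0 k) (g (h *: (1 : R) + t) ord0 k)) /\
    f (g (h *: (1 : R) + t)) - f (g t) =
      \sum_j 'd_j f (xi j) * (g (h *: (1 : R) + t) ord0 j - g t ord0 j).
  by move=> h; exact: coordinate_mean_value.
rewrite (_ : (fun h => _) = (fun h => \sum_j 'd_j f (xi h j) *
    (h^-1 *: (g (h *: (1 : R) + t) ord0 j - g t ord0 j)))); last first.
  apply/funext => h; rewrite (Hxi h).2 scaler_sumr; apply: eq_bigr => j _.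
  by rewrite [LHS]mulrCA.
apply: cvg_big => [|j _]; first exact: add_continuous.
have cxi : (fun h => xi h j) @ (0 : R)^' --> g t.
  apply/cvgrPdist_le => /= e e0.
  have : \forall h \near (0 : R)^', `|g t - g (h *: (1 : R) + t)| <= e.
    move/cvgrPdist_le : cg => /(_ e e0) /nbhs_ballP[d /= d0 gd'].
    exists d => //= h hd _; apply: gd'; move: hd.
    by rewrite /ball/= sub0r normrN [h *: 1]mulr1 opprD addrCA subrr addr0 normrN.
  apply: filterS => h gh.
  rewrite distrC; apply: rV_norm_le; first exact: ltW.
  move=> k; rewrite !mxE; apply: le_trans (between_dist ((Hxi h).1 j k)) _.
  have := rV_coord_le (g t - g (h *: (1 : R) + t)) k; rewrite !mxE distrC => /le_trans; exact.
have gj : derivable (fun s => g s ord0 j) t 1 by exact: (derivable_mxP _ _ _).1.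
apply: cvgM; last by rewrite derive1E derive_mx// mxE; exact: gj.
apply: (@cvg_comp _ _ _ (fun h => xi h j) ('d_j f) _ (nbhs (g t))) => //.
exact: Ck1_partial_continuous.
Qed.

End continuously_differentiable.

Section horizontal_calculus.
Context {R : realType} {n : nat}.
Implicit Types (f : heis R n -> R) (x v : heis R n).

Lemma Ck1_directional m (f : 'rV[R]_m -> R) (x v : 'rV[R]_m) : Ck 1 f ->
  is_derive x v f (\sum_j 'D_(delta_mx ord0 j) f x * v ord0 j).
Proof.
move=> fC; apply/is_derive_line.
have cv : (fun h : R => h^-1 *: (((h *: (1 : R) + 0) *: v + x) - (0 *: v + x))) @ 0^' --> v.
  apply: cvg_near_cst; near=> h.
  have h0 : h != 0 by near: h; exact: nbhs_dnbhs_neq.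
  by rewrite addr0 [h *: 1]mulr1 scale0r add0r addrK scalerA mulVf// scale1r.
have dg0 : derivable (fun s : R => s *: v + x) 0 1 by apply/cvg_ex; exists v.
have g0 : 'D_1 (fun s : R => s *: v + x) 0 = v by exact: cvg_lim cv.
have := Ck1_chain_rule fC dg0.
by rewrite derive1E g0 scale0r add0r.
Unshelve. all: by end_near. Qed.

(** The coefficient of the last coordinate direction in X_i. *)
Definition vertical_coef (i : 'I_(n + n)) x : R :=
  match fintype.split i with
  | inl j => - (x ord0 (lshift 1 (rshift n j)) / 2)
  | inr j => x ord0 (lshift 1 (lshift n j)) / 2
  end.

Lemma hderivE i f x : Ck 1 f ->
  hderiv i f x = 'D_(delta_mx ord0 (lshift 1 i)) f x +
    'D_(delta_mx ord0 (rshift (n + n) ord0)) f x * vertical_coef i x.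
Proof.
move=> fC; have [_] := Ck1_directional x (hfield i x) fC; rewrite /hderiv => ->.
rewrite big_split_ord/= big_ord1; congr (_ + _ * _).
  rewrite (bigD1 i)//= big1 => [|j ji].
    by rewrite addr0 row_mxEl mxE !eqxx mulr1.
  by rewrite row_mxEl mxE (negbTE ji) andbF mulr0.
by rewrite row_mxEr mxE eqxx mulr1n.
Qed.

Lemma vertical_coef_continuous i : continuous (vertical_coef i).
Proof.
have cc k : continuous (fun x : heis R n => x ord0 k / 2).
  by move=> x; exact: (cvgM (@coord_continuous _ _ _ ord0 k x) (cvg_cst (2^-1 : R))).
rewrite /vertical_coef; case: (fintype.split i) => j x; last exact: cc.
exact: (cvgN (cc _ x)).
Qed.

Lemma hderiv_continuous i f : Ck 1 f -> continuous (hderiv i f).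
Proof.
move=> fC.
rewrite (_ : hderiv i f = (fun x => 'D_(delta_mx ord0 (lshift 1 i)) f x +
    'D_(delta_mx ord0 (rshift (n + n) ord0)) f x * vertical_coef i x)); last first.
  by apply/funext => x; rewrite hderivE.
move=> x; exact: (cvgD (@Ck1_partial_continuous _ _ f (lshift 1 i) fC x)
  (cvgM (@Ck1_partial_continuous _ _ f (rshift (n + n) ord0) fC x)
        (@vertical_coef_continuous i x))).
Qed.

(** The Euclidean chain rule pairs all partial derivatives with the velocity; writing the velocity
    as a combination of the X_i and exchanging the two sums leaves the horizontal pairing. *)
Lemma hchain_rule f (g : R -> heis R n) (t : R) : Ck 1 f ->
  derivable g t 1 -> hspace (g t) (derive1 g t) ->
  is_derive t 1 (f \o g) (hdot (hgrad f (g t)) (hspeed g t)).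
Proof.
move=> fC dg [c gc]; have := Ck1_chain_rule fC dg.
move=> D; apply: (is_derive_eq D).
rewrite gc /hspeed gc hcoordE /hdot.
under eq_bigr do rewrite summxE mulr_sumr.
rewrite exchange_big/=; apply: eq_bigr => i _.
rewrite mxE; have [_] := Ck1_directional (g t) (hfield i (g t)) fC.
rewrite /hderiv => ->; rewrite mulr_suml; apply: eq_bigr => j _.
by rewrite mxE mulrCA mulrC.
Qed.

End horizontal_calculus.

Section horizontal_curves.
Context {R : realType} {n : nat} (Om : bounded_domain R (n + n + 1)).
Local Notation leb := (@lebesgue_measure R).

Lemma closure_dom_bounded m (D : bounded_domain R m) :
  exists M : R, forall x : 'rV[R]_m, closure D x -> `|x| <= M.
Proof.
have [M [_ HM]] := dom_bounded D; exists (`|M| + 1) => x.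
have cl : closed [set x : 'rV[R]_m | `|x| <= `|M| + 1].
  apply: (@preimage_closed _ _ (fun x : 'rV[R]_m => `|x|) [set y : R | y <= `|M| + 1]).
    by move=> y _; exact: norm_continuous.
  exact: closed_le.
have : closure D `<=` [set x : 'rV[R]_m | `|x| <= `|M| + 1].
  move/closure_id : cl => ->; apply: closure_subset => y Dy /=.
  by apply: HM => //; rewrite (le_lt_trans (ler_norm _))// ltrDl.
exact.
Qed.

Lemma closure_curveR (c : curve Om) t : closure Om (curveR c t).
Proof. by rewrite /curveR; apply: set_mem; exact: valP. Qed.

Lemma hgrad_bounded (f : heis R n -> R) : Ck 1 f -> exists2 C : R, 0 <= C &
  forall x, closure Om x -> hnorm (hgrad f x) <= C.
Proof.
move=> fC; have [M HM] := closure_dom_bounded Om.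
have /choice[C HC] : forall i, exists C : R, 0 <= C /\
    forall x : heis R n, `|x| <= M -> `|hderiv i f x| <= C.
  move=> i; have [C C0 HC] := continuous_bounded_ball M (@hderiv_continuous _ _ i f fC).
  by exists C.
exists (\sum_i C i) => [|x /HM xM]; first by apply: sumr_ge0 => i _; exact: (HC i).1.
apply: le_trans (hnorm_le_sum _) _; apply: ler_sum => i _.
by rewrite mxE; exact: (HC i).2.
Qed.

Lemma measurable_hgrad_path (f : heis R n -> R) : Ck 1 f -> forall i,
  measurable_fun [set: borel (curve Om) * measurableTypeR R]
    (fun z => hgrad f (curveR z.1 z.2) ord0 i).
Proof.
move=> fC i.
have mh : measurable_fun [set: borel (cldom Om)]
    (fun x : borel (cldom Om) => hderiv i f (val x)).
  apply: continuous_real_measurable => x.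
  apply: (@continuous_comp (cldom Om) (heis R n) R val (hderiv i f)).
    exact: val_cldom_continuous.
  exact: hderiv_continuous.
have -> : (fun z : borel (curve Om) * measurableTypeR R => hgrad f (curveR z.1 z.2) ord0 i) =
  (fun x : borel (cldom Om) => hderiv i f (val x)) \o (@path_eval _ _ Om).
  by apply/funext => z; rewrite mxE.
exact: (measurableT_comp mh (@measurable_path_eval R n Om)).
Qed.

(** [f] is Lipschitz on the bounded closure, so f along the curve is absolutely continuous, and
    boundedness of [hgrad f] there makes the derivative integrable. As [velocity] is 0 off [0, 1],
    the integral may run over all times. *)
Lemma horizontal_ftc (f : heis R n -> R) (c : curve Om) : Ck 1 f ->
  horizontal (curveR c) ->
  leb.-integrable [set: R] (fun t => (hnorm (velocity (c, t)))%:E) ->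
  (\int[leb]_t (hdot (hgrad f (curveR c t)) (velocity (c, t)))%:E =
    (f (curveR c 1) - f (curveR c 0))%:E)%E.
Proof.
move=> fC [cac cd] iV.
pose g t := hdot (hgrad f (curveR c t)) (velocity (c, t)).
have mg : measurable_fun [set: measurableTypeR R] g.
  apply: measurable_sum => i; apply: measurable_funM.
    exact: (measurableT_comp (measurable_hgrad_path fC i) (pair1_measurable (c : borel (curve Om)))).
  exact: (measurableT_comp (@measurable_velocity _ _ Om i) (pair1_measurable (c : borel (curve Om)))).
have [C C0 HC] := hgrad_bounded fC.
have ig : leb.-integrable [set: R] (EFin \o g).
  apply: (@le_integrable _ _ _ _ _ measurableT _ (fun t => C%:E * (hnorm (velocity (c, t)))%:E)%E).
  - exact/measurable_EFinP.
  - move=> t _; rewrite -EFinM lee_fin (le_trans (hdot_norm_le _ _))//.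
    rewrite (ger0_norm (mulr_ge0 C0 (hnorm_ge0 _))) ler_wpM2r ?hnorm_ge0// HC//.
    exact: closure_curveR.
  - exact: integrableZl.
have fac : scalar_ac (f \o curveR c).
  have [M HM] := closure_dom_bounded Om.
  have [L L0 HL] := Ck1_lipschitz M fC.
  move=> e e0; have [d d0 H] := cac (e / (L + 1)) (divr_gt0 e0 (ltr_wpDl L0 ltr01)).
  exists d => // k a b ab01 abd abs.
  have := H k a b ab01 abd abs; rewrite ltr_pdivlMr ?ltr_wpDl// => Hab.
  apply: le_lt_trans Hab; rewrite mulr_suml; apply: ler_sum => i _.
  apply: (@le_trans _ _ (L * `|curveR c (b i) - curveR c (a i)|)).
    by apply: HL; apply: HM; exact: closure_curveR.
  by rewrite mulrC ler_wpM2l// lerDl.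
have fd : {ae leb, forall t : R, t \in `[0, 1] -> is_derive t 1 (f \o curveR c) (g t)}.
  move: cd; apply: filterS; first exact: (ae_filter_ringOfSetsType leb).
  move=> t H t01; have [dc hc] := H t01.
  by rewrite /g velocityE//; exact: hchain_rule.
have := ftc_scalar_ac fac ig fd; rewrite /= => <-.
rewrite /Rintegral fineK; last first.
  apply: integrable_fin_num => //; exact: integrableS ig.
rewrite [RHS]integral_mkcond; apply: eq_integral => t _.
rewrite patchE; case: ifPn => //; rewrite notin_setE /= => /negP t01.
by rewrite velocity_out// hdotC /hdot big1// => i _; rewrite mxE mul0r.
Qed.

End horizontal_curves.

(** * Traffic intensities *)

Section closure_of_domain.
Context {R : realType} {m : nat} (Om : bounded_domain R m).

(** A left inverse of [val], with the default [point] off the closure; it moves functions and Borel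
    sets between the subtype and the ambient space. *)
Definition to_cldom (x : 'rV[R]_m) : cldom Om :=
  match pselect (closure Om x) with
  | left h => exist (fun x => x \in closure Om) x (mem_set h)
  | right _ => point
  end.

Lemma to_cldomK (x : 'rV[R]_m) : closure Om x -> val (to_cldom x) = x.
Proof. by move=> h; rewrite /to_cldom; case: pselect. Qed.

Lemma closure_val (y : cldom Om) : closure Om (val y).
Proof. by apply: set_mem; exact: valP. Qed.

Lemma valK_cldom (y : cldom Om) : to_cldom (val y) = y.
Proof. by apply: val_inj; rewrite to_cldomK//; exact: closure_val. Qed.

(** Compactness is available for the closure as a subset of R^m, hence the detour through
    [to_cldom]. *)
Lemma cldom_bounded (f : cldom Om -> R) : continuous f ->
  exists2 C : R, 0 <= C & forall y, `|f y| <= C.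
Proof.
move=> cf; pose A := closure Om.
have cA : compact A.
  apply: bounded_closed_compact; last exact: closed_closure.
  have [M HM] := closure_dom_bounded Om.
  by exists M; split; [exact: num_real|move=> N MN x /HM xM; rewrite /= (le_trans xM)// ltW].
have cg : {within A, continuous (f \o to_cldom)}.
  apply/subspace_sigL_continuousP.
  rewrite (_ : sigL A (f \o to_cldom) = f)//.
  by apply/funext => y; rewrite /sigL/= valK_cldom.
have [C [_ HC]] := compact_bounded (continuous_compact cg cA).
exists (`|C| + 1) => [|y]; first by rewrite addr_ge0.
apply: HC; first by rewrite (le_lt_trans (ler_norm _))// ltrDl.
by exists (val y); [exact: closure_val|rewrite /= valK_cldom].
Qed.

Lemma measurable_val_cldom :
  measurable_fun [set: borel (cldom Om)] (val : borel (cldom Om) -> borel 'rV[R]_m).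
Proof. by apply: continuous_borel_measurable; exact: val_cldom_continuous. Qed.

Lemma measurable_closure (D : set 'rV[R]_m) : measurable (closure D : set (borel 'rV[R]_m)).
Proof.
rewrite -(setCK (closure D)); apply: measurableC.
by apply: sub_sigma_algebra; apply: closed_openC; exact: closed_closure.
Qed.

Lemma measurable_open (D : set 'rV[R]_m) : open D -> measurable (D : set (borel 'rV[R]_m)).
Proof. exact: sub_sigma_algebra. Qed.

Lemma measurable_to_cldom :
  measurable_fun [set: borel 'rV[R]_m] (to_cldom : borel 'rV[R]_m -> borel (cldom Om)).
Proof.
apply: measurable_cldom.
rewrite (_ : (fun x => _) = (fun x : borel 'rV[R]_m =>
    if x \in closure Om then x else val (point : cldom Om))).
  apply: measurable_fun_ifT => //.
    apply: (measurable_fun_bool true); rewrite setTI.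
    rewrite (_ : _ @^-1` _ = closure Om); first exact: measurable_closure.
    by apply/seteqP; split => x /=; [exact: set_mem|exact: mem_set].
apply/funext => x; case: ifPn => [/set_mem/to_cldomK//|].
by rewrite notin_setE /to_cldom; case: pselect.
Qed.

Lemma cldom_preimage (A : set (cldom Om)) :
  val @^-1` (to_cldom @^-1` A) = A.
Proof. by apply/seteqP; split => y /=; rewrite valK_cldom. Qed.

(** Replaces an image by a preimage, whose measurability is immediate. *)
Lemma dom_image_cldom (A : set (cldom Om)) :
  (Om : set _) `&` (val @` A) = (Om : set _) `&` (to_cldom @^-1` A).
Proof.
apply/seteqP; split => x [Ox].
  by move=> [y Ay yx]; split => //=; rewrite -yx valK_cldom.
move=> /= Ax; split => //; exists (to_cldom x) => //.
by rewrite to_cldomK//; exact: subset_closure.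
Qed.

End closure_of_domain.

Section lebesgue_rV_bounded.
Context {R : realType}.

Lemma cons_rV0 m (t : R) (v : 'rV[R]_m) : cons_rV (t, v) ord0 ord0 = t.
Proof. by rewrite /cons_rV mxE; case: splitP => // i _; rewrite (ord1 i) mxE. Qed.

Lemma cons_rVS m (t : R) (v : 'rV[R]_m) j :
  cons_rV (t, v) ord0 (lift ord0 j) = v ord0 j.
Proof.
rewrite /cons_rV mxE; case: splitP => [i|i /=]; first by rewrite (ord1 i).
by move=> [ij]; congr (v _ _); apply: val_inj.
Qed.

(** By induction along the iterated product: a cube is an interval times a cube of one dimension
    less. *)
Lemma lebesgue_rV_box m (M : R) :
  (lebesgue_rV R m (box (const_mx (- M)) (const_mx M))%R < +oo)%E.
Proof.
elim: m => [|m IH] /=; first by rewrite diracE ltry.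
rewrite /lebesgue_step /pushforward.
rewrite (_ : _ @^-1` _ = `]- M, M[%classic `*` box (const_mx (- M)) (const_mx M)).
  rewrite product_measure1E//; last exact: measurable_box.
  rewrite lte_mul_pinfty//.
  by rewrite /= lebesgue_measure_itv/=; case: ifP.
apply/seteqP; split => [[t v] /= h|[t v] /= [h1 h2] j].
  split => [/=|j].
    by rewrite in_itv/=; have := h ord0; rewrite cons_rV0 !mxE.
  by have := h (lift ord0 j); rewrite cons_rVS !mxE.
have [k ->|->] := unliftP ord0 j; first by have := h2 k; rewrite cons_rVS !mxE.
by rewrite cons_rV0 !mxE; move: h1; rewrite in_itv.
Qed.

Lemma lebesgue_rV_bounded m (Om : bounded_domain R m) : (lebesgue_rV R m Om < +oo)%E.
Proof.
have [M HM] := closure_dom_bounded Om.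
have Msub : (Om : set _) `<=` box (const_mx (- (M + 1))) (const_mx (M + 1)).
  move=> x /subset_closure/HM xM j; rewrite !mxE -ltr_norml.
  by rewrite (le_lt_trans (rV_coord_le _ _))// (le_lt_trans xM)// ltrDl.
apply: le_lt_trans (lebesgue_rV_box m (M + 1)).
apply: le_measure => //; rewrite inE; last exact: measurable_box.
by apply: measurable_open; exact: dom_open.
Qed.

End lebesgue_rV_bounded.

Section traffic_plans.
Context {R : realType} {n : nat} (Om : bounded_domain R (n + n + 1)).
Variables (mu nu : probability (borel (cldom Om)) R).
Variable Q : probability (borel (curve Om)) R.
Hypothesis hQ : {ae Q, forall c, horizontal (curveR c)}.
Local Notation leb := (@lebesgue_measure R).
Local Notation P := (borel (curve Om) * measurableTypeR R)%type.
Local Notation M := (Q \x leb)%E.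
Local Notation e := (@path_eval R n Om).
Local Notation V := (@velocity R n Om).
Local Open Scope ereal_scope.

(** The exchange is made separately in time and in the curve, almost everywhere, so nothing is asked
    of [hspeed] as a joint function. [psi] must vanish at velocity 0 because V is 0 outside
    [0, 1]. *)
Lemma traffic_integralE (psi : P -> horiz R n -> R) :
  (forall z, psi z 0 = 0)%R ->
  \int[Q]_c \int[leb]_(t in `[0%R, 1%R]) (psi (c, t) (hspeed (curveR c) t))%:E =
  \int[Q]_c \int[leb]_t (psi (c, t) (V (c, t)))%:E.
Proof.
move=> psi0; apply: eq_integral_ae; move: hQ; apply: filterS.
  exact: (ae_filter_ringOfSetsType Q).
move=> c [_ hc] _.
rewrite [RHS](_ : _ = \int[leb]_(t in `[0%R, 1%R]) (psi (c, t) (V (c, t)))%:E).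
  apply: eq_integral_ae; move: hc; apply: filterS.
    exact: (ae_filter_ringOfSetsType leb).
  by move=> t hc t01; have [dc _] := hc t01; rewrite velocityE.
rewrite [RHS]integral_mkcond; apply: eq_integral => t _; rewrite patchE.
by case: ifPn => //; rewrite notin_setE /= => /negP t01; rewrite velocity_out// psi0.
Qed.

Let mV k : measurable_fun [set: P] (fun z => V z ord0 k).
Proof. exact: measurable_velocity. Qed.

Let mhV : measurable_fun [set: P] (fun z => hnorm (V z)).
Proof. exact: measurable_hnorm. Qed.

Let me : measurable_fun [set: P] e. Proof. exact: measurable_path_eval. Qed.

Section with_intensity.
Variable m : {finite_measure set (borel (cldom Om)) -> \bar R}.
Hypothesis hm : traffic_intensity Q m.

Lemma traffic_intensityE (f : cldom Om -> R) : continuous f -> (forall y, 0 <= f y)%R ->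
  \int[m]_y (f y)%:E = \int[M]_z (f (e z) * hnorm (V z))%:E.
Proof.
move=> cf f0; rewrite hm//.
rewrite (traffic_integralE (psi := fun z v => (f (e z) * hnorm v)%R)); last first.
  by move=> z; rewrite /hnorm /hdot big1 ?sqrtr0 ?mulr0// => i _; rewrite mxE mulr0.
rewrite fubini_tonelli1//.
- apply/measurable_EFinP; apply: measurable_funM => //.
  apply: (measurableT_comp _ me); exact: continuous_real_measurable.
- by move=> z; rewrite lee_fin mulr_ge0// hnorm_ge0.
Qed.

(** Testing i_Q with the constant 1 shows that the integral of |V| is the total mass of i_Q, which
    is finite. *)
Lemma integrable_velocity : M.-integrable [set: P] (fun z => (hnorm (V z))%:E).
Proof.
apply/integrableP; split; first exact/measurable_EFinP.
under eq_integral do rewrite gee0_abs ?lee_fin ?hnorm_ge0//.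
have c1 : continuous (cst (1%R : R) : cldom Om -> R) by exact: cst_continuous.
have := traffic_intensityE c1 (fun=> ler01).
under [RHS]eq_integral do rewrite mul1r.
move=> <-; rewrite (integral_cst m measurableT 1%:E) mul1e -ge0_fin_numE//.
exact: fin_num_measure.
Qed.

(** Both sides, as measures on the ambient space, are finite and have the same integrals of bumps,
    these being continuous and nonnegative. *)
Lemma intensity_image (A : set (borel (heis R n))) : measurable A ->
  m (val @^-1` A) = \int[M]_(z in (val \o e) @^-1` A) (hnorm (V z))%:E.
Proof.
have mval := @measurable_val_cldom R _ Om.
have mve : measurable_fun [set: P] (val \o e : P -> borel (heis R n)).
  exact: measurableT_comp mval me.
have m1 : measurable_fun [set: borel (cldom Om)] (cst (1%R : R)) by [].
(* With density 1 this is just the image of m under [val]. *)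
pose m' := density_image m mval m1 (fun=> ler01).
pose j' := density_image M mve mhV (fun z => hnorm_ge0 (V z)).
have m'E B : measurable B -> m' B = m (val @^-1` B).
  move=> mB; rewrite /m' /density_image (integral_cst _ _ 1%:E) ?mul1e//.
  by rewrite -[X in measurable X]setTI; exact: (mval measurableT B mB).
move=> mA; rewrite -m'E//; apply: (@eq_measure_bump R _ m' j') => //.
- rewrite [X in X < _](m'E setT measurableT) preimage_setT -ge0_fin_numE//.
  exact: fin_num_measure.
- rewrite /= /density_image preimage_setT.
  have /integrableP[_] := integrable_velocity; apply: le_lt_trans.
  apply: le_integral_ae; apply: aeW => z _.
  by rewrite gee0_abs ?lee_fin ?hnorm_ge0.
- move=> a b k.
  have cb : continuous (bump a b k.+1%:R) := Ck_continuous (smooth_bump a b k.+1%:R 0%N).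
  have mb : measurable_fun [set: borel (heis R n)] (EFin \o bump a b k.+1%:R).
    by apply/measurable_EFinP; exact: continuous_real_measurable.
  rewrite !ge0_integral_density_image//; try by move=> y; rewrite lee_fin bump_ge0.
  under eq_integral do rewrite mule1.
  rewrite (traffic_intensityE (f := bump a b k.+1%:R \o val))//.
  - move=> y; apply: continuous_comp; [exact: val_cldom_continuous|exact: cb].
  - by move=> y; exact: bump_ge0.
Qed.

End with_intensity.
End traffic_plans.

(** * L^p functions and their Borel representatives *)

Section Lp_tools.
Context d (T : measurableType d) (R : realType).
Variable mu : {measure set T -> \bar R}.
Local Open Scope ereal_scope.

(** Rests on [le_integral_ae], so it applies to functions known only almost everywhere, such as weak
    gradients. *)
Lemma le_Lnorm_ae (f g : T -> \bar R) (p : R) : (0 < p)%R ->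
  {ae mu, forall x, `|f x| <= `|g x|} ->
  'N[mu]_(p%:E)[f] <= 'N[mu]_(p%:E)[g].
Proof.
move=> p0 fg; rewrite unlock /Lnorm; apply: gt0_ler_poweR.
- by rewrite invr_ge0 ltW.
- by rewrite in_itv/= leey andbT integral_ge0// => x _; exact: poweR_ge0.
- by rewrite in_itv/= leey andbT integral_ge0// => x _; exact: poweR_ge0.
- apply: le_integral_ae; move: fg; apply: filterS => x fg _.
  by apply: gt0_ler_poweR; rewrite ?in_itv/= ?leey ?andbT ?abse_ge0// ltW.
Qed.

Lemma Lfun_measurable (f : T -> R) p : f \in Lfun mu p -> measurable_fun [set: T] f.
Proof. by rewrite inE => /andP[/[!inE]]. Qed.

Lemma Lfun_dominated (f g : T -> R) (p : R) : (0 < p)%R ->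
  measurable_fun [set: T] f -> {ae mu, forall x, (`|f x| <= `|g x|)%R} ->
  g \in Lfun mu p%:E -> f \in Lfun mu p%:E.
Proof.
move=> p0 mf fg; rewrite !inE => /andP[_]; rewrite inE => gfin.
apply/andP; split; rewrite inE//=; move: gfin; apply: le_lt_trans.
by apply: le_Lnorm_ae => //; move: fg; apply: filterS => x; rewrite lee_fin.
Qed.

(** Follows from |g| <= |g|^p + 1 on D, where the second term is integrable because D has finite
    measure. *)
Lemma Lfun_integrable_support (D : set T) (g : T -> R) (p : R) : (1 <= p)%R ->
  measurable D -> mu D < +oo -> (forall x, ~ D x -> g x = 0%R) ->
  g \in Lfun mu p%:E -> mu.-integrable [set: T] (EFin \o g).
Proof.
move=> p1 mD Doo g0 gL.
have ip := Lfun_integrable p1 gL.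
have iD : mu.-integrable [set: T] (fun x => (\1_D x)%:E).
  apply/integrableP; split; first by apply/measurable_EFinP; exact: measurable_indic.
  rewrite (eq_integral (fun x => (\1_D x)%:E)); last first.
    by move=> x _; rewrite gee0_abs ?lee_fin// indicE.
  by rewrite integral_indic// setIT.
apply: (@le_integrable _ _ _ _ _ measurableT _ (fun x => (`|g x| `^ p)%:E + (\1_D x)%:E)).
- by apply/measurable_EFinP; exact: Lfun_measurable gL.
- move=> x _; rewrite -EFinD lee_fin.
  have rhs0 : (0 <= `|g x| `^ p + \1_D x :> R)%R.
    by rewrite addr_ge0 ?powR_ge0// indicE.
  rewrite (ger0_norm rhs0) indicE.
  have [Dx|Dx] := pselect (D x); last by rewrite g0// normr0 addr_ge0 ?powR_ge0.
  rewrite mem_set//=; have [g1|g1] := leP `|g x|%R 1%R.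
    by rewrite (le_trans g1)// lerDr powR_ge0.
  rewrite (@le_trans _ _ (`|g x| `^ p)%R) ?lerDl//.
  by rewrite -[leLHS]powRr1// ler_powR// ltW.
- exact: integrableD.
Qed.

End Lp_tools.

Section Lp_representatives.
Context {R : realType} (m : nat).
Local Notation la := (lebesgue_rV R m).

(** The representative is cut off by the indicator of D, so that later integrals over D extend to
    the whole space. *)
Lemma Lp_rep (D : set 'rV[R]_m) (p : R) (f : 'rV[R]_m -> R) : (0 < p)%R ->
  measurable (D : set (borel 'rV[R]_m)) -> Lp D p f ->
  exists g : borel 'rV[R]_m -> R, [/\ g \in Lfun la p%:E,
    forall x, ~ D x -> g x = 0 & {ae la, forall x, D x -> f x = g x}].
Proof.
move=> p0 mD [g gL fg]; have mg := Lfun_measurable gL.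
exists (fun x => g x * \1_D x); split.
- apply: (Lfun_dominated p0 _ _ gL).
    by apply: measurable_funM => //; exact: measurable_indic.
  apply: aeW => x; rewrite normrM ler_piMr// indicE.
  by case: (x \in D); rewrite ?normr1// normr0.
- by move=> x Dx; rewrite indicE memNset// mulr0.
- move: fg; apply: filterS; first exact: (ae_filter_ringOfSetsType la).
  move=> x fg Dx.
  by rewrite indicE mem_set// mulr1 fg.
Qed.

End Lp_representatives.

(** * The vector intensity of a plan and its divergence *)

Section vector_traffic_plans.
Context {R : realType} {n : nat} (Om : bounded_domain R (n + n + 1)).
Variable Q : probability (borel (curve Om)) R.
Hypothesis hQ : {ae Q, forall c, horizontal (curveR c)}.
Variables (p : R) (hp : 1 < p) (i : heis R n -> R).
Hypothesis hi : intensity_density p Q i.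
Local Notation leb := (@lebesgue_measure R).
Local Notation la := (lebesgue_rV R (n + n + 1)).
Local Notation P := (borel (curve Om) * measurableTypeR R)%type.
Local Notation M := (Q \x leb)%E.
Local Notation e := (@path_eval R n Om).
Local Notation V := (@velocity R n Om).
Local Notation ve := (val \o e : P -> borel (heis R n)).
Local Open Scope ereal_scope.

Let p0 : (0 < p)%R.
Proof. exact: lt_trans ltr01 hp. Qed.
Let mOm : measurable (Om : set (borel (heis R n))).
Proof. by apply: measurable_open; exact: dom_open. Qed.
Let me : measurable_fun [set: P] e. Proof. exact: measurable_path_eval. Qed.
Let mve : measurable_fun [set: P] ve.
Proof. by have mval := @measurable_val_cldom R _ Om; exact: measurableT_comp mval me. Qed.
Let mV k : measurable_fun [set: P] (fun z => V z ord0 k).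
Proof. exact: measurable_velocity. Qed.

Lemma plan_integrable_velocity : M.-integrable [set: P] (fun z => (hnorm (V z))%:E).
Proof. by have [_ [m hm _]] := hi; exact: integrable_velocity hm. Qed.

Lemma plan_integrable_coord k : M.-integrable [set: P] (EFin \o (fun z => V z ord0 k)).
Proof.
apply: (@le_integrable _ _ _ _ _ measurableT _ (fun z => (hnorm (V z))%:E)).
- exact/measurable_EFinP.
- move=> x _; rewrite lee_fin (le_trans (hnorm_coord _ _))//.
  by rewrite ger0_norm ?hnorm_ge0.
- exact: plan_integrable_velocity.
Qed.

(** Applies [vector_density] on the ambient space, with the representative [g] of the intensity as
    bound. *)
Lemma plan_vector_density : exists w : borel (heis R n) -> horiz R n,
  [/\ forall k, la.-integrable [set: borel (heis R n)] (EFin \o (fun y => w y ord0 k)),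
      forall k, (fun y => w y ord0 k) \in Lfun la p%:E,
      (forall y, ~ (Om : set _) y -> w y = 0%R),
      {ae la, forall y, (Om : set _) y -> (hnorm (w y) <= i y)%R} &
      forall k A, measurable A -> \int[la]_(y in A) (w y ord0 k)%:E =
        \int[M]_(z in ve @^-1` A) (V z ord0 k)%:E].
Proof.
have [Li [m hm mE]] := hi.
have [g [gL g0 ig]] := Lp_rep p0 mOm Li.
have intg := Lfun_integrable_support (ltW hp) mOm (lebesgue_rV_bounded Om) g0 gL.
(* i_Q, given on the subtype with density on Om, is rewritten as the ambient measure with density
   g. *)
have iE A : measurable A -> \int[M]_(z in ve @^-1` A) (hnorm (V z))%:E =
    \int[la]_(y in A) (g y)%:E.
  move=> mA; rewrite -(intensity_image hQ hm mA).
  rewrite mE; last first.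
    by rewrite -[X in measurable X]setTI; exact: (measurable_val_cldom measurableT).
  rewrite /density_integral (_ : _ `&` _ = (Om : set _) `&` A); last first.
    rewrite dom_image_cldom; apply/seteqP; split => x [Ox] /=;
      by rewrite to_cldomK//; exact: subset_closure.
  transitivity (\int[la]_(x in (Om : set _) `&` A) (g x)%:E).
    apply: eq_integral_ae; apply: (@filterS _ _ (ae_filter_ringOfSetsType la) _ _ _ ig).
    by move=> x ix [Ox _]; rewrite ix.
  rewrite [LHS]integral_mkcond [RHS]integral_mkcond; apply: eq_integral => x _.
  rewrite !patchE in_setI; case: (boolP (x \in (Om : set _))) => //.
  by rewrite notin_setE => /g0 ->; case: ifP.
have [w [iw wg wE]] :=
  vector_density mve mV plan_integrable_velocity intg iE.
(* Off Om one has |w| <= g = 0 almost everywhere, so cutting off changes w only on a null set and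
   makes it vanish exactly off Om. *)
pose w1 y := (\1_(Om : set (borel (heis R n))) y *: w y)%R.
have w1E : {ae la, forall y, w1 y = w y}.
  apply: (@filterS _ _ (ae_filter_ringOfSetsType la) _ _ _ wg) => y wy; rewrite /w1 indicE; case: (boolP (y \in (Om : set _))).
    by rewrite scale1r.
  rewrite notin_setE => /g0 gy; rewrite scale0r; move: wy; rewrite gy => wy.
  apply/esym/rowP => k; rewrite mxE; apply/eqP; rewrite -normr_le0.
  exact: le_trans (hnorm_coord _ _) wy.
have mw k : measurable_fun [set: borel (heis R n)] (fun y => w y ord0 k).
  by apply/measurable_EFinP; exact: measurable_int (iw k).
have mw1 k : measurable_fun [set: borel (heis R n)] (fun y => w1 y ord0 k).
  rewrite (_ : (fun y => _) = (fun y => \1_(Om : set (borel (heis R n))) y * w y ord0 k)%R).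
    by apply: measurable_funM => //; exact: measurable_indic.
  by apply/funext => y; rewrite mxE.
have lew1 k y : (`|w1 y ord0 k| <= `|w y ord0 k|)%R.
  by rewrite mxE normrM ler_piMl// indicE; case: (_ \in _); rewrite ?normr1// normr0.
have w1g : {ae la, forall y, (hnorm (w1 y) <= g y)%R}.
  apply: (@filterS2 _ _ (ae_filter_ringOfSetsType la) _ _ _ _ w1E wg).
  by move=> y -> .
exists w1; split.
- move=> k; apply: (@le_integrable _ _ _ _ _ measurableT _ (fun y => (w y ord0 k)%:E)).
  + exact/measurable_EFinP.
  + by move=> y _; rewrite lee_fin.
  + exact: iw.
- move=> k; apply: (Lfun_dominated p0 _ _ gL) => //.
  apply: (@filterS _ _ (ae_filter_ringOfSetsType la) _ _ _ w1g).
  move=> y /(le_trans (hnorm_coord (w1 y) k)) h.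
  by rewrite (le_trans h)// ler_norm.
- by move=> y Oy; rewrite /w1 indicE memNset// scale0r.
- apply: (@filterS2 _ _ (ae_filter_ringOfSetsType la) _ _ _ _ w1g ig).
  by move=> y + /[swap] Oy => /[swap] /(_ Oy) ->.
- move=> k A mA; rewrite -wE//; apply: eq_integral_ae.
  apply: (@filterS _ _ (ae_filter_ringOfSetsType la) _ _ _ w1E).
  by move=> y ->.
Qed.

Section density.
Variable w : borel (heis R n) -> horiz R n.
Hypothesis iw : forall k, la.-integrable [set: borel (heis R n)] (EFin \o (fun y => w y ord0 k)).
Hypothesis w0 : forall y, ~ (Om : set _) y -> w y = 0%R.
Hypothesis wE : forall k A, measurable A -> \int[la]_(y in A) (w y ord0 k)%:E =
  \int[M]_(z in ve @^-1` A) (V z ord0 k)%:E.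

(** Both sides integrate [psi] against one charge: the image of V_k under [ve], which by [wE] is
    also the identity image of the density w_k. *)
Lemma integral_density_velocity (psi : borel (heis R n) -> R) (C : R) k :
  measurable_fun [set: borel (heis R n)] psi -> (forall y, (`|psi y| <= C)%R) ->
  \int[la]_y (psi y * w y ord0 k)%:E = \int[M]_z (psi (ve z) * V z ord0 k)%:E.
Proof.
move=> mpsi psiC.
have mid : measurable_fun [set: borel (heis R n)] (fun y : borel (heis R n) => y).
  exact: measurable_id.
pose W := charge_image mve (plan_integrable_coord k).
rewrite -(@integral_charge_image _ _ _ _ _ _ _ mve _ (plan_integrable_coord k) W psi C)//.
rewrite (@integral_charge_image _ _ _ _ _ _ _ mid _ (iw k) W psi C)//.
by move=> A mA; rewrite -[LHS]wE.
Qed.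

Lemma vector_traffic_density : (forall k, (fun y => w y ord0 k) \in Lfun la p%:E) ->
  vector_intensity_density p Q w.
Proof.
move=> wL; split.
  by move=> k; exists (fun y => w y ord0 k) => //; exact: aeW.
(* The charge lives on the subtype and is the image of V_k under [path_eval]; the defining identity
   is then Fubini for the integrable pairing of [phi] with V. *)
exists (fun k => charge_image me (plan_integrable_coord k)) => [phi cphi|k A mA].
- have cphik k : continuous (fun y => phi y ord0 k).
    move=> y; apply: (@continuous_comp _ _ _ phi (fun v : horiz R n => v ord0 k)).
      exact: cphi.
    exact: coord_continuous.
  have mphik k := continuous_real_measurable (cphik k).
  have /choice[C HC] : forall k, exists C : R, forall y, (`|phi y ord0 k| <= C)%R.
    by move=> k; have [C _ HC] := cldom_bounded (cphik k); exists C.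
  have mphie k : measurable_fun [set: P] (fun z => phi (e z) ord0 k).
    exact: (measurableT_comp (mphik k) me).
  have ik k : M.-integrable [set: P] (fun z => (phi (e z) ord0 k * V z ord0 k)%:E).
    apply: (@le_integrable _ _ _ _ _ measurableT _ (fun z => (C k)%:E * (V z ord0 k)%:E)).
    + by apply/measurable_EFinP; exact: measurable_funM.
    + move=> z _; rewrite lee_fin !normrM ler_wpM2r//.
      by rewrite (le_trans (HC k (e z)))// ler_norm.
    + apply: integrableZl => //; exact: plan_integrable_coord.
  under eq_bigr => k _ do rewrite (@integral_charge_image _ _ _ _ _ _ _ me _
    (plan_integrable_coord k) _ (fun y => phi y ord0 k) (C k))//.
  rewrite -(integral_sum measurableT ik).
  rewrite (traffic_integralE hQ (psi := fun z v => hdot (phi (e z)) v)); last first.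
    by move=> z; rewrite /hdot big1// => k _; rewrite mxE mulr0.
  have isum : M.-integrable [set: P] (fun z => (hdot (phi (e z)) (V z))%:E).
    under eq_fun do rewrite /hdot -sumEFin.
    exact: integrable_sum.
  rewrite [RHS](integral12_prod_meas1 isum).
  by apply: eq_integral => z _; rewrite sumEFin.
(* On the closure this charge has density w on Om and no mass on the boundary, because w is 0 off
   Om. *)
- rewrite -[in LHS](@cldom_preimage R _ Om A).
  have mB : measurable (@to_cldom R _ Om @^-1` A : set (borel (heis R n))).
    by rewrite -[X in measurable X]setTI; exact: (measurable_to_cldom measurableT).
  rewrite -[LHS](wE k mB) /density_integral dom_image_cldom.
  rewrite [LHS]integral_mkcond [RHS]integral_mkcond; apply: eq_integral => x _.
  rewrite !patchE in_setI; case: (boolP (x \in (Om : set _))) => //.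
  by rewrite notin_setE => /w0 ->; rewrite mxE; case: ifP.
Qed.

(** Fubini, then [horizontal_ftc] on those curves that are horizontal and have integrable speed,
    which is Q-almost every curve. *)
Lemma velocity_integral_marginals (phi : heis R n -> R) : Ck 1 phi ->
  \int[M]_z (hdot (hgrad phi (curveR z.1 z.2)) (V z))%:E =
  \int[Q]_c (phi (curveR c 1%R) - phi (curveR c 0%R))%:E.
Proof.
move=> Cphi.
have [C C0 HC] := hgrad_bounded Om Cphi.
have ih : M.-integrable [set: P] (fun z => (hdot (hgrad phi (curveR z.1 z.2)) (V z))%:E).
  apply: (@le_integrable _ _ _ _ _ measurableT _ (fun z => C%:E * (hnorm (V z))%:E)).
  - apply/measurable_EFinP; apply: measurable_sum => k; apply: measurable_funM => //.
    exact: measurable_hgrad_path.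
  - move=> z _; rewrite lee_fin (le_trans (hdot_norm_le _ _))//.
    rewrite (ger0_norm (mulr_ge0 C0 (hnorm_ge0 _))) ler_wpM2r ?hnorm_ge0// HC//.
    exact: closure_curveR.
  - by apply: integrableZl => //; exact: plan_integrable_velocity.
rewrite -(integral12_prod_meas1 ih); apply: eq_integral_ae.
apply: (@filterS2 _ _ (ae_filter_ringOfSetsType Q) _ _ _ _ hQ
  (ae_integrable1 plan_integrable_velocity)).
by move=> c hc ic _; exact: horizontal_ftc.
Qed.

Lemma integral_marginal (mu : probability (borel (cldom Om)) R) (t : R) (f : heis R n -> R) :
  (forall A, measurable A -> pushforward Q (marginal t) A = mu A) ->
  continuous f ->
  Q.-integrable [set: borel (curve Om)] (fun c => (f (curveR c t))%:E) /\
  \int[Q]_c (f (curveR c t))%:E = \int[mu]_y (f (val y))%:E.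
Proof.
move=> Qmu cf.
have mm : measurable_fun [set: borel (curve Om)] (@marginal R n Om t).
  exact: continuous_borel_measurable (@eval_at_continuous R _ Om _).
have cfv : continuous (f \o val : cldom Om -> R).
  by move=> y; apply: continuous_comp; [exact: val_cldom_continuous|exact: cf].
have mfv := continuous_real_measurable cfv.
have [C _ HC] := cldom_bounded cfv.
have iQ : Q.-integrable [set: borel (curve Om)] (fun c => (f (curveR c t))%:E).
  apply: (@bounded_integrable _ _ _ Q _ C).
    exact: (measurableT_comp mfv mm).
  by move=> c; exact: HC.
split=> //.
transitivity (\int[pushforward Q (@marginal R n Om t)]_y (f (val y))%:E).
  by rewrite integral_pushforward//; exact/measurable_EFinP.
by apply: eq_measure_integral => A mA _; exact: Qmu.
Qed.

Lemma density_divergence (mu nu : probability (borel (cldom Om)) R) :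
  horizontal_traffic_plan mu nu Q -> divH_eq (Om := Om) w mu nu.
Proof.
move=> [_ _ Qmu Qnu] phi sphi.
have Cphi : Ck 1 phi by exact: sphi.
have [C C0 HC] := hgrad_bounded Om Cphi.
(* The indicator of the closure makes the derivative of phi bounded on the whole space and changes
   nothing along the curves, which may touch the boundary. *)
pose psi k (y : borel (heis R n)) := (\1_(closure Om) y * hderiv k phi y)%R.
have mpsi k : measurable_fun [set: borel (heis R n)] (psi k).
  apply: measurable_funM; first by apply: measurable_indic; exact: measurable_closure.
  by apply: continuous_real_measurable; exact: hderiv_continuous.
have psiC k y : (`|psi k y| <= C)%R.
  rewrite /psi indicE; case: (boolP (y \in closure Om)) => [/set_mem Oy|_].
    rewrite mul1r (le_trans _ (HC y Oy))//.
    by have := hnorm_coord (hgrad phi y) k; rewrite mxE.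
  by rewrite mul0r normr0.
have mw k : measurable_fun [set: borel (heis R n)] (fun y => w y ord0 k).
  by apply/measurable_EFinP; exact: measurable_int (iw k).
have ipsi k : la.-integrable [set: borel (heis R n)] (fun y => (psi k y * w y ord0 k)%:E).
  apply: (@le_integrable _ _ _ _ _ measurableT _ (fun y => C%:E * (w y ord0 k)%:E)).
  - by apply/measurable_EFinP; apply: measurable_funM.
  - by move=> y _; rewrite lee_fin [leLHS]normrM [leRHS]normrM (ger0_norm C0) ler_wpM2r ?psiC.
  - by apply: integrableZl => //; exact: iw.
have [i1 e1] := integral_marginal Qnu (Ck_continuous Cphi).
have [i0 e0] := integral_marginal Qmu (Ck_continuous Cphi).
have Epath z : (hdot (hgrad phi (curveR z.1 z.2)) (V z) = \sum_k psi k (ve z) * V z ord0 k)%R.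
  apply: eq_bigr => k _; rewrite mxE /psi indicE mem_set ?mul1r//.
  exact: closure_curveR.
have ipath k : M.-integrable [set: P] (fun z => (psi k (ve z) * V z ord0 k)%:E).
  apply: (@le_integrable _ _ _ _ _ measurableT _ (fun z => C%:E * (V z ord0 k)%:E)).
  - apply/measurable_EFinP; apply: measurable_funM => //.
    exact: measurableT_comp mve.
  - by move=> z _; rewrite lee_fin [leLHS]normrM [leRHS]normrM (ger0_norm C0) ler_wpM2r ?psiC.
  - by apply: integrableZl => //; exact: plan_integrable_coord.
have key : \int[la]_(x in Om) (hdot (hgrad phi x) (w x))%:E =
    \int[nu]_y (phi (val y))%:E - \int[mu]_y (phi (val y))%:E.
  transitivity (\int[la]_x \sum_k (psi k x * w x ord0 k)%:E).
    rewrite [LHS]integral_mkcond; apply: eq_integral => x _.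
    rewrite patchE sumEFin; case: (boolP (x \in (Om : set _))) => [/set_mem Ox|].
      congr EFin; apply: eq_bigr => k _; rewrite mxE /psi indicE mem_set ?mul1r//.
      exact: subset_closure.
    rewrite notin_setE => /w0 ->; congr EFin.
    by rewrite big1// => k _; rewrite mxE mulr0.
  rewrite (integral_sum measurableT ipsi).
  under eq_bigr => k _ do rewrite (integral_density_velocity k (mpsi k) (psiC k)).
  rewrite -(integral_sum measurableT ipath).
  under eq_integral => z _ do rewrite sumEFin -Epath.
  rewrite (velocity_integral_marginals Cphi).
  under eq_integral do rewrite EFinB.
  by rewrite integralB// e1 e0.
(* [key] yields nu - mu, end point minus starting point; the minus sign in [divH_eq] turns it into
   mu - nu. *)
rewrite /measure_diff [in LHS]/Rintegral key fineB ?opprB//.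
- by rewrite -e1; exact: integrable_fin_num i1.
- by rewrite -e0; exact: integrable_fin_num i0.
Qed.

End density.

Lemma vector_intensity_exists (mu nu : probability (borel (cldom Om)) R) :
  horizontal_traffic_plan mu nu Q ->
  exists w, [/\ vector_intensity_density p Q w, divH_eq (Om := Om) w mu nu,
    (forall k, (fun x => w x ord0 k) \in Lfun la p%:E),
    (forall x, ~ (Om : set _) x -> w x = 0%R) &
    {ae la, forall x, (Om : set _) x -> (hnorm (w x) <= i x)%R}].
Proof.
move=> pl; have [w [iw wL w0 wi wE]] := plan_vector_density.
exists w; split => //; first exact: vector_traffic_density.
exact: density_divergence.
Qed.

End vector_traffic_plans.

(** * Weak horizontal gradients *)

Section fundamental_lemma.
Context {R : realType} {n : nat} (U : set (heis R n)) (oU : open U).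
Local Notation E := (borel (heis R n)).
Local Notation la := (lebesgue_rV R (n + n + 1)).
Variables (g : E -> R) (ig : la.-integrable [set: E] (EFin \o g)).
Hypothesis g0 : forall psi, test_function U psi ->
  (\int[la]_x (psi x * g x)%:E = 0)%E.
Local Open Scope ereal_scope.

Let mg : measurable_fun [set: E] g.
Proof. by apply/measurable_EFinP; exact: measurable_int ig. Qed.
Let mgp : measurable_fun [set: E] (g ^\+)%R. Proof. exact: measurable_funrpos. Qed.
Let mgn : measurable_fun [set: E] (g ^\-)%R. Proof. exact: measurable_funrneg. Qed.
Let igp : la.-integrable [set: E] (EFin \o (g ^\+)%R).
Proof. by rewrite -funerpos; exact: integrable_funepos. Qed.
Let ign : la.-integrable [set: E] (EFin \o (g ^\-)%R).
Proof. by rewrite -funerneg; exact: integrable_funeneg. Qed.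
Let mid : measurable_fun [set: E] (fun x : E => x). Proof. exact: measurable_id. Qed.

Let mp := density_image la mid mgp (@funrpos_ge0 _ _ g).
Let mn := density_image la mid mgn (@funrneg_ge0 _ _ g).

Let mpoo : mp setT < +oo.
Proof.
rewrite /mp /density_image preimage_setT -ge0_fin_numE.
  exact: integrable_fin_num igp.
by apply: integral_ge0 => x _; rewrite lee_fin funrpos_ge0.
Qed.

Let mnoo : mn setT < +oo.
Proof.
rewrite /mn /density_image preimage_setT -ge0_fin_numE.
  exact: integrable_fin_num ign.
by apply: integral_ge0 => x _; rewrite lee_fin funrneg_ge0.
Qed.

Let bump_test a b k : cbox a b `<=` U -> test_function U (bump a b k.+1%:R%R).
Proof.
move=> abU.
have sub : [set x | bump a b k.+1%:R%R x != 0%R] `<=` box a b.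
  by move=> x /=; apply: contra_neqP => /bump_eq0; exact.
split; first exact: smooth_bump.
- exact: compact_closure_box sub.
- by move=> x /(closure_subset sub)/closure_box_sub/abU.
Qed.

(** As the closed box lies in U, the bumps are test functions and integrate equally against the two
    measures; letting them sharpen gives the mass of the open box. *)
Let eq_box a b : cbox a b `<=` U -> mp (box a b) = mn (box a b).
Proof.
move=> abU.
have cvp := @bump_integral_cvg _ _ a b mp setT measurableT mpoo.
have cvn := @bump_integral_cvg _ _ a b mn setT measurableT mnoo.
rewrite !setIT in cvp cvn.
suff Ek k : \int[mp]_x (bump a b k.+1%:R%R x)%:E = \int[mn]_x (bump a b k.+1%:R%R x)%:E.
  have eqk := funext Ek; rewrite eqk in cvp.
  exact: (cvg_unique (@ereal_hausdorff R) cvp cvn).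
have mb : measurable_fun [set: E] (bump a b k.+1%:R%R).
  by apply: continuous_real_measurable; exact: Ck_continuous (smooth_bump a b _ 0%N).
have b1 x : (`|bump a b k.+1%:R x| <= 1)%R by rewrite ger0_norm ?bump_ge0 ?bump_le1.
have ib (h : E -> R) : la.-integrable [set: E] (EFin \o h) ->
    la.-integrable [set: E] (fun x => (bump a b k.+1%:R%R x * h x)%:E).
  move=> ih; apply: (@le_integrable _ _ _ _ _ measurableT _ (EFin \o h)) => //.
    apply/measurable_EFinP; apply: measurable_funM => //.
    by apply/measurable_EFinP; exact: measurable_int ih.
  by move=> x _; rewrite lee_fin normrM ler_piMl.
rewrite !ge0_integral_density_image//;
  try by [exact/measurable_EFinP | move=> y; rewrite lee_fin bump_ge0].
have h := g0 (bump_test k abU).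
rewrite (eq_integral (fun x : E => (bump a b k.+1%:R%R x * (g^\+)%R x)%:E
                             - (bump a b k.+1%:R%R x * (g^\-)%R x)%:E)) in h; last first.
  move=> x _; rewrite -EFinB -mulrBr; congr (_ * _)%:E.
  by rewrite -[in LHS](funrposBneg g).
rewrite integralB// in h; try exact: ib.
move/eqP : h; rewrite sube_eq ?add0e; last 2 first.
- exact: integrable_fin_num (ib _ igp).
- by rewrite fin_num_adde_defr.
by move/eqP.
Qed.

(** U is a countable union of open boxes whose closures lie in U. On each, the measures with
    densities g^+ and g^- coincide, so g integrates to 0 over every Borel subset. *)
Lemma test_function_ae0 : {ae la, forall x, U x -> g x = 0%R}.
Proof.
have [F [UF HF]] := open_bigcup_box oU.
have box0 a b : cbox a b `<=` U -> {ae la, forall x, box a b x -> g x = 0%R}.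
  move=> abU; have mB := @measurable_box _ _ a b.
  pose gB x := (g x * \1_(box a b : set E) x)%R.
  have igB : la.-integrable [set: E] (EFin \o gB).
    apply: (@le_integrable _ _ _ _ _ measurableT _ (EFin \o g)) => //.
      apply/measurable_EFinP; apply: measurable_funM; first exact: mg.
      exact: (@measurable_indic _ E R setT _ mB).
    move=> x _; rewrite lee_fin normrM ler_piMr// indicE.
    by case: (_ \in _); rewrite ?normr1// normr0.
  have H A : measurable A -> \int[la]_(x in A) (gB x)%:E = 0.
    move=> mA.
    (* Restricting to the box makes every test box meet it in a box whose closure is still inside U,
       where [eq_box] applies. *)
    have : mrestr mp mB A = mrestr mn mB A.
      apply: eq_measure_box => //.
        by rewrite /= /mrestr (le_lt_trans _ mpoo)// le_measure ?inE//; exact: measurableI.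
      move=> a' b'; rewrite /= /mrestr box_setI; apply: eq_box => x xB.
      apply: abU => j; have := xB j; rewrite !mxE ge_max le_min.
      by move=> /andP[/andP[_ ->] /andP[_ ->]].
    rewrite /mrestr /mp /mn /density_image /= => mpmn.
    rewrite (_ : \int[la]_(x in A) _ = \int[la]_(x in A `&` box a b) (g x)%:E).
      rewrite [LHS]integralE.
      rewrite -[X in X - _ = _]/(\int[la]_(x in A `&` box a b) ((EFin \o g)^\+ x)).
      rewrite funerpos [X in _ - X](_ : _ = \int[la]_(x in A `&` box a b) ((EFin \o g)^\- x))//.
      rewrite funerneg; move: mpmn; rewrite /preimage => ->; rewrite subee//.
      apply: integrable_fin_num; first exact: measurableI.
      by apply: integrableS ign => //; exact: measurableI.
    rewrite [LHS]integral_mkcond [RHS]integral_mkcond; apply: eq_integral => x _.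
    rewrite !patchE in_setI /gB indicE.
    by case: (x \in A); case: (x \in box a b) => /=; rewrite ?mulr1 ?mulr0.
  have ig0 : la.-integrable [set: E] (EFin \o cst (0%R : R)) by exact: integrable0.
  have le0 : {ae la, forall x, (gB x <= 0)%R}.
    apply: (ae_le_of_le_integral igB ig0) => A mA.
    by rewrite H// integral0.
  have ge0 : {ae la, forall x, (0 <= gB x)%R}.
    apply: (ae_le_of_le_integral ig0 igB) => A mA.
    by rewrite H// integral0.
  apply: (@filterS2 _ _ (ae_filter_ringOfSetsType la) _ _ _ _ le0 ge0) => x h1 h2 Bx.
  have : gB x = 0%R by apply/eqP; rewrite eq_le h1 h2.
  by rewrite /gB indicE mem_set// mulr1.
have all_k : {ae la, forall x, forall k, F k x -> g x = 0%R}.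
  apply: ae_forall_countable => k.
  case: (HF k) => [->|[a [b [-> /box0//]]]].
  exact: aeW.
apply: (@filterS _ _ (ae_filter_ringOfSetsType la) _ _ _ all_k) => x gk.
by rewrite UF => -[k _ /gk].
Qed.

End fundamental_lemma.

(** * Integration by parts for compactly supported functions *)

Section compactly_supported_integrals.
Context {R : realType}.
Local Notation leb := (@lebesgue_measure R).
Local Notation "'d_ j f" := ('D_(delta_mx ord0 j) f) (at level 10, j at level 2, f at level 9).

Lemma integral_derivative0 (h h' : R -> R) (K : R) : 0 < K ->
  (forall t : R, is_derive t 1 h (h' t)) -> continuous h' ->
  (forall t : R, K <= `|t| -> h t = 0) -> (\int[leb]_t (h' t)%:E = 0)%E.
Proof.
move=> K0 dh ch' h0.
(* The inequality is strict so that h vanishes in a whole neighbourhood of t. *)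
have h'0 t : K < `|t| -> h' t = 0.
  move=> Kt; have [_ <-] := dh t.
  rewrite (near_eq_derive (g := cst 0)) ?derive_cst//.
  near=> s; apply: h0; apply: ltW; near: s.
  exact: (@cvgr_norm_gt _ _ _ (nbhs t) _ (fun s : R => s) t cvg_id K Kt).
rewrite (_ : (\int[leb]_t _)%E = (\int[leb]_(t in `[(- K)%R, K]) (h' t)%:E)%E); last first.
  rewrite [RHS]integral_mkcond; apply: eq_integral => t _.
  rewrite patchE; case: ifPn => //; rewrite notin_setE /= in_itv/= => /negP.
  by rewrite -ler_norml -ltNge => /h'0 ->.
rewrite (@continuous_FTC2 R h' h).
- by rewrite !h0 ?normrN ?ger0_norm ?subee// ltW.
- by rewrite gtrN.
- exact: continuous_subspaceT.
- have ch t : {for t, continuous h}.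
    by apply/differentiable_continuous/derivable1_diffP; have [] := dh t.
  split=> [t _||].
  + by have [] := dh t.
  + exact: cvg_at_right_filter (ch _).
  + exact: cvg_at_left_filter (ch _).
- by move=> t _; rewrite derive1E; have [] := dh t.
Unshelve. all: by end_near. Qed.

Section on_rV.
Context {m : nat}.
Implicit Types (f : 'rV[R]_m -> R) (K : R).

Definition zero_outside K f := forall (x : 'rV[R]_m) k, K <= `|x ord0 k| -> f x = 0.

(** The derivative is seen to vanish only where K < |x_k| strictly; enlarging K by 1 restores the
    large inequality of [zero_outside]. *)
Lemma partial_zero_outside K f j : zero_outside K f -> zero_outside (K + 1) ('d_j f).
Proof.
move=> f0 x k xk; have Kx : K < `|x ord0 k| by rewrite (lt_le_trans _ xk)// ltrDl.
rewrite (near_eq_derive (g := cst 0)) ?derive_cst//.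
near=> y; apply: (f0 y k); apply: ltW; near: y.
exact: (@cvgr_norm_gt _ _ _ (nbhs x) _ _ _ (@coord_continuous _ _ _ ord0 k x) K Kx).
Unshelve. all: by end_near. Qed.

Lemma integrable_zero_outside K f : 0 <= K -> continuous f -> zero_outside K f ->
  (lebesgue_rV R m).-integrable [set: borel 'rV[R]_m] (EFin \o f).
Proof.
move=> K0 cf f0; have [C C0 HC] := continuous_bounded_ball K cf.
pose B : set (borel 'rV[R]_m) := box (const_mx (- K)) (const_mx K).
have mB : measurable B by exact: measurable_box.
have iB : (lebesgue_rV R m).-integrable [set: borel 'rV[R]_m] (fun x => (\1_B x)%:E).
  apply/integrableP; split; first by apply/measurable_EFinP; exact: measurable_indic.
  rewrite (eq_integral (fun x => (\1_B x)%:E)); last first.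
    by move=> x _; rewrite gee0_abs ?lee_fin// indicE.
  by rewrite integral_indic// setIT; exact: lebesgue_rV_box.
apply: (@le_integrable _ _ _ _ _ measurableT _ (fun x => C%:E * (\1_B x)%:E)%E).
- by apply/measurable_EFinP; exact: continuous_real_measurable.
- move=> x _; rewrite -EFinM lee_fin indicE; case: (boolP (x \in B)).
    move/set_mem => Bx; rewrite mulr1 (ger0_norm C0) HC//.
    apply: rV_norm_le => // k; have := Bx k; rewrite !mxE -ltr_norml; exact: ltW.
  rewrite notin_setE mulr0 normr0 => xB.
  have [k xk] : exists k, K <= `|x ord0 k|.
    apply/not_existsP => H; apply: xB => k; rewrite !mxE -ltr_norml ltNge.
    by apply/negP; exact: H.
  by rewrite (f0 x k xk) normr0.
- exact: integrableZl.
Qed.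

End on_rV.

Lemma measurable_cons_rV m :
  measurable_fun [set: measurableTypeR R * borel 'rV[R]_m] (@cons_rV R m).
Proof.
apply: measurable_fun_rV => j; have [k ->|->] := unliftP ord0 j.
- rewrite (_ : (fun z => _) = (fun z : measurableTypeR R * borel 'rV[R]_m => z.2 ord0 k)).
    exact: (measurableT_comp (coord_measurable k) measurable_snd).
  by apply/funext => -[t v]; rewrite cons_rVS.
- rewrite (_ : (fun z => _) = (fun z : measurableTypeR R * borel 'rV[R]_m => z.1)).
    exact: measurable_fst.
  by apply/funext => -[t v]; rewrite cons_rV0.
Qed.

Lemma cons_rV_head m (t : R) (v : 'rV[R]_m) :
  cons_rV (t, v) = t *: delta_mx ord0 ord0 + cons_rV (0, v).
Proof.
apply/rowP => j; rewrite [RHS]mxE [X in _ = X + _]mxE [X in _ * X]mxE.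
have [k ->|->] := unliftP ord0 j.
  by rewrite (cons_rVS t v k) (cons_rVS 0 v k) andbF mulr0 add0r.
by rewrite (cons_rV0 t v) (cons_rV0 0 v) mulr1 addr0.
Qed.

Lemma cons_rV_tail m (t s : R) (v : 'rV[R]_m) j :
  cons_rV (t, s *: delta_mx ord0 j + v) =
  s *: delta_mx ord0 (lift ord0 j) + cons_rV (t, v).
Proof.
apply/rowP => i; rewrite [RHS]mxE [X in _ = X + _]mxE [X in _ * X]mxE.
have [k ->|->] := unliftP ord0 i.
  by rewrite !cons_rVS !mxE (inj_eq lift_inj).
by rewrite !cons_rV0 mulr0 add0r.
Qed.

Lemma cons_rV_continuous m (t : R) :
  continuous (fun v : 'rV[R]_m => cons_rV (t, v) : 'rV[R]_m.+1).
Proof.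
move=> v; have nF := nbhs_filter v.
apply: (@cvgrPdist_le _ _ _ (nbhs v) nF _ _).2 => /= e e0.
near=> u.
have uv : `|v - u| <= e.
  near: u; move: e e0; apply: (@cvgrPdist_le _ _ _ (nbhs v) nF (fun u => u) v).1.
  exact: cvg_id.
apply: rV_norm_le => [|i]; first exact: le_trans uv.
rewrite mxE [X in _ + X]mxE; have [k ->|->] := unliftP ord0 i.
  rewrite (cons_rVS t v k) (cons_rVS t u k) (le_trans _ uv)//.
  by have := rV_coord_le (v - u) k; rewrite !mxE.
by rewrite (cons_rV0 t v) (cons_rV0 t u) subrr normr0 ltW.
Unshelve. all: by end_near. Qed.

(** Induction along the iterated product that defines [lebesgue_rV]. For the first coordinate, time
    is integrated first and [integral_derivative0] applies; for another one, each slice with fixed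
    first coordinate is covered by the induction hypothesis. *)
Lemma integral_partial m (j : 'I_m) (f : 'rV[R]_m -> R) (K : R) :
  0 < K -> Ck 1 f -> zero_outside K f ->
  (\int[lebesgue_rV R m]_x ('d_j f x)%:E = 0)%E.
Proof.
elim: m j f => [[]//|m IH] j f K0 fC f0.
have cd := @Ck1_partial_continuous _ _ f j fC.
have id0 := integrable_zero_outside (addr_ge0 (ltW K0) ler01) cd (partial_zero_outside j f0).
have mdf : measurable_fun [set: borel 'rV[R]_m.+1] (EFin \o 'd_j f).
  exact: measurable_int id0.
have mc := @measurable_cons_rV m.
have pf (h : borel 'rV[R]_m.+1 -> \bar R) : (\int[lebesgue_rV R m.+1]_x h x =
    \int[pushforward (leb \x lebesgue_rV R m)%E (@cons_rV R m)]_x h x)%E.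
  by apply: eq_measure_integral.
have idc : (leb \x lebesgue_rV R m)%E.-integrable
    [set: measurableTypeR R * borel 'rV[R]_m] ((EFin \o 'd_j f) \o @cons_rV R m).
  apply/integrableP; split; first exact: measurableT_comp.
  have /integrableP[_] := id0; apply: le_lt_trans.
  rewrite pf.
  rewrite (@ge0_integral_pushforward _ _ _ _ _ _ mc
    (leb \x lebesgue_rV R m)%E setT (abse \o (EFin \o 'd_j f)))//.
    exact: measurableT_comp.
  by move=> y _; exact: abse_ge0.
rewrite pf (integral_pushforward mc mdf idc measurableT) preimage_setT.
have slice t (v : 'rV[R]_m) :
    is_derive (cons_rV (t, v)) (delta_mx ord0 j) f ('d_j f (cons_rV (t, v))).
  exact: Ck1_partial.
have [k jk|j0] := unliftP ord0 j; subst j.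
- rewrite -(integral12_prod_meas1 idc) integral0_eq// => t _.
  rewrite /fubini_F /=; pose ft (v : 'rV[R]_m) := f (cons_rV (t, v)).
  have dft l v : is_derive v (delta_mx ord0 l) ft ('d_(lift ord0 l) f (cons_rV (t, v))).
    apply/is_derive_line.
    have /is_derive_line := Ck1_partial (lift ord0 l) (cons_rV (t, v)) fC.
    rewrite (_ : (fun s => ft _) = (fun s => f (s *: delta_mx ord0 (lift ord0 l) + cons_rV (t, v))))//.
    by apply/funext => s; rewrite /ft cons_rV_tail.
  have ftC : Ck 1 ft.
    split=> [v|l].
      by apply: continuous_comp; [exact: cons_rV_continuous|exact: Ck_continuous fC _].
    split=> [v|]; first by have [] := dft l v.
    split=> // v.
    rewrite (_ : 'd_l ft = 'd_(lift ord0 l) f \o (fun v => cons_rV (t, v))); last first.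
      by apply/funext => u; have [_ ->] := dft l u.
    apply: continuous_comp; first exact: cons_rV_continuous.
    exact: Ck1_partial_continuous.
  rewrite -[RHS](IH k ft K0 ftC).
    by apply: eq_integral => v _; have [_ ->] := dft k v.
  by move=> v l vl; apply: (f0 _ (lift ord0 l)); rewrite cons_rVS.
- rewrite -(integral21_prod_meas1 idc) integral0_eq// => v _.
  rewrite /fubini_G /=; apply: (@integral_derivative0 (fun t => f (cons_rV (t, v))) _ K) => //.
  + move=> t; have := slice t v; rewrite cons_rV_head => /is_derive_line_at.
    rewrite (_ : (fun s => f _) = (fun t => f (cons_rV (t, v))))//.
    by apply/funext => s; rewrite (cons_rV_head s).
  + rewrite (_ : (fun t => _) = 'd_ord0 f \o (fun t : R => t *: delta_mx ord0 ord0 + cons_rV (0, v))).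
      move=> t; apply: continuous_comp; last exact: cd.
      apply: cvgD; last exact: cvg_cst.
      by apply: cvgZr_tmp; exact: cvg_id.
    by apply/funext => t /=; rewrite (cons_rV_head t).
  + by move=> t tK; apply: (f0 _ ord0); rewrite cons_rV0.
Qed.

End compactly_supported_integrals.

Section horizontal_integration_by_parts.
Context {R : realType} {n : nat}.
Implicit Types (f : heis R n -> R) (x : heis R n).
Local Notation E := (borel (heis R n)).
Local Notation la := (lebesgue_rV R (n + n + 1)).
Local Notation "'d_ j f" := ('D_(delta_mx ord0 j) f) (at level 10, j at level 2, f at level 9).
Local Notation vert := (rshift (n + n) (ord0 : 'I_1)).

Lemma vertical_coefE (i : 'I_(n + n)) : exists (c : R) (k : 'I_(n + n)),
  vertical_coef i = fun x => c * x ord0 (lshift 1 k).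
Proof.
rewrite /vertical_coef; case: (fintype.split i) => j.
  exists (- 2^-1), (rshift n j); apply/funext => x.
  by rewrite mulNr mulrC.
by exists 2^-1, (lshift n j); apply/funext => x; rewrite mulrC.
Qed.

Lemma Ck_vertical_coef i : Ck 1 (@vertical_coef R n i).
Proof.
have [c [k ->]] := vertical_coefE i.
pose H (l : nat) (t : R) := if l is 0%N then c * t else if l is 1%N then c else 0.
apply: (@Ck_coord _ _ H _ 1%N 0%N) => -[|[|l]] t /=.
- have := is_deriveZ c (is_derive_id t (1 : R)) => D.
  by apply: (is_derive_eq D); rewrite [c *: 1]mulr1.
- exact: is_derive_cst.
- exact: is_derive_cst.
Qed.

(** The coefficient depends on a horizontal coordinate only; this is why X_i is divergence free. *)
Lemma partial_vertical_coef i x : 'd_vert (@vertical_coef R n i) x = 0.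
Proof.
have [c [k ->]] := vertical_coefE i.
have dc : is_derive (x ord0 (lshift 1 k)) 1 (fun t : R => c * t) c.
  have D := is_deriveZ c (is_derive_id (x ord0 (lshift 1 k)) (1 : R)).
  by apply: (is_derive_eq D); rewrite [c *: 1]mulr1.
by have [_ ->] := is_derive_coord vert dc; rewrite eq_rlshift.
Qed.

(** X_i f is the partial derivative of f in direction i plus the vertical partial derivative of f
    times [vertical_coef i], and each term integrates to 0. *)
Lemma integral_hderiv i f (K : R) : 0 < K -> Ck 1 f -> zero_outside K f ->
  (\int[la]_x (hderiv i f x)%:E = 0)%E.
Proof.
move=> K0 fC f0; have vC := Ck_vertical_coef i.
pose g := f \* @vertical_coef R n i.
have gC : Ck 1 g by exact: CkM.
have g0 : zero_outside K g by move=> x k xk; rewrite /g /= (f0 x k xk) mul0r.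
have K1 : 0 <= K + 1 by rewrite addr_ge0// ltW.
have gE x : 'd_vert g x = 'd_vert f x * vertical_coef i x.
  have [_ ->] := is_deriveM (Ck1_partial vert x fC) (Ck1_partial vert x vC).
  by rewrite partial_vertical_coef scaler0 add0r [LHS]mulrC.
under eq_integral do rewrite hderivE// -gE EFinD.
rewrite integralD//.
- by rewrite !(@integral_partial _ _ _ _ K)// adde0.
- apply: (integrable_zero_outside K1); last exact: partial_zero_outside.
  exact: Ck1_partial_continuous.
- apply: (integrable_zero_outside K1); last exact: partial_zero_outside.
  exact: Ck1_partial_continuous.
Qed.

Lemma hderivM i f g x : Ck 1 f -> Ck 1 g ->
  hderiv i (f \* g) x = f x * hderiv i g x + hderiv i f x * g x.
Proof.
move=> fC gC; rewrite /hderiv.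
have [df _] := Ck1_directional x (hfield i x) fC.
have [dg _] := Ck1_directional x (hfield i x) gC.
by rewrite deriveM// [X in _ + X]mulrC.
Qed.

Lemma test_function_out (D : set (heis R n)) psi x : test_function D psi ->
  ~ D x -> psi x = 0 /\ forall i, hderiv i psi x = 0.
Proof.
move=> [_ _ sD] Dx; pose S := closure [set x | psi x != 0].
have near0 : \forall y \near x, psi y = 0.
  have : nbhs x (~` S).
    apply: open_nbhs_nbhs; split; last by move=> /sD.
    by apply: closed_openC; exact: closed_closure.
  apply: filterS => y Sy; apply/eqP/negPn/negP => py.
  by apply: Sy; exact: subset_closure.
split=> [|i]; first exact: nbhs_singleton near0.
by rewrite /hderiv (near_eq_derive (g := cst 0))// derive_cst.
Qed.

Lemma test_function_zero_outside (D : set (heis R n)) psi : test_function D psi ->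
  exists2 K : R, 0 < K & zero_outside K psi.
Proof.
move=> [_ cS _]; have [M [_ HM]] := compact_bounded cS.
have M1 : M < `|M| + 1 by rewrite (le_lt_trans (ler_norm _))// ltrDl.
(* Compactness bounds the support by |M| + 1; the further 1 makes a point with a coordinate that
   large lie strictly outside. *)
exists (`|M| + 1 + 1) => [|x k xk]; first by rewrite addr_gt0// ltr_wpDl.
apply/eqP/negPn/negP => px.
have Sx : closure [set x | psi x != 0] x by exact: subset_closure.
have := HM _ M1 x Sx; apply/negP; rewrite -ltNge.
by rewrite (lt_le_trans _ (rV_coord_le _ k))// (lt_le_trans _ xk)// ltrDl.
Qed.

End horizontal_integration_by_parts.

Section smooth_in_HW.
Context {R : realType} {n : nat} (Om : bounded_domain R (n + n + 1)).
Implicit Types (f : heis R n -> R).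
Local Notation E := (borel (heis R n)).
Local Notation la := (lebesgue_rV R (n + n + 1)).

Let mOm : measurable (Om : set E).
Proof. by apply: measurable_open; exact: dom_open. Qed.

Lemma dom_continuous_bounded f : continuous f -> exists2 C : R, 0 <= C &
  forall x, (Om : set _) x -> `|f x| <= C.
Proof.
move=> cf; have [M HM] := closure_dom_bounded Om.
have [C C0 HC] := continuous_bounded_ball M cf.
by exists C => // x Ox; apply/HC/HM; exact: subset_closure.
Qed.

Lemma dom_continuous_integrable f : continuous f -> la.-integrable (Om : set E) (EFin \o f).
Proof.
move=> cf; have [C _ HC] := dom_continuous_bounded cf.
apply: measurable_bounded_integrable => //.
- exact: lebesgue_rV_bounded.
- by apply: measurable_funTS; exact: continuous_real_measurable.
- exists C; split; first exact: num_real.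
  by move=> A CA x Ox; rewrite /= (le_trans (HC x Ox))// ltW.
Qed.

Lemma dom_continuous_Lp (q : R) f : 0 < q -> continuous f -> Lp Om q f.
Proof.
move=> q0 cf; have [C C0 HC] := dom_continuous_bounded cf.
exists (fun x => f x * \1_(Om : set E) x); last first.
  by apply: aeW => x Ox; rewrite indicE mem_set// mulr1.
rewrite inE; apply/andP; split; rewrite inE.
  apply: measurable_funM; last exact: measurable_indic.
  exact: continuous_real_measurable.
rewrite /= /finite_norm unlock /Lnorm; apply: poweR_lty.
apply: (@le_lt_trans _ _ (\int[la]_x ((C `^ q)%:E * (\1_(Om : set E) x)%:E))%E).
  apply: le_integral_ae; apply: aeW => x _.
  rewrite /= -EFinM lee_fin indicE; case: (boolP (x \in (Om : set _))).
    move/set_mem => Ox; rewrite !mulr1; apply: ge0_ler_powR; rewrite ?nnegrE//.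
      exact: ltW.
    exact: HC.
  by rewrite !mulr0 normr0 powR0// gt_eqF.
rewrite ge0_integralZl//; last 2 first.
- by apply/measurable_EFinP; exact: measurable_indic.
- by rewrite lee_fin powR_ge0.
rewrite integral_indic// setIT; apply: lte_mul_pinfty => //.
- by rewrite lee_fin powR_ge0.
- exact: lebesgue_rV_bounded.
Qed.

(** Apply [integral_hderiv] to the product of phi with a test function psi and expand by Leibniz;
    psi and its derivatives vanish off Om, so the integral is over Om. *)
Lemma smooth_HW_grad (q : R) phi : 0 < q -> smooth phi ->
  HW_grad (Om : set _) q phi (hgrad phi).
Proof.
move=> q0 sphi; have phiC : Ck 1 phi by exact: sphi.
split; first exact: dom_continuous_Lp (Ck_continuous phiC).
  move=> i; rewrite (_ : (fun x => _) = hderiv i phi).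
    by apply: dom_continuous_Lp => //; exact: hderiv_continuous.
  by apply/funext => x; rewrite mxE.
move=> i psi tpsi; have [spsi _ _] := tpsi; have psiC : Ck 1 psi by exact: spsi.
have [K K0 psi0] := test_function_zero_outside tpsi.
have prod0 : zero_outside K (phi \* psi) by move=> x k xk; rewrite /= (psi0 x k xk) mulr0.
have := integral_hderiv i K0 (CkM phiC psiC) prod0.
have cphi := Ck_continuous phiC; have cpsi := Ck_continuous psiC.
have chphi := @hderiv_continuous _ _ i _ phiC.
have chpsi := @hderiv_continuous _ _ i _ psiC.
have i1 : la.-integrable (Om : set E) (EFin \o (fun x => phi x * hderiv i psi x)).
  by apply: dom_continuous_integrable => x; exact: (cvgM (cphi x) (chpsi x)).
have i2 : la.-integrable (Om : set E) (EFin \o (fun x => hderiv i phi x * psi x)).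
  by apply: dom_continuous_integrable => x; exact: (cvgM (chphi x) (cpsi x)).
rewrite (_ : (\int[la]_x _)%E =
    (\int[la]_(x in Om) ((phi x * hderiv i psi x)%:E + (hderiv i phi x * psi x)%:E))%E).
  rewrite integralD// => h.
  apply/eqP; rewrite -addr_eq0; apply/eqP.
  under [X in _ + X = _]eq_Rintegral do rewrite mxE.
  rewrite /Rintegral -fineD ?h//; exact: integrable_fin_num.
rewrite [RHS]integral_mkcond; apply: eq_integral => x _; rewrite patchE -EFinD -hderivM//.
case: ifPn => //; rewrite notin_setE => Ox.
have [p0 hp0] := test_function_out tpsi Ox.
by rewrite hderivM// p0 hp0 !mulr0 addr0.
Qed.

End smooth_in_HW.

Section weak_gradients.
Context {R : realType} {n : nat} (Om : bounded_domain R (n + n + 1)).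
Variables (q : R) (q1 : 1 < q).
Local Notation E := (borel (heis R n)).
Local Notation la := (lebesgue_rV R (n + n + 1)).
Local Notation D := (Om : set (heis R n)).
Implicit Types (F f : heis R n -> R) (W v : heis R n -> horiz R n).

Let mOm : measurable (Om : set E).
Proof. by apply: measurable_open; exact: dom_open. Qed.
Let q0 : 0 < q. Proof. exact: lt_trans ltr01 q1. Qed.

Lemma Lp_lin (a : R) F F' : Lp D q F -> Lp D q F' -> Lp D q (fun x => a * F x + F' x).
Proof.
move=> [g gL Fg] [g' g'L F'g']; exists (fun x => a * g x + g' x).
  have [_] := Lfun_submod_closed la (ltW q1 : (1 <= q%:E)%E).
  exact.
apply: (@filterS2 _ _ (ae_filter_ringOfSetsType la) _ _ _ _ Fg F'g') => x h h' Dx.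
by rewrite h// h'.
Qed.

Lemma Rintegral_rep F (g : E -> R) : (forall x, ~ D x -> g x = 0) ->
  {ae la, forall x, D x -> F x = g x} ->
  \int[la]_(x in D) F x = \int[la]_x g x.
Proof.
move=> g0 Fg; rewrite /Rintegral; congr fine; rewrite [RHS](_ : _ = (\int[la]_(x in D) (g x)%:E)%E).
  apply: eq_integral_ae.
  apply: (@filterS _ _ (ae_filter_ringOfSetsType la) _ _ _ Fg) => x h Dx.
  by rewrite h.
rewrite [RHS]integral_mkcond; apply: eq_integral => x _; rewrite patchE.
by case: ifPn => //; rewrite notin_setE => /g0 ->.
Qed.

(** Weak gradients are paired through integrals of functions that are only almost everywhere equal
    to Borel ones; additivity is recovered on the representatives. *)
Lemma Lp_pairing_rep F (h : heis R n -> R) : Lp D q F -> continuous h ->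
  exists g : E -> R, [/\ forall x, ~ D x -> g x = 0,
    {ae la, forall x, D x -> F x = g x},
    la.-integrable [set: E] (fun x => (g x * h x)%:E) &
    \int[la]_(x in D) (F x * h x) = \int[la]_x (g x * h x)].
Proof.
move=> LF ch; have [g [gL g0 Fg]] := Lp_rep q0 mOm LF.
have ig := Lfun_integrable_support (ltW q1) mOm (lebesgue_rV_bounded Om) g0 gL.
have [C C0 HC] := dom_continuous_bounded Om ch.
exists g; split => //; last first.
  apply: Rintegral_rep => [x /g0 ->|]; first by rewrite mul0r.
  apply: (@filterS _ _ (ae_filter_ringOfSetsType la) _ _ _ Fg) => x Fgx Dx.
  by rewrite Fgx.
apply: (@le_integrable _ _ _ _ _ measurableT _ (fun x => C%:E * (g x)%:E)%E).
- apply/measurable_EFinP; apply: measurable_funM; first exact: Lfun_measurable gL.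
  exact: continuous_real_measurable.
- move=> x _; rewrite -EFinM lee_fin [leLHS]normrM [leRHS]normrM (ger0_norm C0).
  have [Dx|/g0 ->] := pselect (D x); last by rewrite normr0 !mulr0 mul0r.
  by rewrite mulrC ler_wpM2r// HC.
- exact: integrableZl.
Qed.

Lemma Lp_pairing_lin (a : R) F F' (h : heis R n -> R) :
  Lp D q F -> Lp D q F' -> continuous h ->
  \int[la]_(x in D) ((a * F x + F' x) * h x) =
  a * (\int[la]_(x in D) (F x * h x)) + \int[la]_(x in D) (F' x * h x).
Proof.
move=> LF LF' ch.
have [g [g0 Fg ig ->]] := Lp_pairing_rep LF ch.
have [g' [g'0 F'g' ig' ->]] := Lp_pairing_rep LF' ch.
rewrite (@Rintegral_rep _ (fun x => a * (g x * h x) + g' x * h x)).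
- rewrite RintegralD//; last by apply: integrableZl ig.
  by rewrite RintegralZl.
- by move=> x Dx; rewrite g0// g'0// !mul0r mulr0 addr0.
- apply: (@filterS2 _ _ (ae_filter_ringOfSetsType la) _ _ _ _ Fg F'g') => x e e' Dx.
  by rewrite e// e'// mulrDl mulrA.
Qed.

Lemma HW_grad_lin (a : R) f f' W W' : HW_grad D q f W -> HW_grad D q f' W' ->
  HW_grad D q (fun x => a * f x + f' x) (fun x => a *: W x + W' x).
Proof.
move=> [Lf LW wf] [Lf' LW' wf']; split; first exact: Lp_lin.
  move=> i; rewrite (_ : (fun x => _) = (fun x => a * W x ord0 i + W' x ord0 i)).
    exact: (Lp_lin a (LW i) (LW' i)).
  by apply/funext => x; rewrite !mxE.
move=> i psi tpsi; have [spsi _ _] := tpsi; have psiC : Ck 1 psi by exact: spsi.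
rewrite Lp_pairing_lin//; last exact: hderiv_continuous.
under [in RHS]eq_Rintegral do rewrite !mxE.
rewrite (Lp_pairing_lin a (LW i) (LW' i)); last exact: Ck_continuous psiC.
by rewrite wf// wf'// mulrN opprD.
Qed.

Lemma LpH_rep W : LpH D q W -> exists v : E -> horiz R n,
  [/\ forall k, (fun x => v x ord0 k) \in Lfun la q%:E,
      forall x, ~ D x -> v x = 0 & {ae la, forall x, D x -> W x = v x}].
Proof.
move=> LW; have /choice[g Hg] : forall k, exists g : E -> R,
    [/\ g \in Lfun la q%:E, forall x, ~ D x -> g x = 0 &
        {ae la, forall x, D x -> W x ord0 k = g x}].
  by move=> k; exact: Lp_rep.
exists (fun x => \row_k g k x); split.
- move=> k; rewrite (_ : (fun x => _) = g k); first by have [] := Hg k.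
  by apply/funext => x; rewrite mxE.
- by move=> x Dx; apply/rowP => k; rewrite !mxE; have [_ ->] := Hg k.
- have H : {ae la, forall x, forall k, D x -> W x ord0 k = g k x}.
    by apply: ae_forall_countable => k; have [_ _] := Hg k.
  apply: (@filterS _ _ (ae_filter_ringOfSetsType la) _ _ _ H) => x Wx Dx.
  by apply/rowP => k; rewrite mxE Wx.
Qed.

(** Each coordinate of the difference has integral 0 against all test functions, so
    [test_function_ae0] applies to its representative. *)
Lemma weak_hgrad_unique f W W' : HW_grad D q f W -> HW_grad D q f W' ->
  {ae la, forall x, D x -> W x = W' x}.
Proof.
move=> [_ LW wW] [_ LW' wW'].
have H k : {ae la, forall x, D x -> W x ord0 k = W' x ord0 k}.
  have [g [gL g0 Fg]] := Lp_rep q0 mOm (LW k).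
  have [g' [g'L g'0 F'g']] := Lp_rep q0 mOm (LW' k).
  have ig := Lfun_integrable_support (ltW q1) mOm (lebesgue_rV_bounded Om) g0 gL.
  have ig' := Lfun_integrable_support (ltW q1) mOm (lebesgue_rV_bounded Om) g'0 g'L.
  have igg' : la.-integrable [set: E] (EFin \o (fun x => g x - g' x)).
    by have := integrableB measurableT ig ig'.
  have gg'0 : {ae la, forall x, D x -> g x - g' x = 0}.
    have oD : open D by exact: dom_open.
    apply: (test_function_ae0 oD igg') => psi tpsi.
    have [spsi _ _] := tpsi; have psiC : Ck 1 psi by exact: spsi.
    have [h [h0 Fh ih hE]] := Lp_pairing_rep (LW k) (Ck_continuous psiC).
    have [h' [h'0 F'h' ih' h'E]] := Lp_pairing_rep (LW' k) (Ck_continuous psiC).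
    have hh' : \int[la]_x (h x * psi x) = \int[la]_x (h' x * psi x).
      rewrite -hE -h'E; have := wW k psi tpsi; rewrite (wW' k psi tpsi).
      by move/oppr_inj.
    rewrite (_ : (\int[la]_x _)%E = (\int[la]_x ((h x * psi x)%:E - (h' x * psi x)%:E))%E).
      rewrite integralB//; apply/eqP; rewrite sube_eq ?add0e ?fin_num_adde_defr//;
        last exact: integrable_fin_num ih.
      apply/eqP; move: hh'; rewrite /Rintegral => hh'.
      rewrite -[LHS]fineK ?hh' ?fineK//; exact: integrable_fin_num.
    apply: eq_integral_ae.
    (* [g] and [h] represent the same coordinate of W through separate choices, and agree almost
       everywhere on D. *)
    have Fgh := @filterS2 _ _ (ae_filter_ringOfSetsType la) _ _ _
      (fun x (e : D x -> W x ord0 k = g x) (e' : D x -> W x ord0 k = h x) Dx =>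
         etrans (esym (e Dx)) (e' Dx)) Fg Fh.
    have Fgh' := @filterS2 _ _ (ae_filter_ringOfSetsType la) _ _ _
      (fun x (e : D x -> W' x ord0 k = g' x) (e' : D x -> W' x ord0 k = h' x) Dx =>
         etrans (esym (e Dx)) (e' Dx)) F'g' F'h'.
    apply: (@filterS2 _ _ (ae_filter_ringOfSetsType la) _ _ _ _ Fgh Fgh') => x e e' _.
    rewrite -EFinB mulrBr ![psi x * _]mulrC.
    have [Dx|Dx] := pselect (D x); first by rewrite e// e'.
    by rewrite g0// g'0// h0// h'0.
  have FF := @filterS2 _ _ (ae_filter_ringOfSetsType la) _ _ _
    (fun x e e' => conj e e') Fg F'g'.
  apply: (@filterS2 _ _ (ae_filter_ringOfSetsType la) _ _ _ _ FF gg'0) => x [e e'] gg Dx.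
  by rewrite e// e'//; apply/eqP; rewrite -subr_eq0 gg.
have HH := ae_forall_countable H.
apply: (@filterS _ _ (ae_filter_ringOfSetsType la) _ _ _ HH) => x Wx Dx.
by apply/rowP => k; exact: Wx.
Qed.

End weak_gradients.

(** * The divergence as a functional on HW^{1,q} *)

Section divergence_functional.
Context {R : realType} {n : nat} (Om : bounded_domain R (n + n + 1)).
Variables (p q : R) (hp : 1 < p) (hq : q = p / (p - 1)).
Local Notation E := (borel (heis R n)).
Local Notation la := (lebesgue_rV R (n + n + 1)).
Local Notation D := (Om : set (heis R n)).
Variable w : E -> horiz R n.
Hypothesis wL : forall k, (fun x => w x ord0 k) \in Lfun la p%:E.
Hypothesis w0 : forall x, ~ D x -> w x = 0.
Hypothesis wN : (fun x => hnorm (w x)) \in Lfun la p%:E.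
Implicit Types (f : heis R n -> R) (W : heis R n -> horiz R n).

Let p0 : 0 < p. Proof. exact: lt_trans ltr01 hp. Qed.

Lemma conjugate_gt1 : 1 < q.
Proof. by rewrite hq ltr_pdivlMr ?subr_gt0// mul1r gtrBl. Qed.

Lemma conjugate_invD : q^-1 + p^-1 = 1.
Proof.
have ? : p != 0 by rewrite gt_eqF.
have ? : p - 1 != 0 by rewrite subr_eq0 gt_eqF.
by rewrite hq; field; apply/andP.
Qed.

Let q0 : 0 < q. Proof. exact: lt_trans ltr01 conjugate_gt1. Qed.

(* div_H w as a functional on HW^{1,q}; extended by 0 to all functions. *)
Definition grad_pairing f : R :=
  match pselect (HW D q f) with
  | left h => - \int[la]_(x in D) hdot (projT1 (cid h) x) (w x)
  | right _ => 0
  end.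

Lemma Lfun_mul_integrable (g h : E -> R) :
  g \in Lfun la q%:E -> h \in Lfun la p%:E ->
  la.-integrable [set: E] (fun x => (g x * h x)%:E).
Proof.
move=> gL hL; have mg := Lfun_measurable gL; have mh := Lfun_measurable hL.
apply/integrableP; split; first by apply/measurable_EFinP; exact: measurable_funM.
have := hoelder la mg mh q0 p0 conjugate_invD; rewrite Lnorm1 => H.
apply: le_lt_trans H _; apply: lte_mul_pinfty; first exact: Lnorm_ge0.
- rewrite ge0_fin_numE ?Lnorm_ge0//.
  by move: gL; rewrite inE => /andP[_]; rewrite inE.
- by move: hL; rewrite inE => /andP[_]; rewrite inE.
Qed.

Lemma hdot_rep W (v : E -> horiz R n) : {ae la, forall x, D x -> W x = v x} ->
  \int[la]_(x in D) hdot (W x) (w x) = \int[la]_x hdot (v x) (w x).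
Proof.
move=> Wv; apply: Rintegral_rep => [x /w0 ->|].
  by rewrite /hdot big1// => k _; rewrite mxE mulr0.
apply: (@filterS _ _ (ae_filter_ringOfSetsType la) _ _ _ Wv) => x e Dx.
by rewrite e.
Qed.

Lemma hdot_rep_integrable (v : E -> horiz R n) :
  (forall k, (fun x => v x ord0 k) \in Lfun la q%:E) ->
  la.-integrable [set: E] (fun x => (hdot (v x) (w x))%:E).
Proof.
move=> vL; under eq_fun do rewrite /hdot -sumEFin.
by apply: integrable_sum => // k _; exact: (Lfun_mul_integrable (vL k) (wL k)).
Qed.

(** [grad_pairing] picks one weak gradient by choice; uniqueness makes every other one give the same
    value. *)
Lemma grad_pairingE f W : HW_grad D q f W ->
  grad_pairing f = - \int[la]_(x in D) hdot (W x) (w x).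
Proof.
move=> fW; rewrite /grad_pairing; case: pselect => [h|]; last by case; exists W.
congr (- _); set W' := projT1 _.
have fW' : HW_grad D q f W' := projT2 (cid h).
have [_ LW _] := fW; have [v [_ _ Wv]] := LpH_rep conjugate_gt1 LW.
rewrite (hdot_rep Wv); apply: hdot_rep.
have W'W := weak_hgrad_unique conjugate_gt1 fW' fW.
apply: (@filterS2 _ _ (ae_filter_ringOfSetsType la) _ _ _ _ W'W Wv) => x e e' Dx.
by rewrite e// e'.
Qed.

Lemma grad_pairing_lin (a : R) f f' : HW D q f -> HW D q f' ->
  grad_pairing (fun x => a * f x + f' x) = a * grad_pairing f + grad_pairing f'.
Proof.
move=> [W fW] [W' fW'].
rewrite (grad_pairingE (HW_grad_lin conjugate_gt1 a fW fW')).
rewrite (grad_pairingE fW) (grad_pairingE fW').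
have [_ LW _] := fW; have [_ LW' _] := fW'.
have [v [vL _ Wv]] := LpH_rep conjugate_gt1 LW.
have [v' [vL' _ Wv']] := LpH_rep conjugate_gt1 LW'.
rewrite (hdot_rep Wv) (hdot_rep Wv') (@hdot_rep _ (fun x => a *: v x + v' x)); last first.
  apply: (@filterS2 _ _ (ae_filter_ringOfSetsType la) _ _ _ _ Wv Wv') => x e e' Dx.
  by rewrite e// e'.
rewrite mulrN -opprD -RintegralZl//; last exact: hdot_rep_integrable.
rewrite -RintegralD//; last 2 first.
- by apply: (integrableZl measurableT a (hdot_rep_integrable vL)).
- exact: hdot_rep_integrable.
by congr (- _); apply: eq_Rintegral => x _; rewrite hdotDl hdotZl.
Qed.

(** Cauchy-Schwarz pointwise, then Hoelder: the constant is the L^p norm of |w|, and the L^q norm of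
    f is added for free. *)
Lemma grad_pairing_bound f W : HW_grad D q f W ->
  (`|grad_pairing f|%:E <= (fine 'N[la]_(p%:E)[EFin \o (fun x => hnorm (w x))])%:E *
     (Lp_norm D q f + Lp_norm D q (@hnorm R n \o W)))%E.
Proof.
move=> fW; rewrite (grad_pairingE fW) normrN.
have [_ LW _] := fW; have [v [vL v0 Wv]] := LpH_rep conjugate_gt1 LW.
have iv := hdot_rep_integrable vL.
have mv k := Lfun_measurable (vL k).
have mw := Lfun_measurable wN.
have mhv : measurable_fun [set: E] (fun x => hnorm (v x)) by exact: measurable_hnorm.
rewrite (hdot_rep Wv) /Rintegral -abse_EFin fineK; last exact: integrable_fin_num iv.
have Nfin : 'N[la]_(p%:E)[EFin \o (fun x => hnorm (w x))]%E \is a fin_num.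
  by rewrite ge0_fin_numE ?Lnorm_ge0//; move: wN; rewrite inE => /andP[_]; rewrite inE.
rewrite fineK//.
apply: le_trans (le_abse_integral la measurableT (measurable_int _ iv)) _.
have H1 := hoelder la mhv mw q0 p0 conjugate_invD.
have H2 : (\int[la]_x `|(hdot (v x) (w x))%:E| <=
    'N[la]_1[EFin \o ((fun x => hnorm (v x)) \* (fun x => hnorm (w x)))%R])%E.
  rewrite Lnorm1; apply: le_integral_ae; apply: aeW => x _.
  by rewrite lee_fin /= (ger0_norm (mulr_ge0 (hnorm_ge0 _) (hnorm_ge0 _))) hdot_norm_le.
apply: (le_trans H2); apply: (le_trans H1).
rewrite muleC lee_wpmul2l ?Lnorm_ge0//.
apply: (@le_trans _ _ (Lp_norm D q (@hnorm R n \o W))); last by rewrite leeDr ?Lnorm_ge0.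
apply: le_Lnorm_ae => //.
apply: (@filterS _ _ (ae_filter_ringOfSetsType la) _ _ _ Wv) => x e.
rewrite /= patchE; case: ifPn => [/set_mem Dx|]; first by rewrite /= e.
by rewrite notin_setE => /v0 ->; rewrite /hnorm /hdot big1 ?sqrtr0// => k _; rewrite mxE mul0r.
Qed.

Lemma divergence_in_HW_dual (mu nu : probability (borel (cldom Om)) R) :
  divH_eq (Om := Om) w mu nu -> in_HW_dual_diamond q mu nu.
Proof.
move=> wdiv.
have smoothE phi : smooth phi -> grad_pairing phi = measure_diff mu nu phi.
  by move=> sphi; rewrite (grad_pairingE (smooth_HW_grad Om q0 sphi)) wdiv.
exists grad_pairing => //; split; first split.
- exact: grad_pairing_lin.
- by eexists; exact: grad_pairing_bound.
(* The value at 1 is the difference of the total masses of two probability measures. *)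
- rewrite smoothE; last by move=> k; exact: Ck_cst.
  have one (m : probability (borel (cldom Om)) R) : \int[m]_x cst (1 : R) (val x) = 1.
    rewrite /Rintegral (integral_cst _ measurableT 1%:E) mul1e.
    exact: (congr1 fine (@probability_setT _ _ _ m)).
  by rewrite /measure_diff !one subrr.
Qed.

End divergence_functional.

Theorem proposition5p13 (R : realType) (n : nat) (hn : (0 < n)%N)
    (Om : bounded_domain R (n + n + 1)) (hOm : C11_boundary Om)
    (p q : R) (hp : 1 < p) (hq : q = p / (p - 1))
    (mu nu : probability (borel (cldom Om)) R)
    (G : heis R n -> R -> R)
    (hGmeas : forall i, 0 <= i ->
       lebesgue_measurable_fun (closure Om) (fun x => G x i))
    (hG0 : forall x, closure Om x -> G x 0 = 0)
    (hGconvex : forall x, closure Om x -> forall i j t : R,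
       0 <= i -> 0 <= j -> 0 <= t <= 1 ->
       G x (t * i + (1 - t) * j) <= t * G x i + (1 - t) * G x j)
    (hGmono : forall x, closure Om x -> forall i j : R,
       0 <= i -> i <= j -> G x i <= G x j)
    (hGgrowth : exists (a b : R) (h0 h1 : heis R n -> R),
       [/\ 0 < a /\ 0 < b, Lp Om p h0 /\ Lp Om p h1,
           forall x, closure Om x -> 0 <= h0 x /\ 0 <= h1 x &
           forall x, closure Om x -> forall i : R, 0 <= i ->
             a / p * (i `^ p) - h0 x <= G x i /\
             G x i <= b / p * (i `^ p) + h1 x]) :
  [/\ traffic_plan_p p mu nu !=set0 -> in_HW_dual_diamond q mu nu,
      forall Q, traffic_plan_p p mu nu Q ->
        forall i, intensity_density p Q i ->
          exists w, [/\ vector_intensity_density p Q w, divH_eq w mu nu &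
            {ae lebesgue_rV R (n + n + 1),
               forall x, (Om : set _) x -> hnorm (w x) <= i x}] &
      (ereal_inf
         [set \int[lebesgue_rV R (n + n + 1)]_(x in Om) (G x (hnorm (w x)))%:E
         | w in [set w | LpH Om p w /\ divH_eq w mu nu]] <=
       ereal_inf
         [set \int[lebesgue_rV R (n + n + 1)]_(x in Om) (G x (i x))%:E
         | i in [set i | exists2 Q, traffic_plan_p p mu nu Q &
                           intensity_density p Q i]])%E].
Proof.
have p0 : 0 < p := lt_trans ltr01 hp.
have part2 Q : traffic_plan_p p mu nu Q -> forall i, intensity_density p Q i ->
    exists w : borel (heis R n) -> horiz R n,
    [/\ vector_intensity_density p Q w, divH_eq w mu nu,
      (forall k, (fun x => w x ord0 k) \in Lfun (lebesgue_rV R (n + n + 1)) p%:E),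
      (forall x, ~ (Om : set _) x -> w x = 0) &
      {ae lebesgue_rV R (n + n + 1),
        forall x, (Om : set _) x -> hnorm (w x) <= i x}].
  by move=> [[? hQ ? ?] _] i hi; exact: (vector_intensity_exists hQ hp hi).
split.
- move=> [Q QP]; have [_ [i hi]] := QP; have [w [_ wdiv wL w0 wi]] := part2 Q QP i hi.
  have mOm : measurable (Om : set (borel (heis R n))).
    by apply: measurable_open; exact: dom_open.
  have [Li _] := hi; have [g [gL _ ig]] := Lp_rep p0 mOm Li.
  apply: (divergence_in_HW_dual hp hq wL w0 _ wdiv).
  (* |w| is in L^p because |w| <= i = g almost everywhere on Om, and w is 0 elsewhere. *)
  apply: (Lfun_dominated p0 _ _ gL).
    by apply: measurable_hnorm => k; exact: (Lfun_measurable (wL k)).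
  apply: (@filterS2 _ _ (ae_filter_ringOfSetsType _) _ _ _ _ wi ig) => x wx ix.
  rewrite ger0_norm ?hnorm_ge0//; have [Ox|/w0 ->] := pselect ((Om : set _) x).
    by rewrite -ix// (le_trans (wx Ox))// ler_norm.
  by rewrite /hnorm /hdot big1 ?sqrtr0// => k _; rewrite mxE mul0r.
- move=> Q QP i hi; have [w [? ? _ _ ?]] := part2 Q QP i hi.
  by exists w.
- apply: le_ereal_inf_tmp => _ [i [Q QP hi] <-].
  have [w [[wL _] wdiv _ _ wi]] := part2 Q QP i hi.
  apply: ge_ereal_inf; eexists; first by exists w; [split|reflexivity].
  (* Almost everywhere on Om, 0 <= |w| <= i, so monotonicity of G in its second argument compares
     the integrands; thus w is a competitor doing at least as well as i. *)
  apply: le_integral_ae.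
  apply: (@filterS _ _ (ae_filter_ringOfSetsType _) _ _ _ wi) => x wx Ox.
  rewrite lee_fin; apply: hGmono; [exact: subset_closure|exact: hnorm_ge0|exact: wx].
Qed.
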